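(* (Restricted logarithmic Sobolev inequality.) Let $(W,H,\mu_W)$ be an abstract Wiener space, let $x$ be a random variable with law $\mu_X$ satisfying the standing assumptions listed in the context, independent of the Wiener noise $w$, let $y=\rho x+w$ with $\rho$ a real scalar, and let $\ell=d\mu_Y/d\mu_W$. Then $$E_0\,\ell(w)\log\ell(w)\le\tfrac12\,E_0\,\ell(w)\,|\nabla\log\ell(w)|_H^2 .$$ Consequently, for $c>0$ and $f=\sqrt{c\,\ell}$ (so $f^2=c\,\ell$), $$E_0\,f^2(w)\log|f(w)|\le E_0f^2\cdot\log\bigl(E_0f^2\bigr)^{1/2}+E_0|\nabla f(w)|_H^2 .$$
   Context: Abstract Wiener space: $W$ is a separable Banach space, $H$ (the Cameron-Martin space) is a Hilbert space densely and continuously embedded in $W$, the dual $W^*$ is densely and continuously embedded in $H$ (so $W^*\subset H\subset W$), and $\mu_W$ is the probability measure on $W$ such that for every $e\in W^*$ the random variable $\delta e:=\langle w,e\rangle$ is $N(0,|e|_H^2)$. Channel: $x$ is an $H$-valued random variable with law $\mu_X$; $(x,w)$ lives on $H\times W$ with the product measure $\mu_X\times\mu_W$ (so $x$ and $w$ are independent), and $y=\rho x+w$, where $\rho$ is a real scalar and $x$ is identified with its image in $W$. Standing assumptions on $x$: $x$ takes values in $W^*$, and $\exp(\alpha(x,h)_H)\in L^1(\mu_X)$ for all $\alpha\in\mathbb{R}$ and all $h\in W^*$. Notation: $\mu_Y$ is the law of $y$ on $W$; the likelihood ratio is $\ell(w)=\frac{d\mu_Y}{d\mu_W}(w)=\int_H\exp(\rho\langle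 w,x\rangle-\frac{\rho^2}{2}|x|_H^2)\,\mu_X(dx)$. $E_0$ is expectation with respect to $\mu_W$; the convention $0\log 0=0$ is used. Malliavin derivative: for smooth cylindrical $F=f(\delta e_1,\dots,\delta e_n)$ with $e_i\in W^*$, $\nabla F=\sum_i \partial_i f(\delta e_1,\dots,\delta e_n)\,e_i$, extended by closability in $L^2(\mu_W)$. *)

(* Defs.v *)
From HB Require Import structures.
From mathcomp Require Import all_boot all_order all_algebra.
From mathcomp Require Export sesquilinear.
From mathcomp Require Import all_classical all_reals all_analysis.

Set Implicit Arguments.
Unset Strict Implicit.
Unset Printing Implicit Defensive.

Import Order.TTheory GRing.Theory Num.Theory.
Import numFieldNormedType.Exports.

Local Open Scope classical_set_scope.
Local Open Scope ring_scope.

(* A topological space with its Borel sigma-algebra. *)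
Notation borel T := (g_sigma_algebraType (@open T)).

(* The topological dual of W; the application e w is the pairing <w, e>. *)
Record dual (R : realType) (W : normedModType R) := Dual {
  dual_fun :> {linear W -> R^o} ;
  dual_continuous : continuous dual_fun }.

(* N(0, s^2). The library's normal_prob is the Gaussian law only for s != 0,
   whereas N(0, 0), the law of the functional 0, is the Dirac mass at 0. *)
Definition centered_gaussian (R : realType) (s : R) (A : set R) : \bar R :=
  if s == 0 then dirac (0 : measurableTypeR R) A else normal_prob 0 s A.

(* i : H -> W and j : W^* -> H are the two embeddings of W^* < H < W. The field
   aws_riesz says that j is the adjoint of i once H is identified with its
   dual. *)
Record abstract_wiener_space (R : realType) (W H : completeNormedModType R)
    (ip : {dot H for (@idfun R)}) (i : {linear H -> W}) (j : dual W -> H)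
    (muW : probability (borel W) R) : Prop := AbstractWienerSpace {
  aws_separable : exists2 D : set W, countable D & dense D ;
  aws_hilbert : forall h : H, ip h h = `|h| ^+ 2 ;
  aws_i_continuous : continuous i ;
  aws_i_injective : injective i ;
  aws_i_dense : dense (range i) ;
  aws_riesz : forall (e : dual W) (h : H), ip (j e) h = e (i h) ;
  aws_j_injective : forall e1 e2 : dual W, j e1 = j e2 -> e1 =1 e2 ;
  aws_j_continuous : exists C : R, forall (e : dual W) (M : R),
    (forall w : W, `|e w| <= M * `|w|) -> `|j e| <= C * M ;
  aws_j_dense : dense (range j) ;
  aws_gaussian : forall (e : dual W) (A : set R), measurable A ->
    pushforward muW e A = centered_gaussian `|j e| A }.

(* k-fold differentiability with bounded partial derivatives up to order k. *)
Fixpoint Cb (R : realType) (n k : nat) (f : 'rV[R]_n -> R) : Prop :=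
  (exists M : R, forall x, `|f x| <= M) /\
  match k with
  | 0 => continuous f
  | k'.+1 => (forall x, differentiable f x) /\
             forall m : 'I_n, Cb k' (fun x => 'D_(delta_mx 0 m) f x)
  end.

Definition smooth_bounded (R : realType) (n : nat) (f : 'rV[R]_n -> R) : Prop :=
  forall k, Cb k f.

Section malliavin.
Context (R : realType) (W H : completeNormedModType R) (j : dual W -> H)
  (muW : probability (borel W) R).

(* F = f(<., e_1>, ..., <., e_n>) with f smooth, and G is its gradient
   \sum_m (d_m f)(<., e_1>, ..., <., e_n>) e_m. *)
Definition cylindrical_gradient (F : W -> R) (G : W -> H) : Prop :=
  exists (n : nat) (f : 'rV[R]_n -> R) (e : 'I_n -> dual W),
    let delta (w : W) : 'rV[R]_n := \row_m e m w in
    [/\ smooth_bounded f,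
        forall w, F w = f (delta w) &
        forall w, G w = \sum_(m < n) 'D_(delta_mx 0 m) f (delta w) *: j (e m)].

(* The closure in L^2(muW) x L^2(muW; H) of the gradient on smooth cylindrical
   functions. *)
Definition L2_gradient (F : W -> R) (G : W -> H) : Prop :=
  [/\ measurable_fun [set: borel W] (F : borel W -> R),
      measurable_fun [set: borel W] (G : borel W -> borel H) &
      exists (Fk : nat -> W -> R) (Gk : nat -> W -> H),
        [/\ forall k, cylindrical_gradient (Fk k) (Gk k),
            (\int[muW]_w (`|Fk k w - F w| ^+ 2)%:E)%E @[k --> \oo] --> 0%E &
            (\int[muW]_w (`|Gk k w - G w| ^+ 2)%:E)%E @[k --> \oo] --> 0%E]].

(* The usual local extension of the closed operator: F need only agree with
   elements of the L^2 domain on measurable sets that cover W up to a null set.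
   Taking A k = W recovers L2_gradient. The extension matters because neither
   the likelihood ratio nor its logarithm need belong to the L^2 domain. *)
Definition malliavin_gradient (F : W -> R) (G : W -> H) : Prop :=
  measurable_fun [set: borel W] (G : borel W -> borel H) /\
  exists (A : nat -> set (borel W)) (Fk : nat -> W -> R) (Gk : nat -> W -> H),
    [/\ forall k, measurable (A k),
        {ae muW, forall w, (\bigcup_k A k) w},
        forall k, L2_gradient (Fk k) (Gk k) &
        forall k, {ae muW, forall w, A k w -> Fk k w = F w /\ Gk k w = G w}].

End malliavin.

Section channel.
Context (R : realType) (W H : completeNormedModType R)
  (ip : {dot H for (@idfun R)}) (i : {linear H -> W}) (j : dual W -> H)
  (muW : probability (borel W) R) (muX : probability (borel H) R).

Definition admissible_input : Prop :=
  {ae muX, forall x, range j x} /\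
  forall (alpha : R) (e : dual W),
    muX.-integrable setT (fun x => (expR (alpha * ip x (j e)))%:E).

(* The law of y = rho x + w, where (x, w) has law muX \x muW. *)
Definition output_law (rho : R) : set (borel W) -> \bar R :=
  pushforward (muX \x muW)%E
    (fun xw : borel H * borel W => (rho *: i xw.1 + xw.2 : W) : borel W).

(* l is a version of the Radon-Nikodym density d muY / d muW. *)
Definition likelihood_ratio (rho : R) (l : W -> R) : Prop :=
  [/\ measurable_fun [set: borel W] (l : borel W -> R),
      forall w, 0 <= l w &
      forall A : set (borel W), measurable A ->
        output_law rho A = (\int[muW]_(w in A) (l w)%:E)%E].

End channel.

(* Main.v *)
Require Import Defs.
From HB Require Import structures.
From mathcomp Require Import all_boot all_order all_algebra.
From mathcomp Require Import all_classical all_reals all_analysis.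
From mathcomp Require Import measurable_realfun ring lra.

Set Implicit Arguments.
Unset Strict Implicit.
Unset Printing Implicit Defensive.

Import Order.TTheory GRing.Theory Num.Theory.
Import numFieldNormedType.Exports.

Local Open Scope classical_set_scope.
Local Open Scope ring_scope.

(* Write h = j e for e in W^* and Psi t = t ln t - t + 1, so that
   E_0 l ln l = E_0 Psi(l).

   Projecting y on finitely many orthonormal directions gives a finite-dimensional
   likelihood ratio lik s, a strictly positive Gaussian mixture. Adding one direction e
   and disintegrating muW along it, the one-dimensional Gaussian logarithmic Sobolev
   inequality (proved by monotone transport to the Gaussian) bounds the increase of
   E_0 Psi(lik s) by E_0 (d_e lik)^2 / (2 lik). Since lik is a conditional expectation of
   l, Jensen's inequality replaces this by E_0 l <S, h>^2 / 2 with S = grad ln l, and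
   Bessel's inequality sums over directions: E_0 Psi(lik s) <= E_0 l |S|^2 / 2. By duality,
   E_0 l f <= E_0 l |S|^2 / 2 + E_0 e^f - 1 for bounded cylindrical f, hence for all
   bounded measurable f, and f = ln l (truncated) gives the bound for E_0 Psi(l).

   What remains is to identify the gradient, which is only given locally as a closure of
   the gradient of cylindrical functions. The law of (signal, y) yields, by
   Radon-Nikodym, a function m with E[f(y) rho <x, h>] = E_0 f m; by the Cameron-Martin
   theorem m is the derivative of t |-> l(w + t h) in L^1(muW). An element F of the
   L^2 domain is differentiable in the same sense, with derivative <grad F, h>. Translates
   w + t h with t small stay, for almost all w in a measurable set A, in A for infinitely
   many t = 1/(n+1), so on a set where F = phi(l) the slopes of F and l can be compared:
   <grad F, h> = phi'(l) m. This covers ln l and sqrt(c l) alike. *)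

(** * Functionals and Borel sets *)

(** All that is given about [muW] is the law of single functionals. The Borel sets, the independence
    of orthogonal directions and the shift formula must be recovered from these one-dimensional
    Gaussian laws, hence Hahn-Banach and characteristic functionals at the start. The main obstacle
    is that [l] is merely integrable and may vanish, and that a gradient is prescribed only
    piecewise on measurable sets with no regularity. The finite-dimensional ratios are smooth and
    positive, and the gradient meets them only through an identity for [l <S, h>] against bounded
    test functions. Differentiability in L^1 is a notion shared by [l] and by the elements of the
    L^2 domain. [Psi] replaces [t ln t] because it is nonnegative: its integrals make sense before
    any finiteness is known, and Tonelli and Fatou apply. Duality spares the convergence of [lik s]
    to [l]: it is enough that bounded functions are approximated by cylindrical ones in L^1 for the
    measure [(1 + l) muW]. *)

Section hahn_banach.
Variables (R : realType) (W : normedModType R).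

Lemma dual_of_fun (f : W -> R) (C : R) :
  (forall a x y, f (a *: x + y) = a * f x + f y) ->
  (forall x, `|f x| <= C * `|x|) -> exists e : dual W, forall x, e x = f x.
Proof.
move=> lf bf.
pose g : {linear W -> R^o} := HB.pack f (GRing.isLinear.Build R W R^o *:%R f lf).
have cg : continuous g.
  apply/linear_bounded_continuous/linear_boundedP.
  apply: filterS (nbhs_pinfty_ge (num_real C)) => M CM x.
  by apply: (le_trans (bf x)); apply: ler_wpM2r.
by exists (Dual cg).
Qed.

(* Partial functionals are encoded by their graphs, so that Zorn's lemma applies to inclusion. *)
Definition linear_graph (G : set (W * R)) :=
  forall a p q, G p -> G q -> G (a *: p.1 + q.1, a * p.2 + q.2).

Definition dominated_graph (G : set (W * R)) := forall p, G p -> p.2 <= `|p.1|.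

Definition line_graph (w0 : W) : set (W * R) :=
  [set p | exists t, p = (t *: w0, t * `|w0|)].

Lemma linear_line_graph w0 : linear_graph (line_graph w0).
Proof.
move=> a _ _ [t ->] [s ->]; exists (a * t + s) => /=.
by rewrite scalerA -scalerDl mulrA -mulrDl.
Qed.

Lemma dominated_line_graph w0 : dominated_graph (line_graph w0).
Proof. by move=> _ [t ->] /=; rewrite normrZ ler_wpM2r// ler_norm. Qed.

(** Domination forces the value [c] at [w] to lie above every [p.2 - |p.1 - w|] and below every
    [|p.1 + w| - p.2]. Each lower bound is below each upper bound by domination on [A] and the
    triangle inequality, so the supremum of the lower bounds is admissible; scaling by [t^-1] then
    handles all multiples of [w]. *)
Lemma extend_graph (A : set (W * R)) (w : W) :
  A (0, 0) -> linear_graph A -> dominated_graph A ->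
  exists B c, [/\ A `<=` B, B (w, c), linear_graph B & dominated_graph B].
Proof.
move=> A0 lA dA.
pose S := [set x | exists2 p, A p & x = p.2 - `|p.1 - w|].
have bS p x : A p -> S x -> x <= `|p.1 + w| - p.2.
  move=> Ap [q Aq ->].
  have := dA _ (lA 1 _ _ Ap Aq); rewrite /= scale1r mul1r => h1.
  have := ler_normD (p.1 + w) (q.1 - w).
  rewrite addrACA subrr addr0 => h2; lra.
have supS : has_sup S.
  split; first by exists (0 - `|0 - w|), (0, 0).
  by exists (`|0 + w| - 0) => x Sx; apply: (bS (0, 0)).
pose c := sup S.
have cl p : A p -> p.2 - `|p.1 - w| <= c.
  by move=> Ap; apply: sup_upper_bound => //; exists p.
have cu p : A p -> c <= `|p.1 + w| - p.2.
  by move=> Ap; apply: ge_sup; [case: supS|move=> x; exact: bS].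
pose B := [set p : W * R | exists t q, A q /\ p = (q.1 + t *: w, q.2 + t * c)].
exists B, c; split.
- by move=> [p1 p2] Ap; exists 0, (p1, p2); split=> //=; rewrite scale0r mul0r !addr0.
- by exists 1, (0, 0); split=> //=; rewrite scale1r mul1r !add0r.
- move=> a _ _ [t [q [Aq ->]]] [s [r [Ar ->]]] /=.
  exists (a * t + s), (a *: q.1 + r.1, a * q.2 + r.2); split; first exact: lA.
  rewrite /= !scalerDr scalerA scalerDl !mulrDr !mulrDl !mulrA.
  by rewrite addrACA [in X in _ = (_, X)]addrACA.
- have sc s q : A q -> A (s *: q.1, s * q.2).
    by move=> Aq; have := lA s _ _ Aq A0; rewrite /= !addr0.
  move=> _ [t [q [Aq ->]]] /=.
  have [t0|t0|->] := ltgtP t 0; last by rewrite scale0r mul0r !addr0; exact: dA.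
  + have := cl _ (sc (- t^-1) _ Aq); rewrite /= lerBlDr.
    have t1 : 0 < - t by rewrite oppr_gt0.
    rewrite -(ler_pM2l t1) mulrDr mulrA mulrNN divff ?lt_eqF// mul1r.
    rewrite -{2}(ger0_norm (ltW t1)) -normrZ scalerBr scalerA mulrNN divff ?lt_eqF//.
    by rewrite scale1r scaleNr opprK mulNr addrC -lerBlDr opprK.
  + have := cu _ (sc t^-1 _ Aq); rewrite /= -(ler_pM2l t0) mulrBr mulrA divff ?gt_eqF//.
    rewrite mul1r -{2}(gtr0_norm t0) -normrZ scalerDr scalerA divff ?gt_eqF// scale1r.
    by rewrite lerBrDr addrC.
Qed.

Lemma hahn_banach (w0 : W) :
  exists e : dual W, e w0 = `|w0| /\ forall w, `|e w| <= `|w|.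
Proof.
set L := line_graph w0.
(* Joining [L] to each candidate makes even the union of an empty chain satisfy [P]. *)
pose P (G : set (W * R)) := linear_graph (G `|` L) /\ dominated_graph (G `|` L).
have [F FP totF|A [[lA dA] maxA]] := @Zorn_bigcup _ P.
  split.
    move=> a p q [[X FX Xp]|Lp] [[Y FY Yq]|Lq].
    - wlog XY : X Y FX FY Xp Yq / X `<=` Y.
        move=> wl; have [XY|YX] := totF _ _ FX FY; first exact: (wl X Y).
        by apply: (wl X X) => //; exact: YX.
      have [] := (FP _ FY).1 a p q; [by left; apply: XY|by left| |by right].
      by left; exists Y.
    - by have [] := (FP _ FX).1 a p q; [left|right|left; exists X|right].
    - by have [] := (FP _ FY).1 a p q; [right|left|left; exists Y|right].
    - by right; exact: linear_line_graph.
  move=> p [[X FX Xp]|Lp]; last by apply: dominated_line_graph Lp.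
  by apply: (FP _ FX).2; left.
have L0 : (A `|` L) (0, 0) by right; exists 0; rewrite scale0r mul0r.
have total w : exists r, (A `|` L) (w, r).
  apply: contrapT => Nw.
  have [B [c [AB Bw lB dB]]] := extend_graph w L0 lA dA.
  have BL : B `|` L = B by apply/setUidPl => x Lx; apply: AB; right.
  apply: (maxA B); last by rewrite /P BL.
  split; first by move=> x Ax; apply: AB; left.
  by move/(_ _ Bw) => Aw; apply: Nw; exists c; left.
have [f fA] := choice total.
(* The graph is single-valued thanks to domination alone: the differences [(0, r - r')] and
   [(0, r' - r)] both belong to it. *)
have uniq w r r' : (A `|` L) (w, r) -> (A `|` L) (w, r') -> r = r'.
  move=> h h'; apply/eqP; rewrite eq_le; apply/andP; split.
    by have := dA _ (lA (-1) _ _ h' h); rewrite /= scaleN1r addNr normr0 mulN1r addrC subr_le0.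
  by have := dA _ (lA (-1) _ _ h h'); rewrite /= scaleN1r addNr normr0 mulN1r addrC subr_le0.
have lf a x y : f (a *: x + y) = a * f x + f y.
  by apply: uniq (fA _) _; exact: (lA a _ _ (fA x) (fA y)).
have f0 : f 0 = 0 by exact: uniq (fA _) L0.
have bf w : `|f w| <= 1 * `|w|.
  rewrite mul1r ler_norml (dA _ (fA w)) andbT lerNl.
  have := dA _ (fA (- w)); rewrite /= normrN; apply: le_trans.
  by have := lf (-1) w 0; rewrite f0 !addr0 scaleN1r mulN1r => ->.
have [e ef] := dual_of_fun lf bf; exists e; split; last first.
  by move=> w; rewrite ef; have := bf w; rewrite mul1r.
by rewrite ef; apply: uniq (fA _) _; right; exists 1; rewrite scale1r mul1r.
Qed.

End hahn_banach.

Section borel_dual.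
Variables (R : realType) (W : completeNormedModType R).

Lemma dense_sequence : (exists2 D : set W, countable D & dense D) ->
  exists d : nat -> W, forall w (e : R), 0 < e -> exists n, `|w - d n| < e.
Proof.
move=> [D cD dD].
have [x [_ Dx]] := dD setT (ex_intro _ (0 : W) I) openT.
have D0 : D !=set0 by exists x.
have [d dE] : exists d : nat -> W, D `<=` range d.
  have /countable_injP [f finj] := cD.
  exists (fun n => xget x [set y | D y /\ f y = n]) => y Dy; exists (f y) => //=.
  have [Dz fz] : [set z | D z /\ f z = f y] (xget x [set z | D z /\ f z = f y]).
    by apply: xgetPex; exists y.
  by apply: finj fz; rewrite inE.
exists d => w e e0.
have [] := dD (ball w e); first by exists w; exact: ballxx.
  exact: ball_open.
move=> y [+ /dE [n _ yn]]; rewrite -yn -ball_normE /= => ?.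
by exists n.
Qed.

(** By separability the norm is a supremum of countably many norming functionals. A closed ball is
    therefore a countable intersection of half-spaces, and an open set a countable union of such
    balls, so half-spaces generate the Borel sets. *)
Lemma borel_dual_ind (C : set (set W)) :
  (exists2 D : set W, countable D & dense D) ->
  C set0 -> (forall A, C A -> C (~` A)) ->
  (forall F : nat -> set W, (forall n, C (F n)) -> C (\bigcup_n F n)) ->
  (forall (e : dual W) a, C [set w | a < e w]) ->
  forall A : set (borel W), measurable A -> C A.
Proof.
move=> sepW C0 CC CU Ce A mA.
have [d dd] := dense_sequence sepW.
have [ed edP] := choice (fun n => hahn_banach (d n)).
have CI (F : nat -> set W) : (forall n, C (F n)) -> C (\bigcap_n F n).
  by move=> CF; rewrite -(setCK (\bigcap_n F n)) setC_bigcap; apply/CC/CU => n; exact: CC.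
have ball c r : C [set w | `|w - c| <= r].
  rewrite (_ : [set _ | _] = \bigcap_n ~` [set w | r + ed n c < ed n w]).
    by apply: CI => n; exact: CC.
  apply/seteqP; split => w /= h.
    move=> n _ /=; apply/negP; rewrite -leNgt addrC -lerBlDl -linearB.
    by apply: le_trans h; apply: le_trans ((edP n).2 _); exact: ler_norm.
  rewrite leNgt; apply/negP => hr.
  (* A point outside the ball is cut off by the functional norming some [d n] close to [w - c]. The
     approximation costs [eps] twice, once in the norm and once in the functional, hence half the
     gap. *)
  pose eps := (`|w - c| - r) / 2.
  have eps0 : 0 < eps by rewrite divr_gt0// subr_gt0.
  have [n dn] := dd (w - c) _ eps0.
  have /negP := h n I; rewrite -leNgt addrC -lerBlDl -linearB.
  apply/negP; rewrite -ltNge.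
  have h1 : ed n (d n) - ed n (w - c) < eps.
    rewrite -linearB; apply: le_lt_trans (ler_norm _) _.
    by apply: le_lt_trans ((edP n).2 _) _; rewrite distrC.
  have h2 : `|w - c| - `|d n| < eps.
    by apply: le_lt_trans dn; apply: lerB_dist.
  rewrite (edP n).1 in h1; rewrite /eps in h1 h2; lra.
rewrite /measurable/= in mA.
apply: (mA C); split=> //.
- by split=> // X CX; rewrite setTD; exact: CC.
- move=> U oU.
  pose B n k : set W := [set w | `|w - d n| <= k.+1%:R^-1].
  rewrite (_ : U = \bigcup_n \bigcup_k (if `[< B n k `<=` U >] then B n k else set0)).
    by apply: (CU) => n; apply: (CU) => k; case: ifP => _ //; exact: ball.
  apply/seteqP; split => w.
    move=> Uw.
    have /nbhs_ballP [e /= e0 he] : nbhs w U by exact: open_nbhs_nbhs.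
    have [k hk] : exists k, k.+1%:R^-1 < e / 2.
      have e2 : 0 < e / 2 by rewrite divr_gt0.
      have [k _ hk] := near_infty_natSinv_lt (PosNum e2).
      by exists k; exact: (hk k (leqnn _)).
    have [n hn] := dd w k.+1%:R^-1 (ltac:(by rewrite invr_gt0)).
    exists n => //; exists k => //; rewrite (_ : `[< _ >]).
      by rewrite /B /= ltW.
    apply/asboolP => v; rewrite /B /= => hv; apply: he; rewrite -ball_normE /=.
    rewrite (_ : w - v = (w - d n) - (v - d n)); last by rewrite opprB addrA subrK.
    apply: le_lt_trans (ler_normB _ _) _.
    move: hn hk hv; set z := k.+1%:R^-1 => /= hn hk hv; lra.
  by move=> [n _ [k _]]; case: ifPn => // /asboolP; exact.
Qed.

End borel_dual.

(** * Bounded measurable functions and transfer of integrals *)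

Section bounded_measurable.
Context d (T : measurableType d) (R : realType).
Implicit Types f g : T -> R.

Lemma measurable_lt f g : measurable_fun setT f -> measurable_fun setT g ->
  measurable [set x | f x < g x].
Proof.
move=> mf mg.
have := measurable_fun_ltr mf mg measurableT (Y := [set true]) I.
by rewrite setTI.
Qed.

Definition bounded_measurable f :=
  measurable_fun [set: T] f /\ exists M : R, forall x, `|f x| <= M.

Lemma bm_cst (c : R) : bounded_measurable (fun=> c).
Proof. by split; [exact: measurable_cst|exists `|c|]. Qed.

Lemma bm_indic (A : set T) : measurable A -> bounded_measurable (\1_A : T -> R).
Proof.
move=> mA; split; first exact: measurable_indic.
by exists 1 => x; rewrite indicE; case: (_ \in _); rewrite ?normr1 ?normr0.
Qed.

Lemma bmD f g : bounded_measurable f -> bounded_measurable g ->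
  bounded_measurable (fun x => f x + g x).
Proof.
move=> [mf [M fM]] [mg [N gN]]; split; first exact: measurable_funD.
by exists (M + N) => x; apply: le_trans (ler_normD _ _) (lerD _ _).
Qed.

Lemma bmM f g : bounded_measurable f -> bounded_measurable g ->
  bounded_measurable (fun x => f x * g x).
Proof.
move=> [mf [M fM]] [mg [N gN]]; split; first exact: measurable_funM.
by exists (M * N) => x; rewrite normrM ler_pM.
Qed.

Lemma bmZ (a : R) f : bounded_measurable f -> bounded_measurable (fun x => a * f x).
Proof. by move=> bf; apply: bmM => //; exact: bm_cst. Qed.

Lemma bmN f : bounded_measurable f -> bounded_measurable (fun x => - f x).
Proof.
by move=> [mf [M fM]]; split; [exact: measurable_funN|exists M => x; rewrite normrN].
Qed.

Lemma bmB f g : bounded_measurable f -> bounded_measurable g ->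
  bounded_measurable (fun x => f x - g x).
Proof. by move=> bf bg; apply: bmD => //; exact: bmN. Qed.

Lemma bm_integrable (mu : {finite_measure set T -> \bar R}) f :
  bounded_measurable f -> mu.-integrable setT (EFin \o f).
Proof.
move=> [mf [M fM]]; apply: measurable_bounded_integrable => //.
  by rewrite ltey_eq fin_num_measure.
exists M; split; first exact: num_real.
by move=> x Mx y _ /=; apply: le_trans (fM y) (ltW _).
Qed.

Lemma bm_integrableM (mu : {measure set T -> \bar R}) f g :
  bounded_measurable f -> mu.-integrable setT (EFin \o g) ->
  mu.-integrable setT (EFin \o (fun x => f x * g x)).
Proof.
move=> [mf [M fM]] ig.
have M0 : 0 <= M by apply: le_trans (fM point).
apply: (le_integrable measurableT (g := fun x => (M * g x)%:E)).
- apply/measurable_EFinP; apply: measurable_funM => //.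
  by apply/measurable_EFinP; exact: measurable_int ig.
- by move=> x _; rewrite /= lee_fin !normrM ler_wpM2r// (ger0_norm M0).
- rewrite (_ : (fun x => _) = (fun x => M%:E * (EFin \o g) x)%E); last by apply/funext.
  exact: (integrableZl measurableT M ig).
Qed.

(* Bounded functions are uniform limits of linear combinations of indicators of superlevel sets. *)
Lemma bm_ind (V : (T -> R) -> Prop) :
  (forall A, measurable A -> V \1_A) ->
  (forall a f g, bounded_measurable f -> bounded_measurable g -> V f -> V g ->
     V (fun x => a * f x + g x)) ->
  (forall f, bounded_measurable f ->
     (forall e : R, 0 < e -> exists g, [/\ bounded_measurable g, V g &
        forall x, `|f x - g x| <= e]) -> V f) ->
  forall f, bounded_measurable f -> V f.
Proof.
move=> V1 Vlin Vlim f bf; apply: Vlim => // e e0.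
have [mf [c fc]] := bf.
have V0 : V (fun=> 0).
  by have := V1 set0 measurable0; rewrite indic0.
pose A i := [set x | i%:R * e < f x + c].
have mA i : measurable (A i).
  apply: measurable_lt; first exact: measurable_cst.
  exact: measurable_funD.
pose s N x := - c + \sum_(i < N) e * \1_(A i) x.
have bs N : bounded_measurable (s N) /\ V (s N).
  elim: N => [|N [bN VN]].
    rewrite /s; under eq_fun do rewrite big_ord0 addr0; split; first exact: bm_cst.
    have := Vlin (- c) \1_setT (fun=> 0) (bm_indic measurableT) (bm_cst 0) (V1 _ measurableT) V0.
    by rewrite indicT; under eq_fun do rewrite mulr1 addr0.
  rewrite /s; under eq_fun do rewrite big_ord_recr /= addrA addrC.
  split; last by apply: Vlin => //; [exact: bm_indic|exact: V1].
  by apply: bmD => //; apply: bmZ; exact: bm_indic.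
(* The staircase rounds [t = f x + c >= 0] up to a multiple of [e], capped at [N * e]. Since
   [t <= 2 * c], the cap is harmless as soon as [2 * c <= N * e]. *)
have sb N x : Num.min (f x + c) (N%:R * e) <= \sum_(i < N) e * \1_(A i) x <=
              Num.min (f x + c + e) (N%:R * e).
  have t0 : 0 <= f x + c by have := fc x; rewrite ler_norml; lra.
  have AE i : \1_(A i) x = ((i%:R * e < f x + c)%R : nat)%:R :> R.
    rewrite indicE; congr (nat_of_bool _)%:R; apply/idP/idP; first by rewrite inE.
    by move=> ?; rewrite inE.
  under eq_bigr do rewrite AE.
  move: (f x + c) t0 => t t0; elim: N => [|N].
    have te : 0 <= t + e by lra.
    by rewrite big_ord0 mul0r !min_r ?lexx.
  rewrite big_ord_recr /=.
  set S := \sum_(i < N) _; rewrite -(natr1 N) mulrDl mul1r.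
  have [h|h] := ltP (N%:R * e) t.
    rewrite mulr1; move: h; set Ne := N%:R * e => h.
    rewrite !(min_r (y := Ne)); try lra; move=> SN.
    by rewrite ge_min le_min; apply/andP; split; [apply/orP; right|apply/andP; split]; lra.
  move: h; set Ne := N%:R * e => h.
  rewrite mulr0 addr0 (min_l (x := t) (y := Ne + e)); last lra.
  rewrite !le_min.
  by move=> /andP[-> /andP[-> ?]] /=; lra.
have [N hN] : exists N : nat, 2 * c <= N%:R * e.
  have c0 : 0 <= 2 * c / e.
    by rewrite divr_ge0 ?(ltW e0)// mulr_ge0//; apply: le_trans (fc point).
  by exists (Num.bound (2 * c / e)); rewrite -ler_pdivrMr// ltW// archi_boundP.
exists (s N); split; [exact: (bs N).1|exact: (bs N).2|move=> x].
have := sb N x; have := fc x.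
rewrite /s; set S := \sum_(i < N) _; rewrite !ler_norml => fx.
rewrite min_l; last lra.
by rewrite le_min => /andP[h1 /andP[h2 h3]]; lra.
Qed.

Lemma dominated_Rcvg (mu : {measure set T -> \bar R}) (f_ : nat -> T -> R) f g :
  (forall n, measurable_fun setT (f_ n)) -> measurable_fun setT f ->
  mu.-integrable setT (EFin \o g) ->
  (forall n x, `|f_ n x| <= g x) -> (forall x, f_ n x @[n --> \oo] --> f x) ->
  \int[mu]_x f_ n x @[n --> \oo] --> \int[mu]_x f x.
Proof.
move=> mf_ mf ig fg fcvg.
have h x : [set: T] x -> (f_ n x)%:E @[n --> \oo] --> (f x)%:E.
  by move=> _; apply: cvg_EFin; [exact: nearW|exact: fcvg].
have hg : {ae mu, forall x n, [set: T] x -> (`|(f_ n x)%:E| <= (EFin \o g) x)%E}.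
  by apply: aeW => x n _; rewrite /= lee_fin.
have mEf_ n : measurable_fun setT (fun x => (f_ n x)%:E) by exact/measurable_EFinP.
have mEf : measurable_fun setT (EFin \o f) by exact/measurable_EFinP.
have [i _ h'] := dominated_convergence measurableT mEf_ mEf (aeW mu h) ig hg.
apply: fine_cvg; rewrite fineK; first exact: h'.
exact: integrable_fin_num.
Qed.

Lemma bounded_cvg (mu : {finite_measure set T -> \bar R}) (f_ : nat -> T -> R) f M :
  (forall n, measurable_fun setT (f_ n)) -> measurable_fun setT f ->
  (forall n x, `|f_ n x| <= M) -> (forall x, f_ n x @[n --> \oo] --> f x) ->
  \int[mu]_x f_ n x @[n --> \oo] --> \int[mu]_x f x.
Proof.
move=> mf_ mf fM; apply: (dominated_Rcvg mf_ mf) fM.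
exact: (bm_integrable mu (bm_cst M)).
Qed.

Lemma EFin_Rintegral (mu : {measure set T -> \bar R}) f :
  mu.-integrable setT (EFin \o f) -> (\int[mu]_x f x)%R%:E = (\int[mu]_x (f x)%:E)%E.
Proof. by move=> h; rewrite fineK//; exact: integrable_fin_num. Qed.

Lemma integral_indicM (mu : {measure set T -> \bar R}) (A : set T) f :
  measurable A -> (\int[mu]_x (\1_A x * f x)%:E = \int[mu]_(x in A) (f x)%:E)%E.
Proof.
move=> mA; rewrite [RHS]integral_mkcond; apply: eq_integral => x _.
rewrite patchE indicE; case: ifP => xA; rewrite ?xA ?(negbTE xA) ?mul1r ?mul0r//.
Qed.

Lemma monotone_Rcvg (mu : {measure set T -> \bar R}) (g : nat -> T -> R) f :
  (forall n, measurable_fun setT (g n)) -> (forall n x, 0 <= g n x) ->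
  (forall x m n, (m <= n)%N -> g m x <= g n x) ->
  (forall x, g n x @[n --> \oo] --> f x) ->
  (\int[mu]_x (g n x)%:E @[n --> \oo] --> \int[mu]_x (f x)%:E)%E.
Proof.
move=> mg g0 gnd gf.
have mEg n : measurable_fun setT (fun x => (g n x)%:E) by exact/measurable_EFinP.
have Eg0 n x : [set: T] x -> (0 <= (g n x)%:E)%E by rewrite lee_fin.
have Egnd x : [set: T] x -> {homo (fun n => (g n x)%:E) : n m / (n <= m)%N >-> (n <= m)%E}.
  by move=> _ m n mn; rewrite lee_fin gnd.
have := cvg_monotone_convergence (mu := mu) measurableT mEg Eg0 Egnd.
rewrite (eq_integral (fun x => (f x)%:E))// => x _.
by apply/cvg_lim => //; apply: cvg_EFin; [exact: nearW|exact: gf].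
Qed.

Lemma ge0_integralZl_real (mu : {measure set T -> \bar R}) f k :
  0 <= k -> (forall x, 0 <= f x) -> measurable_fun setT f ->
  (\int[mu]_x (k * f x)%:E = k%:E * \int[mu]_x (f x)%:E)%E.
Proof.
move=> k0 f0 mf; rewrite -ge0_integralZl_EFin//.
- by move=> x _; rewrite lee_fin.
- exact/measurable_EFinP.
Qed.

Lemma ge0_integralD_real (mu : {measure set T -> \bar R}) f g :
  (forall x, 0 <= f x) -> (forall x, 0 <= g x) ->
  measurable_fun setT f -> measurable_fun setT g ->
  (\int[mu]_x (f x + g x)%:E = \int[mu]_x (f x)%:E + \int[mu]_x (g x)%:E)%E.
Proof.
move=> f0 g0 mf mg; rewrite -ge0_integralD//.
- by move=> x _; rewrite lee_fin.
- exact/measurable_EFinP.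
- by move=> x _; rewrite lee_fin.
- exact/measurable_EFinP.
Qed.

Lemma ge0_le_integral_real (mu : {measure set T -> \bar R}) f g :
  (forall x, 0 <= f x <= g x) -> measurable_fun setT f -> measurable_fun setT g ->
  (\int[mu]_x (f x)%:E <= \int[mu]_x (g x)%:E)%E.
Proof.
move=> fg mf mg; apply: ge0_le_integral => //.
- by move=> x _; rewrite lee_fin; case/andP: (fg x).
- exact/measurable_EFinP.
- exact/measurable_EFinP.
- by move=> x _; rewrite lee_fin; case/andP: (fg x).
Qed.

Lemma integrable_EFinD (mu : {measure set T -> \bar R}) f g :
  mu.-integrable setT (EFin \o f) -> mu.-integrable setT (EFin \o g) ->
  mu.-integrable setT (EFin \o (fun x => f x + g x)).
Proof. by move=> hf hg; exact: (integrableD measurableT hf hg). Qed.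

Lemma integrable_EFinZ (mu : {measure set T -> \bar R}) (a : R) f :
  mu.-integrable setT (EFin \o f) -> mu.-integrable setT (EFin \o (fun x => a * f x)).
Proof. by move=> hf; exact: (bm_integrableM (bm_cst a) hf). Qed.

Lemma integrable_EFinN (mu : {measure set T -> \bar R}) f :
  mu.-integrable setT (EFin \o f) -> mu.-integrable setT (EFin \o (fun x => - f x)).
Proof. by move=> hf; exact: (integrableN hf). Qed.

Lemma integrable_EFinB (mu : {measure set T -> \bar R}) f g :
  mu.-integrable setT (EFin \o f) -> mu.-integrable setT (EFin \o g) ->
  mu.-integrable setT (EFin \o (fun x => f x - g x)).
Proof. by move=> hf hg; apply: integrable_EFinD hf (integrable_EFinN hg). Qed.

Lemma integrable_real_le (mu : {measure set T -> \bar R}) f g :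
  measurable_fun setT f -> (forall x, `|f x| <= g x) ->
  mu.-integrable setT (EFin \o g) -> mu.-integrable setT (EFin \o f).
Proof.
move=> mf fg ig; apply: (le_integrable measurableT _ _ ig); first exact/measurable_EFinP.
by move=> x _; rewrite /= lee_fin; apply: le_trans (fg x) (ler_norm _).
Qed.

Lemma integrable_measurable (mu : {measure set T -> \bar R}) f :
  mu.-integrable setT (EFin \o f) -> measurable_fun setT f.
Proof. by move=> hf; apply/measurable_EFinP; exact: measurable_int hf. Qed.

Lemma ge0_integrable (mu : {measure set T -> \bar R}) f :
  measurable_fun setT f -> (forall x, 0 <= f x) -> (\int[mu]_x (f x)%:E < +oo)%E ->
  mu.-integrable setT (EFin \o f).
Proof.
move=> mf f0 foo; apply/integrableP; split; first exact/measurable_EFinP.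
by under eq_integral do rewrite /= ger0_norm//.
Qed.

End bounded_measurable.

(** * Transfer of integrals along a measurable map *)

Section transfer.
Context d1 d2 (O : measurableType d1) (T : measurableType d2) (R : realType).
Variables (P : {measure set O -> \bar R}) (mu : {measure set T -> \bar R}).
Variables (Y : O -> T) (mY : measurable_fun [set: O] Y).

Lemma measurable_preimage (A : set T) : measurable A -> measurable (Y @^-1` A).
Proof. by move=> mA; rewrite -[X in measurable X]setTI; exact: mY. Qed.

Section signed.
Variables (k : O -> R) (D : T -> R).
Hypotheses (ik : P.-integrable setT (EFin \o k)) (iD : mu.-integrable setT (EFin \o D)).
Hypothesis kD : forall A, measurable A ->
  (\int[P]_(x in Y @^-1` A) (k x)%:E = \int[mu]_(w in A) (D w)%:E)%E.

(** The identity [kD] is the case of indicators. It survives uniform limits because a uniform error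
    [e] costs at most [e] times the total mass of [|k|] plus that of [|D|], which is finite. *)
Lemma bm_transfer (f : T -> R) : bounded_measurable f ->
  \int[P]_x (f (Y x) * k x) = \int[mu]_w (f w * D w).
Proof.
have bmY (g : T -> R) : bounded_measurable g -> bounded_measurable (fun x => g (Y x)).
  by move=> [mg [M gM]]; split; [exact: measurableT_comp|exists M].
move: f; apply: bm_ind.
- move=> A mA; rewrite /Rintegral; congr fine.
  rewrite (integral_indicM mu _ mA) -kD//.
  exact: (integral_indicM P k (measurable_preimage mA)).
- move=> a f g bf bg Vf Vg.
  under eq_Rintegral do rewrite mulrDl -mulrA.
  under [RHS]eq_Rintegral do rewrite mulrDl -mulrA.
  have if1 := bm_integrableM (bmY _ bf) ik; have if2 := bm_integrableM bf iD.
  have ig1 := bm_integrableM (bmY _ bg) ik; have ig2 := bm_integrableM bg iD.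
  have iaf1 := bm_integrableM (bm_cst _ a) if1.
  have iaf2 := bm_integrableM (bm_cst _ a) if2.
  rewrite RintegralD//=.
  rewrite [RHS]RintegralD//=.
  by rewrite RintegralZl// [in RHS]RintegralZl// Vf Vg.
- move=> f bf happ; apply/eqP/negPn/negP => ne.
  set a := eqbLHS in ne; set b := eqbRHS in ne.
  pose c := (\int[P]_x `|k x| + \int[mu]_w `|D w|) + 1.
  have c0 : 0 < c.
    by rewrite ltr_pwDr// addr_ge0// Rintegral_ge0.
  have ab0 : 0 < `|a - b| by rewrite normr_gt0 subr_eq0.
  have e0 : 0 < `|a - b| / (2 * c) by rewrite divr_gt0// mulr_gt0.
  have [g [bg Vg fg]] := happ _ e0.
  set e := `|a - b| / (2 * c) in e0 fg.
  have bound d' (S : measurableType d') (nu : {measure set S -> \bar R}) (u v m : S -> R) :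
      bounded_measurable u -> bounded_measurable v -> nu.-integrable setT (EFin \o m) ->
      (forall x, `|u x - v x| <= e) ->
      `|\int[nu]_x (u x * m x) - \int[nu]_x (v x * m x)| <= e * \int[nu]_x `|m x|.
    move=> bu bv im uv.
    have iu := bm_integrableM bu im; have iv := bm_integrableM bv im.
    have iuv := bm_integrableM (bmB bu bv) im.
    have inm := integrable_norm im.
    rewrite -RintegralB// -RintegralZl//.
    under eq_Rintegral do rewrite -mulrBl.
    apply: le_trans (le_normr_Rintegral measurableT iuv) _.
    apply: le_Rintegral => //; first exact: integrable_norm.
      by have := bm_integrableM (bm_cst _ e) inm.
    by move=> x _; rewrite normrM ler_wpM2r.
  have h1 := bound _ _ _ _ _ _ (bmY _ bf) (bmY _ bg) ik (fun x => fg (Y x)).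
  have h2 := bound _ _ _ _ _ _ bf bg iD fg.
  rewrite Vg -/a in h1; rewrite -/b in h2.
  have : `|a - b| <= e * (c - 1).
    rewrite /c addrK mulrDr.
    apply: le_trans (ler_distD (\int[mu]_w (g w * D w)) _ _) _.
    by rewrite lerD// distrC.
  apply/negP; rewrite -ltNge /e.
  apply: (lt_le_trans (y := `|a - b| / (2 * c) * (2 * c))).
    by rewrite ltr_pM2l//; move: c0; clearbody c; lra.
  by rewrite divfK// gt_eqF// mulr_gt0.
Qed.

(* Test against the sign of D. *)
Lemma transfer_L1_le :
  (\int[mu]_w `|D w|%:E <= \int[P]_x `|k x|%:E)%E.
Proof.
have mD : measurable_fun setT D by apply/measurable_EFinP; exact: measurable_int iD.
pose f := fun w : T => if 0 <= D w then 1 else -1 : R.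
have bf : bounded_measurable f.
  split; last by exists 1 => x; rewrite /f; case: ifP; rewrite ?normrN normr1.
  apply: measurable_fun_ifT => //.
  exact: measurable_fun_ler.
have h := bm_transfer bf.
have bfY : bounded_measurable (fun x => f (Y x)).
  by case: bf => mf [M fM]; split; [exact: measurableT_comp|exists M].
rewrite -(EFin_Rintegral (integrable_norm iD)) -(EFin_Rintegral (integrable_norm ik)) lee_fin.
rewrite (_ : \int[mu]_w `|D w| = \int[mu]_w (f w * D w)); last first.
  apply: eq_Rintegral.
  move=> w _; rewrite /f; case: ifPn; first by move=> ?; rewrite mul1r ger0_norm.
  by rewrite -ltNge => ?; rewrite mulN1r ltr0_norm.
rewrite -h; apply: le_Rintegral => //.
- exact: bm_integrableM.
- exact: integrable_norm.
- move=> x _; apply: le_trans (ler_norm _) _; rewrite normrM /f.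
  by case: ifP; rewrite ?normrN normr1 mul1r.
Qed.

End signed.

(** Truncation at [n] reduces to bounded functions, and monotone convergence removes it; both sides
    may be infinite. *)
Lemma ge0_transfer (D f : T -> R) : mu.-integrable setT (EFin \o D) -> (P setT < +oo)%E ->
  (forall w, 0 <= D w) -> measurable_fun setT f -> (forall w, 0 <= f w) ->
  (forall A, measurable A -> P (Y @^-1` A) = \int[mu]_(w in A) (D w)%:E)%E ->
  (\int[P]_x (f (Y x))%:E = \int[mu]_w (f w * D w)%:E)%E.
Proof.
move=> iD Pfin D0 mf f0 PD.
have mD : measurable_fun setT D by apply/measurable_EFinP; exact: measurable_int iD.
pose g n (w : T) := Num.min (f w) n%:R.
have mg n : measurable_fun setT (g n) by exact: measurable_minr.
have g0 n w : 0 <= g n w by rewrite le_min f0 ler0n.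
have bg n : bounded_measurable (g n).
  by split=> //; exists n%:R => w; rewrite ger0_norm// ge_min lexx orbT.
have gnd w m n : (m <= n)%N -> g m w <= g n w.
  by move=> mn; rewrite le_min !ge_min lexx /= ler_nat mn orbT.
have gcvg w : g n w @[n --> \oo] --> f w.
  apply: cvg_near_cst; near=> n; apply: min_l.
  apply: ltW; apply: lt_le_trans (archi_boundP (f0 w)) _.
  by rewrite ler_nat; near: n; exact: nbhs_infty_ge.
have i1 : P.-integrable setT (EFin \o (fun=> 1 : R)).
  apply/integrableP; split; first exact: measurable_cst.
  by under eq_integral do rewrite /= normr1; rewrite integral_cst// mul1e.
have gE n : (\int[P]_x (g n (Y x))%:E = \int[mu]_w (g n w * D w)%:E)%E.
  have hset A : measurable A ->
      (\int[P]_(x in Y @^-1` A) (1%R)%:E = \int[mu]_(w in A) (D w)%:E)%E.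
    by move=> mA; rewrite integral_cst ?mul1e ?PD//; exact: measurable_preimage.
  have bgY : bounded_measurable (fun x => g n (Y x)).
    split; first exact: measurableT_comp.
    by case: (bg n) => _ [M h]; exists M.
  have := bm_transfer i1 iD hset (bg n).
  under eq_Rintegral do rewrite mulr1.
  move=> e1; rewrite -EFin_Rintegral; last first.
    have := bm_integrableM bgY i1; rewrite (_ : (fun x => _ * 1) = (fun x => g n (Y x)))//.
    by apply/funext => x; rewrite mulr1.
  by rewrite e1 EFin_Rintegral//; exact: bm_integrableM.
have cvgP : (\int[P]_x (g n (Y x))%:E @[n --> \oo] --> \int[P]_x (f (Y x))%:E)%E.
  apply: monotone_Rcvg => //.
  - by move=> n; exact: measurableT_comp.
  - by move=> x m n; exact: gnd.
have cvgmu : (\int[mu]_w (g n w * D w)%:E @[n --> \oo] --> \int[mu]_w (f w * D w)%:E)%E.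
  apply: monotone_Rcvg.
  - by move=> n; exact: measurable_funM.
  - by move=> n w; rewrite mulr_ge0.
  - by move=> w m n mn; rewrite ler_wpM2r// gnd.
  - by move=> w; apply: cvgM; [exact: gcvg|exact: cvg_cst].
apply: (cvg_unique _ cvgP) => //.
rewrite (_ : (fun n => _) = (fun n => \int[mu]_w (g n w * D w)%:E)%E)//.
by apply/funext => n; exact: gE.
Unshelve. all: by end_near. Qed.

End transfer.

(** * The standard Gaussian law *)

Section derive_integral.
Context d (Y : measurableType d) (R : realType) (mu : {measure set Y -> \bar R}).

Lemma is_derive_integral (f f' : R -> Y -> R) (a : R) (G : Y -> R) :
  (forall x y, is_derive x (1 : R) (f ^~ y) (f' x y)) ->
  (forall x, `|x - a| < 1 -> mu.-integrable setT (EFin \o f x)) ->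
  (forall x y, `|x - a| < 1 -> `|f' x y| <= G y) ->
  mu.-integrable setT (EFin \o G) ->
  is_derive a (1 : R) (fun x => \int[mu]_y f x y) (\int[mu]_y f' a y).
Proof.
move=> df iF fG iG.
have Ia : `]a - 1, a + 1[%classic a by rewrite /= in_itv /=; lra.
have itv1 x : `]a - 1, a + 1[%classic x -> `|x - a| < 1.
  by rewrite /= in_itv /= ltr_norml; lra.
have p1 x y : partial1of2 f x y = f' x y.
  by rewrite partial1of2E; apply: derive_val.
have G0 y : 0 <= G y by apply: le_trans (fG a y _); rewrite ?subrr ?normr0.
have h1 x : `]a - 1, a + 1[%classic x -> mu.-integrable setT (EFin \o f x).
  by move=> /itv1; exact: iF.
have h2 x y : `]a - 1, a + 1[%classic x -> setT y -> derivable (f ^~ y) x 1.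
  by move=> _ _; apply: ex_derive.
have h3 x y : `]a - 1, a + 1[%classic x -> setT y -> `|partial1of2 f x y| <= G y.
  by move=> /itv1 ? _; rewrite p1 fG.
apply: DeriveDef.
  exact: (derivable_under_integral measurableT Ia h1 h2 G0 iG h3).
rewrite -derive1E (differentiation_under_integral measurableT Ia h1 h2 G0 iG h3).
by apply: eq_Rintegral => y _; exact: p1.
Qed.

End derive_integral.

Section gaussian_line.
Variable R : realType.
Notation gamma := (normal_prob (0 : R) 1).
Notation leb := (@lebesgue_measure R).
Implicit Types f : R -> R.

Lemma normal_pdf01E (x : R) : normal_pdf 0 1 x = normal_pdf 0 1 0 * expR (- x ^+ 2 / 2).
Proof.
rewrite !normal_pdfE ?oner_eq0// /normal_fun !subr0 expr0n /= oppr0 mul0r expR0 mulr1.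
by rewrite expr1n.
Qed.

Lemma normal_pdf01_gt0 (x : R) : 0 < normal_pdf 0 1 x.
Proof. by rewrite normal_pdfE ?oner_eq0// mulr_gt0 ?expR_gt0 ?normal_peak_gt0 ?oner_eq0. Qed.

Lemma ge0_integral_gamma f : measurable_fun setT f -> (forall x, 0 <= f x) ->
  (\int[gamma]_x (f x)%:E = \int[leb]_x (f x * normal_pdf 0 1 x)%:E)%E.
Proof.
move=> mf f0; apply: (@ge0_transfer _ _ _ _ _ gamma leb id) => //.
- exact: integrable_normal_pdf.
- by rewrite ltey_eq fin_num_measure.
- by move=> x; exact: normal_pdf_ge0.
Qed.

Lemma lebesgue_measure_shift (t : R) (A : set R) : measurable A ->
  pushforward leb (fun x : measurableTypeR R => x + t : measurableTypeR R) A = leb A.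
Proof.
have mt : measurable_fun [set: measurableTypeR R] (fun x : measurableTypeR R => x + t : measurableTypeR R).
  exact: measurable_funD.
move=> mA; apply/esym.
apply: (@lebesgue_measure_unique _ (pushforward leb (fun x : measurableTypeR R => x + t : measurableTypeR R))) => //= _ [[a b]] _ <-.
rewrite /pushforward (_ : _ @^-1` _ = `]a - t, b - t]%classic); last first.
  by apply/seteqP; split => x /=; rewrite !in_itv /=; lra.
rewrite !lebesgue_measure_itv/= !lte_fin ltrD2r; case: ifP => // _.
by rewrite -!EFinB; congr EFin; lra.
Qed.

Lemma ge0_integral_shift f t : measurable_fun setT f -> (forall x, 0 <= f x) ->
  (\int[leb]_x (f (x + t))%:E = \int[leb]_x (f x)%:E)%E.
Proof.
move=> mf f0.
have mt : measurable_fun [set: measurableTypeR R] (fun x : measurableTypeR R => x + t : measurableTypeR R).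
  exact: measurable_funD.
have := @ge0_integral_pushforward _ _ _ _ _ _ mt leb setT (EFin \o f) measurableT.
rewrite preimage_setT => <-.
- by apply: eq_measure_integral => A mA _; exact: lebesgue_measure_shift.
- exact/measurable_EFinP.
- by move=> x _; rewrite lee_fin.
Qed.

(** The Cameron-Martin formula on the line: translate the Lebesgue integral and complete the square
    in the Gaussian density. *)
Lemma gamma_shift f t : measurable_fun setT f -> (forall x, 0 <= f x) ->
  (\int[gamma]_x (f (x + t))%:E = \int[gamma]_x (f x * expR (t * x - t ^+ 2 / 2))%:E)%E.
Proof.
move=> mf f0.
have mp : measurable_fun setT (fun x : R => normal_pdf (0 : R) 1 (x - t)).
  by apply: (measurableT_comp (measurable_normal_pdf _ _)); exact: measurable_funB.
rewrite ge0_integral_gamma//; last first.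
  by apply: (measurableT_comp mf); exact: measurable_funD.
rewrite ge0_integral_gamma; last 2 first.
- apply: measurable_funM => //; apply: measurableT_comp => //.
  by apply: measurable_funB => //; exact: measurable_funM.
- by move=> x; rewrite mulr_ge0// expR_ge0.
rewrite -(@ge0_integral_shift (fun x => f x * expR (t * x - t ^+ 2 / 2) * normal_pdf 0 1 x) t).
- apply: eq_integral => x _; congr EFin; rewrite -mulrA; congr (_ * _).
  rewrite normal_pdf01E [in RHS]normal_pdf01E mulrCA -expRD; congr (_ * expR _).
  by field.
- apply: measurable_funM; last exact: measurable_normal_pdf.
  apply: measurable_funM => //; apply: measurableT_comp => //.
  by apply: measurable_funB => //; exact: measurable_funM.
- by move=> x; rewrite !mulr_ge0// ?expR_ge0// normal_pdf_ge0.
Qed.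

(** Shifting the constant 1 shows that the tilt [expR (t * x - t ^+ 2 / 2)] has mean 1. *)
Lemma gamma_expR t : (\int[gamma]_x (expR (t * x))%:E = (expR (t ^+ 2 / 2))%:E)%E.
Proof.
have h := @gamma_shift (fun=> 1) t (measurable_cst _) (fun=> ler01).
have e1 : (\int[gamma]_x (1%R)%:E = 1)%E by rewrite integral_cst// mul1e; exact: probability_setT.
rewrite e1 in h.
have mE : measurable_fun setT (fun x : R => expR (t * x)).
  by apply: measurableT_comp => //; exact: measurable_funM.
have mE2 : measurable_fun setT (fun x : R => expR (t * x - t ^+ 2 / 2)).
  by apply: measurableT_comp => //; apply: measurable_funB => //; exact: measurable_funM.
transitivity ((expR (t ^+ 2 / 2))%:E * \int[gamma]_x (1 * expR (t * x - t ^+ 2 / 2))%:E)%E.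
  rewrite -ge0_integralZl_EFin ?expR_ge0//.
  - by apply: eq_integral => x _; rewrite -EFinM mul1r -expRD addrC subrK.
  - by apply/measurable_EFinP; apply: measurable_funM.
by rewrite -h mule1.
Qed.

Lemma gamma_integrable_expR t : gamma.-integrable setT (EFin \o (fun x => expR (t * x))).
Proof.
apply/integrableP; split.
  by apply/measurable_EFinP; apply: measurableT_comp => //; exact: measurable_funM.
under eq_integral do rewrite /= ger0_norm ?expR_ge0//.
by rewrite gamma_expR ltry.
Qed.

Lemma measurable_cosM s : measurable_fun setT (fun x : R => cos (s * x)).
Proof.
apply: continuous_measurable_fun => x.
apply: continuous_comp; last exact: continuous_cos.
by apply: cvgM; [exact: cvg_cst|exact: cvg_id].
Qed.

Lemma measurable_sinM s : measurable_fun setT (fun x : R => sin (s * x)).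
Proof.
apply: continuous_measurable_fun => x.
apply: continuous_comp; last exact: continuous_sin.
by apply: cvgM; [exact: cvg_cst|exact: cvg_id].
Qed.

Lemma norm_cos_le1 (x : R) : `|cos x| <= 1.
Proof. by rewrite ler_norml cos_geN1 cos_le1. Qed.

Lemma norm_sin_le1 (x : R) : `|sin x| <= 1.
Proof. by rewrite ler_norml sin_geN1 sin_le1. Qed.

Lemma bm_cosM s : bounded_measurable (fun x : R => cos (s * x)).
Proof. by split; [exact: measurable_cosM|exists 1 => x; exact: norm_cos_le1]. Qed.

Lemma bm_sinM s : bounded_measurable (fun x : R => sin (s * x)).
Proof. by split; [exact: measurable_sinM|exists 1 => x; exact: norm_sin_le1]. Qed.

Lemma gamma_transfer f : bounded_measurable f ->
  \int[gamma]_x f x = \int[leb]_x (f x * normal_pdf 0 1 x).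
Proof.
move=> bf.
have := @bm_transfer _ _ _ _ _ gamma leb id _ (fun=> 1) (normal_pdf 0 1) _ _ _ f bf.
rewrite /= => <-//.
- by under [RHS]eq_Rintegral do rewrite mulr1.
- exact: (bm_integrable gamma (bm_cst _ 1)).
- exact: integrable_normal_pdf.
- by move=> A mA; rewrite integral_cst// mul1e.
Qed.

Lemma gamma_sin s : \int[gamma]_x sin (s * x) = 0.
Proof.
rewrite gamma_transfer; last exact: bm_sinM.
set g := fun x : R => sin (s * x) * normal_pdf 0 1 x.
have gN x : g (- x) = - g x.
  by rewrite /g mulrN sinN mulNr normal_pdf01E sqrrN -normal_pdf01E.
have ig : leb.-integrable setT (EFin \o g).
  exact: (@bm_integrableM _ _ R leb (fun x => sin (s * x)) (normal_pdf 0 1) (bm_sinM s) (integrable_normal_pdf 0 1)).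
have mg : measurable_fun setT (EFin \o g) by exact: measurable_int ig.
have mN : measurable_fun [set: measurableTypeR R] (-%R : _ -> measurableTypeR R).
  exact: measurable_funN.
have igN : leb.-integrable setT (EFin \o g \o -%R).
  have := integrableN ig; apply: eq_integrable => // x _.
  by rewrite /= gN.
suff : \int[leb]_x g x = - \int[leb]_x g x by lra.
have e : (\int[leb]_x (g x)%:E = \int[leb]_x (g (- x))%:E)%E.
  have := @integral_pushforward _ _ _ _ _ _ mN leb setT (EFin \o g) mg igN measurableT.
  rewrite preimage_setT => <-.
  by apply: eq_measure_integral => A mA _; rewrite -[LHS]lebesgue_measureN.
rewrite {1}/Rintegral e -[RHS]mulN1r -RintegralZl//.
by congr fine; apply: eq_integral => x _; rewrite gN mulN1r.
Qed.

Lemma normr_le_expR (x : R) : `|x| <= expR x + expR (- x).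
Proof.
have := expR_ge1Dx x; have := expR_ge1Dx (- x).
have := expR_gt0 x; have := expR_gt0 (- x); rewrite ler_norml; lra.
Qed.

Lemma expR_norm_le (x : R) : expR `|x| <= expR x + expR (- x).
Proof.
have := expR_gt0 x; have := expR_gt0 (- x).
by case: (lerP 0 x) => [/ger0_norm|/ltr0_norm] ->; lra.
Qed.

Lemma gamma_integrable_cosh c a :
  gamma.-integrable setT (EFin \o (fun x => c * (expR (a * x) + expR (- (a * x))))).
Proof.
have h1 := gamma_integrable_expR a; have h2 := gamma_integrable_expR (- a).
have h3 : gamma.-integrable setT (EFin \o (fun x : R => expR (a * x) + expR (- (a * x)))).
  apply: eq_integrable (integrableD measurableT h1 h2) => // x _.
  by rewrite /= mulNr.
exact: (bm_integrableM (bm_cst _ c) h3).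
Qed.

Lemma gamma_shift_bm f t : bounded_measurable f ->
  \int[gamma]_x f (x + t) = \int[gamma]_x (f x * expR (t * x - t ^+ 2 / 2)).
Proof.
pose sh (x : measurableTypeR R) : measurableTypeR R := x + t.
have mt : measurable_fun setT sh by exact: measurable_funD.
have ie : gamma.-integrable setT (EFin \o (fun x => expR (t * x - t ^+ 2 / 2))).
  have := bm_integrableM (bm_cst _ (expR (- (t ^+ 2 / 2)))) (gamma_integrable_expR t).
  apply: eq_integrable => // x _.
  by rewrite /= -expRD addrC.
have i1 := bm_integrable gamma (bm_cst _ 1).
have h (A : set (measurableTypeR R)) : measurable A -> (\int[gamma]_(x in sh @^-1` A) (1%R)%:E =
    \int[gamma]_(x in A) (expR (t * x - t ^+ 2 / 2))%:E)%E.
  move=> mA; rewrite -(integral_indicM gamma (fun x => expR (t * x - t ^+ 2 / 2)) mA).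
  rewrite -gamma_shift.
  - rewrite -(integral_indicM gamma (fun=> 1) (measurable_preimage mt mA)).
    by apply: eq_integral => x _; rewrite mulr1.
  - exact: measurable_indic.
  - by move=> x; rewrite indicE ler0n.
move=> bf; have := bm_transfer mt i1 ie h bf.
by under eq_Rintegral do rewrite mulr1.
Qed.

(* C'(s) = - E[r sin (s r)] and, differentiating the shift formula for sin (s r) at 0,
   s C(s) = E[r sin (s r)]. *)
Lemma gamma_cos s : \int[gamma]_x cos (s * x) = expR (- s ^+ 2 / 2).
Proof.
pose C s := \int[gamma]_x cos (s * x).
pose Q s := \int[gamma]_x (x * sin (s * x)).
have iid : gamma.-integrable setT (EFin \o (fun x : R => `|x|)).
  apply: (le_integrable measurableT _ _ (gamma_integrable_cosh 1 1)).
    by apply/measurable_EFinP; exact: measurableT_comp.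
  move=> x _ /=; rewrite lee_fin normr_id !mul1r.
  exact: le_trans (normr_le_expR x) (ler_norm _).
have mxsin t : measurable_fun setT (fun x : R => x * sin (t * x)).
  by apply: measurable_funM => //; exact: measurable_sinM.
have iQ t : gamma.-integrable setT (EFin \o (fun x : R => x * sin (t * x))).
  apply: (le_integrable measurableT _ _ iid); first by apply/measurable_EFinP; exact: mxsin.
  by move=> x _ /=; rewrite lee_fin normr_id normrM ler_piMr// norm_sin_le1.
have dcos u x : is_derive u (1 : R) (fun t => cos (t * x)) (- (x * sin (u * x))).
  have h : is_derive u (1 : R) (fun t => t * x) x.
    by apply: is_derive_eq; rewrite /= scaler0 add0r scaler1.
  have := @is_derive1_comp _ cos (fun t => t * x) u _ _ (is_derive_cos (u * x)) h.
  by move=> h2; apply: (is_derive_eq h2); lra.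
have dC t : is_derive t (1 : R) C (- Q t).
  have -> : - Q t = \int[gamma]_x (- (x * sin (t * x))).
    rewrite -mulN1r /Q -RintegralZl//.
    by apply: eq_Rintegral => x _; rewrite mulN1r.
  apply: (@is_derive_integral _ (measurableTypeR R) R gamma (fun t x => cos (t * x))
     (fun t x => - (x * sin (t * x))) t (fun x => `|x|) dcos) iid.
  - by move=> u _; apply: bm_integrable; exact: bm_cosM.
  - by move=> u x _; rewrite normrN normrM ler_piMr// norm_sin_le1.
move: s => s0.
have sC s : s * C s = Q s.
  pose f (t x : R) := sin (s * x) * expR (t * x - t ^+ 2 / 2).
  pose f' (t x : R) := sin (s * x) * ((x - t) * expR (t * x - t ^+ 2 / 2)).
  have fE t : \int[gamma]_x f t x = sin (s * t) * C s.
    rewrite -(gamma_shift_bm t (bm_sinM s)).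
    under eq_Rintegral do rewrite mulrDr sinD.
    rewrite RintegralD//.
    + rewrite RintegralZr//; last by apply: bm_integrable; exact: bm_sinM.
      rewrite RintegralZr//; last by apply: bm_integrable; exact: bm_cosM.
      by rewrite gamma_sin mul0r add0r mulrC.
    + by apply: bm_integrable; apply: bmM; [exact: bm_sinM|exact: bm_cst].
    + by apply: bm_integrable; apply: bmM; [exact: bm_cosM|exact: bm_cst].
  have df u x : is_derive u (1 : R) (f ^~ x) (f' u x).
    have h : is_derive u (1 : R) (fun t => t * x - t ^+ 2 / 2) (x - u).
      by apply: is_derive_eq; rewrite /= /GRing.scale /=; lra.
    have h2 := @is_derive1_comp _ expR (fun t => t * x - t ^+ 2 / 2) u _ _ (is_derive_expR _) h.
    have h3 := is_deriveZ (sin (s * x)) h2.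
    by apply: (is_derive_eq h3); rewrite /f' /GRing.scale /=; lra.
  have d1 : is_derive (0 : R) (1 : R) (fun t => \int[gamma]_x f t x) (\int[gamma]_x f' 0 x).
    apply: (@is_derive_integral _ (measurableTypeR R) R gamma f f' 0
      (fun x => 1 * (expR (2 * x) + expR (- (2 * x)))) df).
    - move=> t _; apply: bm_integrableM; first exact: bm_sinM.
      have := bm_integrableM (bm_cst _ (expR (- (t ^+ 2 / 2)))) (gamma_integrable_expR t).
      by apply: eq_integrable => // x _; rewrite /= -expRD addrC.
    - move=> t x; rewrite subr0 mul1r => t1.
      rewrite /f' !normrM (ger0_norm (expR_ge0 _)).
      apply: (@le_trans _ _ (expR `|x| * expR `|x|)); last first.
        rewrite -expRD (_ : `|x| + `|x| = 2 * `|x|); last by lra.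
        by have := expR_norm_le (2 * x); rewrite normrM normr_nat.
      apply: (@le_trans _ _ (1 * (expR `|x| * expR `|x|))); last by rewrite mul1r.
      rewrite ler_pM// ?norm_sin_le1// ?mulr_ge0 ?expR_ge0//.
      rewrite ler_pM// ?expR_ge0//.
        apply: le_trans (ler_normB _ _) _; apply: le_trans (expR_ge1Dx _).
        by rewrite addrC lerD2r ltW.
      rewrite ler_expR; apply: (@le_trans _ _ (t * x)); first by rewrite gerBl divr_ge0// sqr_ge0.
      by apply: le_trans (ler_norm _) _; rewrite normrM ler_piMl// ltW.
    - exact: gamma_integrable_cosh.
  have d2 : is_derive (0 : R) (1 : R) (fun t => sin (s * t) * C s) (s * C s).
    have h : is_derive (0 : R) (1 : R) (fun t => s * t) s.
      by apply: is_derive_eq; rewrite /= /GRing.scale /=; lra.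
    have h2 := @is_derive1_comp _ sin (fun t => s * t) 0 _ _ (is_derive_sin _) h.
    have h3 := is_deriveZ (C s) h2.
    have -> : (fun t => sin (s * t) * C s) = C s *: (sin \o (fun t => s * t)).
      by apply/funext => t /=; rewrite mulrC.
    by apply: (is_derive_eq h3); rewrite mulr0 cos0 /GRing.scale /=; lra.
  have e : (fun t => \int[gamma]_x f t x) = (fun t => sin (s * t) * C s) by apply/funext.
  rewrite e in d1.
  have -> : s * C s = \int[gamma]_x f' 0 x.
    by rewrite -(@derive_val _ _ _ _ _ _ _ d2) -(@derive_val _ _ _ _ _ _ _ d1).
  by apply: eq_Rintegral => x _; rewrite /f' subr0 mul0r expr0n mul0r subrr expR0; lra.
(* The equation [C' = - t C] makes this product constant; its value is read off at 0. *)
have dG t : is_derive t (1 : R) (fun t => C t * expR (t ^+ 2 / 2)) 0.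
  have h : is_derive t (1 : R) (fun t => t ^+ 2 / 2) t.
    by apply: is_derive_eq; rewrite /= /GRing.scale /=; lra.
  have h2 := @is_derive1_comp _ expR (fun t => t ^+ 2 / 2) t _ _ (is_derive_expR _) h.
  have h3 := is_deriveM (dC t) h2.
  apply: (is_derive_eq h3); rewrite /GRing.scale /= -sC; lra.
have := is_derive_0_is_cst s0 0 dG.
have -> : C 0 = 1.
  rewrite /C; under eq_Rintegral do rewrite mul0r cos0.
  by rewrite Rintegral_cst// [X in fine X]probability_setT mul1r.
rewrite expr0n mul0r expR0 mulr1 => /(congr1 (fun z => z * expR (- s0 ^+ 2 / 2))).
by rewrite mul1r -mulrA -expRD mulNr subrr expR0 mulr1.
Qed.

End gaussian_line.

(** * Uniqueness from characteristic functionals *)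

Section dual_ops.
Variables (R : realType) (W : completeNormedModType R).

Lemma dual_comb (a b : R) (e1 e2 : dual W) :
  exists e : dual W, forall w, e w = a * e1 w + b * e2 w.
Proof.
have lf c x y : a * e1 (c *: x + y) + b * e2 (c *: x + y) =
    c * (a * e1 x + b * e2 x) + (a * e1 y + b * e2 y).
  by rewrite !linearP /GRing.scale /=; ring.
pose g : {linear W -> R^o} := HB.pack (fun w => a * e1 w + b * e2 w)
  (GRing.isLinear.Build R W R^o *:%R (fun w => a * e1 w + b * e2 w) lf).
have cg : continuous g.
  move=> w; apply: (@cvgD _ R^o).
    by apply: cvgM; [exact: cvg_cst|exact: dual_continuous].
  by apply: cvgM; [exact: cvg_cst|exact: dual_continuous].
by exists (Dual cg).
Qed.

Lemma dual_zero : exists e : dual W, forall w, e w = 0.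
Proof.
apply: (@dual_of_fun _ _ (fun=> 0) 0); first by move=> *; rewrite mulr0 addr0.
by move=> x; rewrite normr0 mul0r.
Qed.

Lemma continuous_borel_measurable (f : W -> R) : continuous f ->
  measurable_fun [set: borel W] (f : borel W -> R).
Proof.
move=> cf; apply: (measurability _ (RGenOpens.measurableE R)).
move=> _ [_ [a [b ->]] <-]; rewrite setTI; apply: sub_sigma_algebra.
by apply: open_comp => [x _|]; [exact: cf|exact: interval_open].
Qed.

Lemma measurable_dual (e : dual W) : measurable_fun [set: borel W] (e : borel W -> R).
Proof. exact: (continuous_borel_measurable (@dual_continuous _ _ e)). Qed.

Lemma measurable_fun_borel d (O : measurableType d) (Y : O -> borel W) :
  (exists2 D : set W, countable D & dense D) ->
  (forall e : dual W, measurable_fun [set: O] (fun x => e (Y x))) ->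
  measurable_fun [set: O] Y.
Proof.
move=> sepW mY _ A mA; rewrite setTI.
apply: (borel_dual_ind (C := fun A => measurable (Y @^-1` A)) sepW) mA => /=.
- by rewrite preimage_set0.
- by move=> B mB; rewrite preimage_setC; exact: measurableC.
- by move=> F mF; rewrite preimage_bigcup; exact: bigcup_measurable.
- move=> e a; have := measurable_lt (measurable_cst a) (mY e); exact.
Qed.

End dual_ops.

(** Recovers an unbounded linear functional as a pointwise limit of trigonometric functions, for use
    in [mult_indic_gt]. *)
Lemma cvg_sin_quot (R : realType) (x : R) :
  n.+1%:R * sin (n.+1%:R^-1 * x) @[n --> \oo] --> x.
Proof.
have [->|x0] := eqVneq x 0.
  by under eq_fun do rewrite mulr0 sin0 mulr0; exact: cvg_cst.
have h : is_derive (0 : R) (1 : R) sin 1.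
  by have := is_derive_sin (0 : R); rewrite cos0.
have [d1 d2] := h.
pose u n : R := n.+1%:R^-1 * x.
have u0 : (forall n, u n != 0) /\ u n @[n --> \oo] --> 0.
  split=> [n|].
    by rewrite mulf_neq0// invr_neq0// pnatr_eq0.
  have -> : (0 : R) = 0 * x by rewrite mul0r.
  apply: cvgM; [exact: (@cvg_harmonic R)|exact: cvg_cst].
have : h^-1 *: (sin (h *: (1 : R) + 0) - sin 0) @[h --> (0 : R)^'] --> (1 : R).
  by rewrite -[X in _ --> X]d2; exact: d1.
move=> /cvgr_dnbhsP /(_ u u0) h1.
have -> : (fun n => n.+1%:R * sin (n.+1%:R^-1 * x)) =
    (fun n => x * ((u n)^-1 *: (sin (u n *: (1 : R) + 0) - sin 0))).
  apply/funext => n; rewrite sin0 subr0 addr0 /GRing.scale /= mulr1 /u.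
  by rewrite invfM invrK; field.
by rewrite -[X in _ --> X]mulr1; apply: cvgM; [exact: cvg_cst|exact: h1].
Qed.

Section uniqueness.
Context d (O : measurableType d) (R : realType) (W : completeNormedModType R).
Variables (P : {finite_measure set O -> \bar R}) (mu : {finite_measure set (borel W) -> \bar R}).
Variables (Y : O -> borel W) (mY : measurable_fun [set: O] Y).
Hypothesis sepW : exists2 D : set W, countable D & dense D.
Implicit Types (f g : borel W -> R) (e : dual W).

Definition trig_equal f := bounded_measurable f /\ forall e (c : R),
  \int[P]_x (f (Y x) * cos (e (Y x : W) + c)) = \int[mu]_w (f w * cos (e (w : W) + c)).

(** The functions satisfying [trig_equal] are not visibly stable under products, whereas multipliers
    are by construction. They form an algebra closed under bounded pointwise limits, which replaces
    Fourier inversion. *)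
Definition trig_multiplier g := bounded_measurable g /\
  forall f, trig_equal f -> trig_equal (fun w => f w * g w).

Let bmY f : bounded_measurable f -> bounded_measurable (fun x => f (Y x)).
Proof. by move=> [mf [M fM]]; split; [exact: measurableT_comp|exists M]. Qed.

Lemma bm_cos_dual e (c : R) : bounded_measurable (fun w : borel W => cos (e (w : W) + c)).
Proof.
split; last by exists 1 => w; rewrite norm_cos_le1.
apply: measurableT_comp; first exact: (continuous_measurable_fun (@continuous_cos R)).
by apply: measurable_funD => //; exact: measurable_dual.
Qed.

Let int_cosY f e c : bounded_measurable f ->
  P.-integrable setT (EFin \o (fun x => f (Y x) * cos (e (Y x : W) + c))).
Proof. by move=> bf; apply: bm_integrable; apply: bmM (bmY bf) (bmY (bm_cos_dual e c)). Qed.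

Let int_cos f e c : bounded_measurable f ->
  mu.-integrable setT (EFin \o (fun w => f w * cos (e (w : W) + c))).
Proof. by move=> bf; apply: bm_integrable; apply: bmM bf (bm_cos_dual e c). Qed.

Lemma trig_equal_lin (a : R) f g : trig_equal f -> trig_equal g ->
  trig_equal (fun w => a * f w + g w).
Proof.
move=> [bf ef] [bg eg]; split; first by apply: bmD => //; exact: bmZ.
move=> e c.
under eq_Rintegral do rewrite mulrDl -mulrA.
under [RHS]eq_Rintegral do rewrite mulrDl -mulrA.
have i1 := int_cosY e c bf; have i2 := int_cos e c bf.
have j1 := bm_integrableM (bm_cst _ a) i1.
have j2 := bm_integrableM (bm_cst _ a) i2.
rewrite RintegralD//=; last exact: int_cosY.
rewrite [RHS]RintegralD//=; last exact: int_cos.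
by rewrite RintegralZl// [in RHS]RintegralZl// ef eg.
Qed.

Lemma trig_equal_lim (f_ : nat -> borel W -> R) f (M : R) :
  (forall n, trig_equal (f_ n)) -> (forall n w, `|f_ n w| <= M) ->
  (forall w, f_ n w @[n --> \oo] --> f w) -> trig_equal f.
Proof.
move=> ef_ fM fcvg.
have mf : measurable_fun setT f.
  by apply: measurable_fun_cvg (fun w _ => fcvg w) => n; case: (ef_ n) => -[].
have bf : bounded_measurable f.
  split=> //; exists M => w.
  have h : `|f_ n w| @[n --> \oo] --> `|f w| by apply: cvg_norm; exact: fcvg.
  by apply: (cvgr_to_le h); exact: nearW.
split=> // e c.
have cM (x y : R) : `|x| <= M -> `|x * cos y| <= M.
  by move=> xM; rewrite normrM; apply: le_trans xM; rewrite ler_piMr// norm_cos_le1.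
have h1 : \int[P]_x (f_ n (Y x) * cos (e (Y x : W) + c)) @[n --> \oo] -->
    \int[P]_x (f (Y x) * cos (e (Y x : W) + c)).
  apply: (bounded_cvg (M := M)).
  - by move=> n; case: (bmM (bmY (ef_ n).1) (bmY (bm_cos_dual e c))).
  - by case: (bmM (bmY bf) (bmY (bm_cos_dual e c))).
  - by move=> n x; exact: cM.
  - by move=> x; apply: cvgM; [exact: fcvg|exact: cvg_cst].
have h2 : \int[mu]_w (f_ n w * cos (e (w : W) + c)) @[n --> \oo] -->
    \int[mu]_w (f w * cos (e (w : W) + c)).
  apply: (bounded_cvg (M := M)).
  - by move=> n; case: (bmM (ef_ n).1 (bm_cos_dual e c)).
  - by case: (bmM bf (bm_cos_dual e c)).
  - by move=> n x; exact: cM.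
  - by move=> x; apply: cvgM; [exact: fcvg|exact: cvg_cst].
apply: (cvg_unique _ h1) => //.
rewrite (_ : (fun n => _) = (fun n => \int[mu]_w (f_ n w * cos (e (w : W) + c))))//.
by apply/funext => n; exact: (ef_ n).2.
Qed.

Lemma mult_cst (c : R) : trig_multiplier (fun=> c).
Proof.
split; first exact: bm_cst.
move=> f ef; rewrite (_ : (fun w => _) = (fun w => c * f w + 0 * f w)).
  have := trig_equal_lin c ef (trig_equal_lin (-1) ef ef).
  rewrite (_ : (fun w => _) = (fun w => c * f w + 0 * f w))//.
  by apply/funext => w; ring.
by apply/funext => w; ring.
Qed.

Lemma multM f g : trig_multiplier f -> trig_multiplier g ->
  trig_multiplier (fun w => f w * g w).
Proof.
move=> [bf hf] [bg hg]; split; first exact: bmM.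
move=> k ek; have := hg _ (hf _ ek).
by under eq_fun do rewrite -mulrA.
Qed.

Lemma mult_lin (a : R) f g : trig_multiplier f -> trig_multiplier g ->
  trig_multiplier (fun w => a * f w + g w).
Proof.
move=> [bf hf] [bg hg]; split; first by apply: bmD => //; exact: bmZ.
move=> k ek; have := trig_equal_lin a (hf _ ek) (hg _ ek).
rewrite (_ : (fun w => _) = (fun w => k w * (a * f w + g w)))//.
by apply/funext => w; ring.
Qed.

Lemma mult_lim (g_ : nat -> borel W -> R) g (M : R) :
  (forall n, trig_multiplier (g_ n)) -> (forall n w, `|g_ n w| <= M) ->
  (forall w, g_ n w @[n --> \oo] --> g w) -> trig_multiplier g.
Proof.
move=> mg_ gM gcvg.
have M0 : 0 <= M := le_trans (normr_ge0 _) (gM 0%N point).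
have h f : trig_equal f -> trig_equal (fun w => f w * g w).
  move=> ef; have [_ [N fN]] := ef.1.
  apply: (trig_equal_lim (f_ := fun n w => f w * g_ n w) (M := N * M)).
  - by move=> n; exact: (mg_ n).2.
  - by move=> n w; rewrite normrM ler_pM.
  - by move=> w; apply: cvgM; [exact: cvg_cst|exact: gcvg].
split=> //; split.
  by apply: measurable_fun_cvg (fun w _ => gcvg w) => n; case: (mg_ n) => -[].
exists M => w.
have h' : `|g_ n w| @[n --> \oo] --> `|g w| by apply: cvg_norm; exact: gcvg.
by apply: (cvgr_to_le h'); exact: nearW.
Qed.

(** The product-to-sum formula turns a product of two cosines of functionals into cosines of their
    sum and difference, which are again functionals; the phase [c] lets sines be treated as
    cosines. *)
Lemma mult_cos e (c : R) : trig_multiplier (fun w => cos (e (w : W) + c)).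
Proof.
split; first exact: bm_cos_dual.
move=> f ef; split; first by apply: bmM ef.1 (bm_cos_dual e c).
move=> e' c'.
have [e1 e1E] := dual_comb 1 1 e e'.
have [e2 e2E] := dual_comb 1 (-1) e e'.
have prod (w : W) (z : R) : z * cos (e w + c) * cos (e' w + c') =
    2^-1 * (z * cos (e1 w + (c + c'))) + 2^-1 * (z * cos (e2 w + (c - c'))).
  rewrite e1E e2E !mul1r mulN1r.
  rewrite (_ : e w + e' w + (c + c') = (e w + c) + (e' w + c')); last by ring.
  rewrite (_ : e w - e' w + (c - c') = (e w + c) - (e' w + c')); last by ring.
  by move: (e w + c) (e' w + c') => A B; rewrite cosD cosB; field.
under eq_Rintegral do rewrite prod.
under [RHS]eq_Rintegral do rewrite prod.
have i1 := int_cosY e1 (c + c') ef.1; have i2 := int_cosY e2 (c - c') ef.1.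
have j1 := int_cos e1 (c + c') ef.1; have j2 := int_cos e2 (c - c') ef.1.
have i1' := bm_integrableM (bm_cst _ 2^-1) i1; have i2' := bm_integrableM (bm_cst _ 2^-1) i2.
have j1' := bm_integrableM (bm_cst _ 2^-1) j1; have j2' := bm_integrableM (bm_cst _ 2^-1) j2.
rewrite RintegralD//= [RHS]RintegralD//= !RintegralZl//.
by rewrite !ef.2.
Qed.

(** The Taylor partial sums are polynomials in [g], bounded uniformly by [expR M]. *)
Lemma mult_exp g : trig_multiplier g -> trig_multiplier (fun w => expR (g w)).
Proof.
move=> mg; have [_ [M gM]] := mg.1.
have M0 : 0 <= M := le_trans (normr_ge0 _) (gM point).
have mX k : trig_multiplier (fun w => g w ^+ k).
  elim: k => [|k IH]; first by under eq_fun do rewrite expr0; exact: mult_cst.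
  by under eq_fun do rewrite exprS; exact: multM.
apply: (mult_lim (g_ := fun n w => series (exp_coeff (g w)) n) (M := expR M)).
- elim=> [|n IH].
    by rewrite (_ : (fun w => _) = (fun=> 0)); [exact: mult_cst|apply/funext => w; rewrite /series /= big_geq].
  have := mult_lin (n`!%:R^-1) (mX n) IH.
  rewrite (_ : (fun w => _ + _) = (fun w => series (exp_coeff (g w)) n.+1))//.
  by apply/funext => w; rewrite /series /= big_nat_recr //= addrC /exp_coeff mulrC.
- move=> n w; apply: (@le_trans _ _ (series (exp_coeff M) n)).
    rewrite /series /=; apply: le_trans (ler_norm_sum _ _ _) _.
    apply: ler_sum => k _; rewrite /exp_coeff /= normrM normrX.
    rewrite (ger0_norm (_ : 0 <= k`!%:R^-1)) ?invr_ge0// ler_wpM2r ?invr_ge0//.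
    by apply: lerXn2r => //; rewrite nnegrE.
  have nd : nondecreasing_seq (series (exp_coeff M)).
    by apply: nondecreasing_series => k _ _; exact: exp_coeff_ge0.
  exact: (nondecreasing_cvgn_le nd (is_cvg_series_exp_coeff M)).
- by move=> w; exact: is_cvg_series_exp_coeff.
Qed.

(** With [x = e w - a], the exponent [k - k^2 x] tends to minus infinity for [x > 0] and is at least
    [k] for [x <= 0], so [expR (- expR (k - k^2 x))] tends to the indicator of the open half-space;
    the summand [k] settles the boundary. The functional itself is first replaced by
    [n.+1 * sin (e w / n.+1)], a shifted cosine up to a factor. The double exponential stays below 1
    throughout. *)
Lemma mult_indic_gt e (a : R) : trig_multiplier (\1_[set w : borel W | a < e (w : W)]).
Proof.
have [z z0] := dual_zero W.
have msin k n : trig_multiplier (fun w => expR (- expR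
    (k%:R + - k%:R ^+ 2 * (n.+1%:R * sin (n.+1%:R^-1 * e (w : W)) - a)))).
  have [e' e'E] := dual_comb n.+1%:R^-1 0 e z.
  apply: mult_exp.
  rewrite (_ : (fun w => _) = (fun w => (-1) * expR (((- k%:R ^+ 2 * n.+1%:R) * cos (e' (w : W) + - (pi / 2)) +
     (k%:R + k%:R ^+ 2 * a))) + 0)).
    apply: mult_lin (mult_cst 0); apply: mult_exp.
    by apply: mult_lin (mult_cst _); exact: mult_cos.
  apply/funext => w; rewrite addr0 mulN1r; congr (- expR _).
  rewrite e'E z0 mul0r addr0 cosBpihalf; ring.
have bnd (x : R) : `|expR (- expR x)| <= 1.
  by rewrite ger0_norm ?expR_ge0// -expR0 ler_expR oppr_le0 expR_ge0.
have mk k : trig_multiplier (fun w => expR (- expR (k%:R + - k%:R ^+ 2 * (e (w : W) - a)))).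
  apply: (mult_lim (msin k) (M := 1)); first by move=> n w; exact: bnd.
  move=> w.
  apply: (cvg_comp _ expR); last exact: continuous_expR.
  apply: cvgN; apply: (cvg_comp _ expR); last exact: continuous_expR.
  apply: cvgD; first exact: cvg_cst.
  apply: cvgM; first exact: cvg_cst.
  by apply: cvgB; [exact: cvg_sin_quot|exact: cvg_cst].
apply: (mult_lim mk (M := 1)); first by move=> n w; exact: bnd.
move=> w; rewrite indicE.
have expN_le n : expR (- n%:R) <= harmonic n :> R.
  rewrite expRN /harmonic /= lef_pV2 ?posrE ?expR_gt0//.
  by rewrite -natr1 addrC expR_ge1Dx.
have [ew|ew] := ltP a (e w).
  rewrite mem_set//=; apply: (@squeeze_cvgr _ _ _ _ (fun n => 1 - harmonic n) (fun=> 1)).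
  - near=> k; apply/andP; split; last by rewrite -expR0 ler_expR oppr_le0 expR_ge0.
    apply: le_trans (expR_ge1Dx _); rewrite lerD2l lerN2.
    apply: le_trans (expN_le k); rewrite ler_expR.
    have k2 : 2 / (e w - a) <= k%:R.
      by near: k; exact: nbhs_infty_ger.
    have k0 : 0 <= k%:R :> R by [].
    rewrite ler_pdivrMr ?subr_gt0// in k2.
    have := ler_wpM2l k0 k2; rewrite expr2; lra.
  - by rewrite -[X in _ --> X]subr0; apply: cvgB; [exact: cvg_cst|exact: cvg_harmonic].
  - exact: cvg_cst.
rewrite memNset/=; last by apply/negP; rewrite -leNgt.
apply: (@squeeze_cvgr _ _ _ _ (fun=> 0) harmonic); last 2 first.
- exact: cvg_cst.
- exact: cvg_harmonic.
near=> k; rewrite expR_ge0 /=; apply: le_trans (expN_le k); rewrite ler_expR lerN2.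
apply: le_trans (expR_ge1Dx _).
have h1 : 0 <= k%:R ^+ 2 * (a - e w) by rewrite mulr_ge0 ?sqr_ge0// subr_ge0.
lra.
Unshelve. all: by end_near. Qed.

(** The hypotheses say that the constant 1 is [trig_equal]. Indicators of half-spaces are
    multipliers, hence so are those of all Borel sets, and [1 * \1_A] is finally tested against the
    zero functional, whose cosine is 1. *)
Theorem trig_uniqueness : (forall e, \int[P]_x cos (e (Y x : W)) = \int[mu]_w cos (e (w : W))) ->
  (forall e, \int[P]_x sin (e (Y x : W)) = \int[mu]_w sin (e (w : W))) ->
  forall A : set (borel W), measurable A -> P (Y @^-1` A) = mu A.
Proof.
move=> hcos hsin A mA.
have [z z0] := dual_zero W.
have e1 : trig_equal (fun=> 1).
  split=> [|e c]; first exact: bm_cst.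
  have dec (x : R) : 1 * cos (x + c) = cos c * cos x + (- sin c) * sin x.
    by rewrite cosD; ring.
  under eq_Rintegral do rewrite dec.
  under [RHS]eq_Rintegral do rewrite dec.
  have bc : bounded_measurable (fun w : borel W => cos (e (w : W))).
    have := bm_cos_dual e 0.
    by under eq_fun do rewrite addr0.
  have bs : bounded_measurable (fun w : borel W => sin (e (w : W))).
    have := bm_cos_dual e (- (pi / 2)).
    by under eq_fun do rewrite cosBpihalf.
  have i1 := bm_integrable P (bmY bc); have i2 := bm_integrable P (bmY bs).
  have j1 := bm_integrable mu bc; have j2 := bm_integrable mu bs.
  have i1' := bm_integrableM (bm_cst _ (cos c)) i1.
  have i2' := bm_integrableM (bm_cst _ (- sin c)) i2.
  have j1' := bm_integrableM (bm_cst _ (cos c)) j1.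
  have j2' := bm_integrableM (bm_cst _ (- sin c)) j2.
  by rewrite RintegralD//= [RHS]RintegralD//= !RintegralZl// hcos hsin.
have [_ /(_ _ e1)[_ /(_ z 0)]] : trig_multiplier (\1_A).
  apply: (borel_dual_ind (C := fun A => trig_multiplier \1_A) sepW) mA.
  - rewrite (_ : \1_set0 = (fun=> 0)); [exact: mult_cst|].
    by apply/funext => w; rewrite indic0.
  - move=> B mB; have := mult_lin (-1) mB (mult_cst 1).
    rewrite (_ : (fun w => _) = \1_(~` B))//.
    by apply/funext => w; rewrite !indicE in_setC; case: (w \in B) => /=; ring.
  - move=> F mF.
    have mU n : trig_multiplier \1_(\big[setU/set0]_(i < n) F i).
      elim: n => [|n IH].
        rewrite big_ord0 (_ : \1_set0 = (fun=> 0)); [exact: mult_cst|].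
        by apply/funext => w; rewrite indic0.
      rewrite big_ord_recr /=.
      have := mult_lin (-1) (multM IH (mF n)) (mult_lin 1 IH (mF n)).
      rewrite (_ : (fun w => _) = \1_(\big[setU/set0]_(i < n) F i `|` F n))//.
      apply/funext => w; rewrite !indicE in_setU.
      by case: (w \in _); case: (w \in _) => /=; ring.
    apply: (mult_lim mU (M := 1)).
      by move=> n w; rewrite indicE; case: (_ \in _); rewrite ?normr1 ?normr0.
    move=> w; have [[n _ Fn]|nF] := pselect ((\bigcup_n F n) w).
      apply: cvg_near_cst; near=> k; rewrite !indicE !mem_set//.
        by exists n.
      rewrite -bigcup_mkord; exists n => //=.
      by near: k; exact: nbhs_infty_gt.
    apply: cvg_near_cst; near=> k; rewrite !indicE !memNset//.
    by rewrite -bigcup_mkord => -[n _ Fn]; apply: nF; exists n.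
  - by move=> e a; exact: mult_indic_gt.
under eq_Rintegral do rewrite z0 addr0 cos0 mul1r mulr1.
under [RHS]eq_Rintegral do rewrite z0 addr0 cos0 mul1r mulr1.
move=> h; have := congr1 EFin h.
rewrite (EFin_Rintegral (bm_integrable mu (bm_indic R mA))).
rewrite (EFin_Rintegral (bm_integrable P (bmY (bm_indic R mA)))).
have pA := integral_indic P measurableT (measurable_preimage mY mA).
have qA := integral_indic mu measurableT mA.
rewrite setIT in qA; rewrite setIT in pA.
by move=> hPQ; rewrite -pA -qA -hPQ.
Unshelve. all: by end_near. Qed.

End uniqueness.

(** * The Cameron-Martin theorem *)

Lemma Rintegral_prob_cst d (T : measurableType d) (R : realType) (P : probability T R) (c : R) :
  \int[P]_x c = c.
Proof. by rewrite Rintegral_cst// [X in fine X]probability_setT mulr1. Qed.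

Section product_integral.
Context d1 d2 (T1 : measurableType d1) (T2 : measurableType d2) (R : realType).
Variables (P1 : probability T1 R) (P2 : probability T2 R).

Definition prod_prob : probability (T1 * T2)%type R := (P1 \x P2)%E.

Lemma bm_fst (f : T1 -> R) : bounded_measurable f ->
  bounded_measurable (fun z : T1 * T2 => f z.1).
Proof. by move=> [mf [M fM]]; split; [exact: measurableT_comp|exists M]. Qed.

Lemma bm_snd (f : T2 -> R) : bounded_measurable f ->
  bounded_measurable (fun z : T1 * T2 => f z.2).
Proof. by move=> [mf [M fM]]; split; [exact: measurableT_comp|exists M]. Qed.

Lemma Rintegral_prodM (f : T1 -> R) (g : T2 -> R) :
  bounded_measurable f -> bounded_measurable g ->
  \int[prod_prob]_z (f z.1 * g z.2) = (\int[P1]_x f x) * (\int[P2]_y g y).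
Proof.
move=> bf bg.
have ib := bm_integrable prod_prob (bmM (bm_fst bf) (bm_snd bg)).
have jf := bm_integrable P1 bf; have jg := bm_integrable P2 bg.
apply: EFin_inj; rewrite EFin_Rintegral// -(integral12_prod_meas1 ib) /fubini_F /=.
transitivity (\int[P1]_x (f x * \int[P2]_y g y)%R%:E)%E.
  apply: eq_integral => x _; rewrite EFinM EFin_Rintegral//.
  rewrite -integralZl//; apply: eq_integral => y _; exact: EFinM.
rewrite EFinM (EFin_Rintegral jf) -integralZr//.
Qed.

Lemma prod_prob_ge0 (f : T1 * T2 -> R) : measurable_fun setT f -> (forall z, 0 <= f z) ->
  (\int[prod_prob]_z (f z)%:E = \int[P1]_x \int[P2]_y (f (x, y))%:E)%E.
Proof.
by move=> mf f0; apply: fubini_tonelli1 => //; exact/measurable_EFinP.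
Qed.

Lemma prod_prob_ge0_sym (f : T1 * T2 -> R) : measurable_fun setT f -> (forall z, 0 <= f z) ->
  (\int[prod_prob]_z (f z)%:E = \int[P2]_y \int[P1]_x (f (x, y))%:E)%E.
Proof.
by move=> mf f0; apply: fubini_tonelli2 => //; exact/measurable_EFinP.
Qed.

End product_integral.

Section cameron_martin.
Variables (R : realType) (W H : completeNormedModType R).
Variables (ip : {dot H for (@idfun R)}) (i : {linear H -> W}) (j : dual W -> H).
Variables (muW : probability (borel W) R).
Hypothesis Haws : abstract_wiener_space ip i j muW.
Notation gamma := (normal_prob (0 : R) 1).

Lemma ipC a b : ip a b = ip b a.
Proof. by rewrite hermC /= expr0 mul1r. Qed.

Lemma ipDl a b c : ip (a + b) c = ip a c + ip b c. Proof. exact: linearDl. Qed.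
Lemma ipDr a b c : ip c (a + b) = ip c a + ip c b. Proof. exact: linearDr. Qed.
Lemma ipZl t a b : ip (t *: a) b = t * ip a b. Proof. exact: linearZl_LR. Qed.
Lemma ipZr t a b : ip a (t *: b) = t * ip a b. Proof. by rewrite ipC ipZl ipC. Qed.
Lemma ipNl a b : ip (- a) b = - ip a b. Proof. by rewrite -scaleN1r ipZl mulN1r. Qed.

Lemma ipNr a b : ip a (- b) = - ip a b. Proof. by rewrite ipC ipNl ipC. Qed.

Lemma ip_norm a : ip a a = `|a| ^+ 2. Proof. exact: (aws_hilbert Haws). Qed.

Lemma ip_inj a b : (forall h, ip a h = ip b h) -> a = b.
Proof.
move=> h; apply/eqP; rewrite -subr_eq0 -normr_eq0 -sqrf_eq0 -ip_norm.
by rewrite ipDl ipNl h subrr.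
Qed.

Lemma ip_cauchy a b : `|ip a b| <= `|a| * `|b|.
Proof.
have [->|b0] := eqVneq b 0.
  by rewrite normr0 mulr0 -(scale0r b) ipZr mul0r normr0.
have nb : 0 < `|b| by rewrite normr_gt0.
(* The component of [a] orthogonal to [b], multiplied by [|b|^2] to avoid a division; its squared
   norm is [|b|^2 (|a|^2 |b|^2 - <a,b>^2)]. *)
have := sqr_ge0 `|(`|b| ^+ 2) *: a - ip a b *: b|.
rewrite -(ip_norm (`|b| ^+ 2 *: a - ip a b *: b)) !(ipDl, ipDr, ipNl, ipNr, ipZl, ipZr).
rewrite (ipC b a) !ip_norm.
move=> h; rewrite -(@ler_pXn2r _ 2) ?nnegrE ?mulr_ge0// real_normK ?num_real// exprMn.
rewrite -(ler_pM2l (exprn_gt0 2 nb)).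
by move: h; set x := ip a b; set u := `|a|; set v := `|b|; lra.
Qed.

(** As a field, [j] is a bare function; its linearity comes from being the adjoint of [i]. *)
Lemma j_comb (e1 e2 e3 : dual W) (a b : R) :
  (forall w, e3 w = a * e1 w + b * e2 w) -> j e3 = a *: j e1 + b *: j e2.
Proof.
move=> e3E; apply: ip_inj => h.
by rewrite ipDl !ipZl !(aws_riesz Haws) e3E.
Qed.

Lemma dual_eq0 (e : dual W) : j e = 0 -> forall w, e w = 0.
Proof.
move=> je w; have [z z0] := dual_zero W.
rewrite -(z0 w); apply: (aws_j_injective Haws); rewrite je.
apply: ip_inj => h; rewrite (aws_riesz Haws) z0.
by rewrite -(scale0r h) ipZl mul0r.
Qed.

Lemma dual_normalize (e : dual W) : j e != 0 ->
  exists e0 : dual W, `|j e0| = 1 /\ forall w, e w = `|j e| * e0 w.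
Proof.
move=> je0; have n0 : `|j e| != 0 by rewrite normr_eq0.
have [z z0] := dual_zero W.
have [e0 e0E] := dual_comb `|j e|^-1 0 e z.
exists e0; split.
  rewrite (j_comb e0E) scale0r addr0 normrZ ger0_norm ?invr_ge0//.
  by rewrite mulVf.
by move=> w; rewrite e0E z0 mulr0 addr0 mulrA divff// mul1r.
Qed.

Lemma dual_law_unit (e : dual W) (f : R -> R) : `|j e| = 1 ->
  bounded_measurable (f : measurableTypeR R -> R) ->
  \int[muW]_w f (e w) = \int[gamma]_r f r.
Proof.
move=> je bf.
have me : measurable_fun [set: borel W] (e : borel W -> measurableTypeR R).
  exact: measurable_dual.
have h A : measurable A -> (\int[muW]_(x in (e : borel W -> measurableTypeR R) @^-1` A) (1%R)%:E =
    \int[gamma]_(x in A) (1%R)%:E)%E.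
  move=> mA; rewrite !integral_cst//; last exact: measurable_preimage.
  have := aws_gaussian Haws e mA.
  by rewrite /pushforward /centered_gaussian je oner_eq0 => e1; congr (_ * _)%E.
have := bm_transfer me (bm_integrable muW (bm_cst _ 1)) (bm_integrable gamma (bm_cst _ 1)) h bf.
under eq_Rintegral do rewrite mulr1.
by under [RHS]eq_Rintegral do rewrite mulr1.
Qed.

Lemma dual_cos (e : dual W) : \int[muW]_w cos (e w) = expR (- `|j e| ^+ 2 / 2).
Proof.
have [je|je] := eqVneq (j e) 0.
  under eq_Rintegral do rewrite (dual_eq0 je) cos0.
  by rewrite Rintegral_prob_cst je normr0 expr0n /= oppr0 mul0r expR0.
have [e0 [je0 eE]] := dual_normalize je.
under eq_Rintegral do rewrite eE.
by rewrite (dual_law_unit je0 (bm_cosM _)) gamma_cos.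
Qed.

Lemma dual_sin (e : dual W) : \int[muW]_w sin (e w) = 0.
Proof.
have [je|je] := eqVneq (j e) 0.
  under eq_Rintegral do rewrite (dual_eq0 je) sin0.
  exact: Rintegral_prob_cst.
have [e0 [je0 eE]] := dual_normalize je.
under eq_Rintegral do rewrite eE.
by rewrite (dual_law_unit je0 (bm_sinM _)) gamma_sin.
Qed.

(** When [|j e| = 1] one has [e (i (j e)) = 1], so this resets the coordinate [e] of [z.2] to [z.1]
    and leaves every functional orthogonal to [e] unchanged. *)
Definition split_direction (e : dual W) (z : measurableTypeR R * borel W) : borel W :=
  (z.1 : R) *: i (j e) + ((z.2 : W) - e (z.2 : W) *: i (j e)).

Lemma dual_split (e e' : dual W) (r : R) (w : W) :
  e' (split_direction e (r, w)) = r * e' (i (j e)) + (e' w - e w * e' (i (j e))).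
Proof. by rewrite /split_direction !linearD linearN !linearZ. Qed.

Lemma measurable_split (e : dual W) :
  measurable_fun [set: measurableTypeR R * borel W] (split_direction e).
Proof.
apply: measurable_fun_borel; first exact: (aws_separable Haws).
move=> e'.
rewrite (_ : (fun z => _) = (fun z => (z.1 : R) * e' (i (j e)) +
    (e' (z.2 : W) - e (z.2 : W) * e' (i (j e))))); last first.
  by apply/funext => -[r w]; exact: dual_split.
have m1 : measurable_fun [set: measurableTypeR R * borel W] (fun z => z.1 : R).
  exact: measurable_fst.
have m2 (u : dual W) : measurable_fun [set: measurableTypeR R * borel W] (fun z => u (z.2 : W)).
  by apply: (measurableT_comp (measurable_dual u)); exact: measurable_snd.
apply: measurable_funD; first by apply: measurable_funM.
by apply: measurable_funB => //; apply: measurable_funM.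
Qed.

(** Independence is read off characteristic functionals: [e'] of the recombined point is
    [a * r + e'' w] with [a = <j e', j e>], and Pythagoras gives [|j e'|^2 = a^2 + |j e''|^2], so
    the Gaussian exponentials multiply to that of [muW]. *)
Lemma split_law (e : dual W) : `|j e| = 1 -> forall A : set (borel W), measurable A ->
  prod_prob gamma muW (split_direction e @^-1` A) = muW A.
Proof.
move=> je; have sepW := aws_separable Haws.
pose G : probability (measurableTypeR R) R := gamma.
have key (e' : dual W) : exists a (e'' : dual W),
    [/\ forall r w, e' (split_direction e (r, w)) = a * r + e'' w &
        `|j e'| ^+ 2 = a ^+ 2 + `|j e''| ^+ 2].
  set a := e' (i (j e)).
  have [e'' e''E] := dual_comb 1 (- a) e' e.
  exists a, e''; split; first by move=> r w; rewrite dual_split e''E -/a; ring.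
  rewrite -!ip_norm (j_comb e''E) scale1r !(ipDl, ipDr, ipZl, ipZr) (ipC (j e) (j e')).
  by rewrite [ip (j e') (j e)](aws_riesz Haws) -/a (ip_norm (j e)) je; ring.
have bmc (e' : dual W) : bounded_measurable (fun w : borel W => cos (e' (w : W))).
  by have := bm_cos_dual e' 0; under eq_fun do rewrite addr0.
have bms (e' : dual W) : bounded_measurable (fun w : borel W => sin (e' (w : W))).
  by have := bm_cos_dual e' (- (pi / 2)); under eq_fun do rewrite cosBpihalf.
pose Q := prod_prob G muW.
have fub (u v : R -> R) (a : R) (e' : dual W) : bounded_measurable (fun r : measurableTypeR R => u (a * r)) ->
    bounded_measurable (fun w : borel W => v (e' (w : W))) ->
    \int[Q]_z (u (a * (z.1 : R)) * v (e' (z.2 : W))) =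
    (\int[gamma]_r u (a * r)) * (\int[muW]_w v (e' w)).
  by move=> bu bv; exact: (Rintegral_prodM _ _ bu bv).
have ifub (u v : R -> R) (a : R) (e' : dual W) : bounded_measurable (fun r : measurableTypeR R => u (a * r)) ->
    bounded_measurable (fun w : borel W => v (e' (w : W))) ->
    Q.-integrable setT (EFin \o (fun z : measurableTypeR R * borel W => u (a * (z.1 : R)) * v (e' (z.2 : W)))).
  by move=> bu bv; exact: (bm_integrable Q (bmM (bm_fst _ bu) (bm_snd _ bv))).
apply: (trig_uniqueness (P := Q) (measurable_split e) sepW).
- move=> e'; have [a [e'' [eE nE]]] := key e'.
  transitivity (\int[Q]_z (cos (a * (z.1 : R)) * cos (e'' (z.2 : W)) - sin (a * (z.1 : R)) * sin (e'' (z.2 : W)))).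
    by apply: eq_Rintegral => -[r w] _; rewrite eE cosD.
  rewrite RintegralB//; [|exact: (ifub cos cos _ _ (bm_cosM a) (bmc e''))|exact: (ifub sin sin _ _ (bm_sinM a) (bms e''))].
  rewrite (fub cos cos _ _ (bm_cosM a) (bmc e'')) (fub sin sin _ _ (bm_sinM a) (bms e'')).
  by rewrite gamma_cos gamma_sin mul0r subr0 !dual_cos -expRD nE; congr expR; field.
- move=> e'; have [a [e'' [eE nE]]] := key e'.
  transitivity (\int[Q]_z (sin (a * (z.1 : R)) * cos (e'' (z.2 : W)) + cos (a * (z.1 : R)) * sin (e'' (z.2 : W)))).
    by apply: eq_Rintegral => -[r w] _; rewrite eE sinD.
  rewrite RintegralD//; [|exact: (ifub sin cos _ _ (bm_sinM a) (bmc e''))|exact: (ifub cos sin _ _ (bm_cosM a) (bms e''))].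
  rewrite (fub sin cos _ _ (bm_sinM a) (bmc e'')) (fub cos sin _ _ (bm_cosM a) (bms e'')).
  by rewrite gamma_sin !dual_sin mul0r mulr0 addr0.
Qed.

(* Under muW the coordinate e is a standard Gaussian independent of the remaining part. *)
Lemma disintegration (e : dual W) (F : borel W -> R) : `|j e| = 1 ->
  measurable_fun setT F -> (forall w, 0 <= F w) ->
  (\int[muW]_w (F w)%:E = \int[muW]_w \int[gamma]_r (F (split_direction e (r, w)))%:E)%E.
Proof.
move=> je mF F0; pose G : probability (measurableTypeR R) R := gamma.
rewrite -(@prod_prob_ge0_sym _ _ _ _ _ G muW (fun z => F (split_direction e z)))//; last first.
  by apply: (measurableT_comp mF); exact: measurable_split.
have := @ge0_transfer _ _ _ _ _ (prod_prob G muW) muW _ (measurable_split e) (fun=> 1) F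
  (bm_integrable muW (bm_cst _ 1)).
move=> ->//.
- by apply: eq_integral => w _; rewrite mulr1.
- by rewrite ltey_eq fin_num_measure.
- by move=> A mA; rewrite integral_cst// mul1e; exact: split_law.
Qed.

Lemma measurable_shift (v : W) : measurable_fun [set: borel W] (fun w : borel W => (w : W) + v : borel W).
Proof.
apply: measurable_fun_borel; first exact: (aws_separable Haws).
move=> e; under eq_fun do rewrite linearD.
by apply: measurable_funD => //; exact: measurable_dual.
Qed.

(** The shift moves only the normalized coordinate [e0], by [t = |j e|]. After disintegration along
    [e0] it becomes the shift of a standard Gaussian on the line. *)
Theorem cameron_martin (e : dual W) (F : borel W -> R) :
  measurable_fun setT F -> (forall w, 0 <= F w) ->
  (\int[muW]_w (F ((w : W) + i (j e)))%:E =
   \int[muW]_w (F w * expR (e (w : W) - `|j e| ^+ 2 / 2))%:E)%E.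
Proof.
move=> mF F0.
have [je|je] := eqVneq (j e) 0.
  apply: eq_integral => w _.
  by rewrite (dual_eq0 je) je linear0 addr0 normr0 expr0n /= mul0r subrr expR0 mulr1.
have [e0 [je0 eE]] := dual_normalize je.
set t := `|j e| in eE *.
have je_t : j e = t *: j e0.
  have [z z0] := dual_zero W.
  have -> : j e = t *: j e0 + 0 *: j z by apply: j_comb => w; rewrite z0 mulr0 addr0 eE.
  by rewrite scale0r addr0.
rewrite (disintegration je0); last 2 first.
- by apply: (measurableT_comp mF); exact: measurable_shift.
- by [].
rewrite [RHS](disintegration je0); last 2 first.
- apply: measurable_funM => //; apply: measurableT_comp => //.
  by apply: measurable_funB => //; exact: measurable_dual.
- by move=> w; rewrite mulr_ge0// expR_ge0.
apply: eq_integral => w _.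
have e0e0 : e0 (i (j e0)) = 1 by rewrite -(aws_riesz Haws) ip_norm je0 expr1n.
have mf : measurable_fun [set: measurableTypeR R] (fun r => F (split_direction e0 (r, w))).
  apply: (measurableT_comp mF); apply: (measurableT_comp (measurable_split e0)).
  exact: measurable_fun_pair.
transitivity (\int[gamma]_r (F (split_direction e0 (r + t, w)))%:E)%E.
  apply: eq_integral => r _; congr (F _)%:E.
  have hW (u x : W) (a b : R) : a *: u + x + b *: u = (a + b) *: u + x.
    by rewrite scalerDl addrAC.
  have -> : i (j e) = t *: i (j e0) by rewrite je_t linearZ.
  exact: hW.
rewrite (gamma_shift t mf (fun r => F0 _)); apply: eq_integral => r _; congr (F _ * expR _)%:E.
by rewrite eE dual_split e0e0; ring.
Qed.

End cameron_martin.

(** * The logarithmic Sobolev inequality on the line *)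

Lemma mulr_ln_ge (R : realType) (t : R) : 0 < t -> t - 1 <= t * ln t.
Proof.
move=> t0; have : -1 < t^-1 - 1 by rewrite ltrBrDr addNr invr_gt0.
move/le_ln1Dx; rewrite addrC subrK lnV ?posrE// => h.
have : t * (- ln t) <= t * (t^-1 - 1) by rewrite ler_wpM2l// ltW.
rewrite mulrBr divff ?gt_eqF//; lra.
Qed.

Section real_calculus.
Variable R : realType.
Implicit Types (f g : R -> R).

Lemma is_derive_continuous f f' : (forall x, is_derive x (1 : R) f (f' x)) -> continuous f.
Proof.
move=> df x; apply: differentiable_continuous; apply/derivable1_diffP.
by apply: ex_derive; exact: df.
Qed.

Lemma MVT_global f f' (a b : R) : (forall x, is_derive x (1 : R) f (f' x)) -> a < b ->
  exists2 c, a < c < b & f b - f a = f' c * (b - a).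
Proof.
move=> df ab; have cf := is_derive_continuous df.
have [c cab e] := MVT ab (fun x _ => df x) (continuous_subspaceT cf).
by exists c => //; move: cab; rewrite in_itv.
Qed.

Lemma FTC2_global f f' (a b : R) : a < b -> (forall x, is_derive x (1 : R) f (f' x)) ->
  continuous f' -> (\int[@lebesgue_measure R]_(x in `[a, b]) (f' x)%:E = (f b - f a)%:E)%E.
Proof.
move=> ab df cf'; rewrite EFinB; have cf := is_derive_continuous df.
apply: continuous_FTC2 => //.
- exact: continuous_subspaceT.
- split; first by move=> x _; apply: ex_derive.
    by apply: cvg_at_right_filter; exact: cf.
  by apply: cvg_at_left_filter; exact: cf.
- by move=> x _; rewrite derive1E; apply: derive_val.
Qed.

Lemma continuous_itv_integrable f (a b : R) : continuous f ->
  (@lebesgue_measure R).-integrable `[a, b] (EFin \o f).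
Proof.
move=> cf; apply: continuous_compact_integrable; first exact: segment_compact.
exact: continuous_subspaceT.
Qed.

End real_calculus.

Section distribution_function.
Variables (R : realType) (h : R -> R).
Notation leb := (@lebesgue_measure R).
Hypotheses (ch : continuous h) (h_gt0 : forall x, 0 < h x).
Hypothesis ih : leb.-integrable setT (EFin \o h).
Hypothesis h1 : \int[leb]_x h x = 1.

Definition distr (x : R) := \int[leb]_(t in `]-oo, x]) h t.

Lemma is_derive_distr (x : R) : is_derive x (1 : R) distr (h x).
Proof.
have xx : x < x + 1 by rewrite ltrDl.
have iu : leb.-integrable [set` Interval -oo%O (BRight (x + 1))] (EFin \o h).
  by apply: integrableS ih.
have [d1 d2] := @continuous_FTC1 R h -oo%O x (x + 1) xx iu (ltNyr x) (@ch x).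
rewrite derive1E in d2; exact: (DeriveDef d1 d2).
Qed.

Lemma distr_lt (x y : R) : x < y -> distr x < distr y.
Proof.
move=> xy; have [c _ e] := MVT_global is_derive_distr xy.
by rewrite -subr_gt0 e mulr_gt0// subr_gt0.
Qed.

Lemma distrE (x : R) : distr x = \int[leb]_t (\1_(`]-oo, x]%classic) t * h t).
Proof.
by congr fine; rewrite integral_indicM//; exact: measurable_itv.
Qed.

Let mh : measurable_fun [set: measurableTypeR R] h.
Proof. by apply/measurable_EFinP; exact: measurable_int ih. Qed.

Let ind_le (A : set (measurableTypeR R)) t : `|\1_A t * h t| <= h t.
Proof.
rewrite normrM (gtr0_norm (h_gt0 t)) ler_piMl ?(ltW (h_gt0 t))// indicE.
by case: (_ \in _); rewrite /= ?normr1 ?normr0.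
Qed.

Lemma distr_cvg1 : distr n%:R @[n --> \oo] --> (1 : R).
Proof.
rewrite -[X in _ --> X]h1; under eq_fun do rewrite distrE.
apply: (@dominated_Rcvg _ (measurableTypeR R) R leb
  (fun n t => \1_(`]-oo, n%:R]%classic) t * h t) h h) => //.
- by move=> n; apply: measurable_funM => //; apply: measurable_indic; exact: measurable_itv.
- move=> x; apply: cvg_near_cst; near=> n.
  rewrite indicE mem_set ?mul1r//= in_itv /=.
  by near: n; exact: nbhs_infty_ger.
Unshelve. all: by end_near. Qed.

Lemma distr_cvg0 : distr (- n%:R) @[n --> \oo] --> (0 : R).
Proof.
have -> : (0 : R) = \int[leb]_x (fun=> 0) x by rewrite /Rintegral integral0_eq.
under eq_fun do rewrite distrE.
apply: (@dominated_Rcvg _ (measurableTypeR R) R leb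
  (fun n t => \1_(`]-oo, - n%:R]%classic) t * h t) (fun=> 0) h) => //.
- by move=> n; apply: measurable_funM => //; apply: measurable_indic; exact: measurable_itv.
- move=> x; apply: cvg_near_cst; near=> n.
  rewrite indicE memNset ?mul0r//= in_itv /=; apply/negP; rewrite -ltNge ltrNl.
  by near: n; exact: nbhs_infty_gtr.
Unshelve. all: by end_near. Qed.

Lemma distr_gt0 (x : R) : 0 < distr x.
Proof.
apply: (@le_lt_trans _ _ (distr (x - 1))); last by apply: distr_lt; rewrite gtrBl.
by apply: Rintegral_ge0 => t _; exact: ltW.
Qed.

Lemma distr_lt1 (x : R) : distr x < 1.
Proof.
apply: (@lt_le_trans _ _ (distr (x + 1))); first by apply: distr_lt; rewrite ltrDl.
rewrite -[leRHS]h1 distrE; apply: le_Rintegral => //.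
  by apply: bm_integrableM ih; apply: bm_indic; exact: measurable_itv.
by move=> t _; apply: le_trans (ler_norm _) (ind_le _ _).
Qed.

Lemma distr_surj (v : R) : 0 < v < 1 -> exists t, distr t = v.
Proof.
move=> /andP[v0 v1].
have [n hn] : exists n : nat, v < distr n%:R.
  have /cvgrPdist_lt /(_ (1 - v)) := distr_cvg1; rewrite subr_gt0 => /(_ v1)[n _ /(_ n (leqnn n))].
  by move=> /= /(le_lt_trans (ler_norm _)) ?; exists n; lra.
have [m hm] : exists m : nat, distr (- m%:R) < v.
  have /cvgrPdist_lt /(_ v v0)[n' _ /(_ n' (leqnn n'))] := distr_cvg0.
  by rewrite /= sub0r normrN => /(le_lt_trans (ler_norm _)) ?; exists n'.
have mn : - m%:R <= n%:R :> R.
  rewrite leNgt; apply/negP => /distr_lt; lra.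
have [c _ cE] : exists2 c, c \in `[- m%:R, n%:R] & distr c = v.
  apply: (IVT mn); first exact: (continuous_subspaceT (is_derive_continuous is_derive_distr)).
  by rewrite ge_min le_max (ltW hm) (ltW hn) orbT.
by exists c.
Qed.

Definition quantile (v : R) := xget 0 [set t | distr t = v].

Lemma distr_quantile (v : R) : 0 < v < 1 -> distr (quantile v) = v.
Proof. by move=> /distr_surj[t tv]; apply: (@xgetPex _ 0 [set t | distr t = v]); exists t. Qed.

Lemma quantile_distr (x : R) : quantile (distr x) = x.
Proof.
have : distr (quantile (distr x)) = distr x.
  by apply: distr_quantile; rewrite distr_gt0 distr_lt1.
by have [/distr_lt|/distr_lt|] := ltgtP (quantile (distr x)) x => //; lra.
Qed.

Lemma is_derive_quantile (x : R) : is_derive (distr x) (1 : R) quantile (h x)^-1.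
Proof.
apply: is_derive_inverse.
- by apply: filterE => y; exact: quantile_distr.
- by apply: filterE => y; exact: (is_derive_continuous is_derive_distr).
- exact: is_derive_distr.
- by rewrite gt_eqF.
Qed.

End distribution_function.

Section log_sobolev_line.
Variable R : realType.
Notation gamma := (normal_prob (0 : R) 1).
Notation leb := (@lebesgue_measure R).

Lemma is_derive_normal_pdf (x : R) :
  is_derive x (1 : R) (normal_pdf 0 1) (- x * normal_pdf 0 1 x).
Proof.
set p : R -> R := normal_pdf 0 1.
have pE : p = (fun x => p 0 * expR (- x ^+ 2 / 2)).
  by apply/funext => y; exact: normal_pdf01E.
have h : is_derive x (1 : R) (fun x => - x ^+ 2 / 2) (- x).
  by apply: is_derive_eq; rewrite /= /GRing.scale /=; lra.
have h2 := @is_derive1_comp _ expR (fun x => - x ^+ 2 / 2) x _ _ (is_derive_expR _) h.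
have h3 := is_deriveZ (p 0) h2.
rewrite [X in is_derive _ _ X _](pE : _ = p 0 *: (expR \o (fun x => - x ^+ 2 / 2))).
apply: (is_derive_eq h3); have -> : p x = p 0 * expR (- x ^+ 2 / 2) by exact: normal_pdf01E.
by rewrite /GRing.scale /=; move: (p 0) (expR _) => a b; ring.
Qed.

(** * Monotone transport to the Gaussian *)

Section transport.
Variables (p : R -> R) (pE : p = normal_pdf 0 1) (f f' : R -> R).
Hypotheses (f_gt0 : forall x, 0 < f x) (df : forall x, is_derive x (1 : R) f (f' x)).
Hypotheses (cf' : continuous f') (if1 : (\int[gamma]_x (f x)%:E = 1)%E).

Let cf : continuous f := is_derive_continuous df.
Let p_gt0 x : 0 < p x. Proof. by rewrite pE; exact: normal_pdf01_gt0. Qed.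
Let cp : continuous p. Proof. by rewrite pE; apply: continuous_normal_pdf; exact: oner_neq0. Qed.
Let p01 x : p x = p 0 * expR (- x ^+ 2 / 2). Proof. by rewrite pE; exact: normal_pdf01E. Qed.
Let dp x : is_derive x (1 : R) p (- x * p x). Proof. by rewrite pE; exact: is_derive_normal_pdf. Qed.
Let int_gamma (g : R -> R) : measurable_fun setT g -> (forall x, 0 <= g x) ->
  (\int[gamma]_x (g x)%:E = \int[leb]_x (g x * p x)%:E)%E.
Proof. by rewrite pE; exact: ge0_integral_gamma. Qed.
Let mf : measurable_fun setT f := continuous_measurable_fun cf.

Let h x := f x * p x.
Let h_gt0 x : 0 < h x. Proof. by rewrite mulr_gt0. Qed.
Let ch : continuous h. Proof. by move=> x; apply: cvgM; [exact: cf|exact: cp]. Qed.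

Let hE : (\int[leb]_x (h x)%:E = 1)%E.
Proof. by rewrite -int_gamma// => x; exact: ltW. Qed.

Let ih : leb.-integrable setT (EFin \o h).
Proof.
apply/integrableP; split; first by apply/measurable_EFinP; exact: continuous_measurable_fun ch.
under eq_integral do rewrite /= ger0_norm ?ltW//.
by rewrite hE ltry.
Qed.

Let h1 : \int[leb]_x h x = 1. Proof. by rewrite /Rintegral hE. Qed.

Let ip : leb.-integrable setT (EFin \o p). Proof. by rewrite pE; exact: integrable_normal_pdf. Qed.
Let p1 : \int[leb]_x p x = 1. Proof. by rewrite /Rintegral pE integral_normal_pdf. Qed.

(* The monotone map transporting f gamma to gamma, its displacement, and the boundary term. *)
Let T x := quantile p (distr h x).
Let theta x := T x - x.
Let E x := theta x * h x.

Let distr_T x : distr p (T x) = distr h x.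
Proof.
by apply: distr_quantile => //; rewrite distr_gt0// distr_lt1.
Qed.

Let dT x : is_derive x (1 : R) T (h x / p (T x)).
Proof.
have d1 : is_derive (distr h x) (1 : R) (quantile p) (p (T x))^-1.
  by rewrite -distr_T; exact: is_derive_quantile.
have d2 := is_derive_distr ch ih x.
have := @is_derive1_comp _ (quantile p) (distr h) x _ _ d1 d2.
by rewrite mulrC.
Qed.

Let cT : continuous T := is_derive_continuous dT.

Let E' x := (h x / p (T x) - 1) * h x + theta x * (f' x * p x - x * h x).

Let dE x : is_derive x (1 : R) E (E' x).
Proof.
have d1 := dT x; have d2 := df x; have d3 := dp x.
have d4 : is_derive x (1 : R) (f * p) (f' x * p x - x * h x).
  apply: (is_derive_eq (is_deriveM d2 d3)).
  by rewrite /h /GRing.scale /=; ring.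
have d5 : is_derive x (1 : R) (T - id) (h x / p (T x) - 1).
  exact: is_deriveB.
apply: (is_derive_eq (is_deriveM d5 d4)).
by rewrite /E' /h /theta !fctE /GRing.scale /= /h; ring.
Qed.

Let cE' : continuous E'.
Proof.
move=> x.
have ct := @cT x.
have cpT : continuous_at x (p \o T) by apply: continuous_comp => //; exact: cp.
apply: cvgD; apply: cvgM.
- apply: cvgB; last exact: cvg_cst.
  apply: cvgM; first exact: ch.
  by apply: cvgV; [rewrite gt_eqF|exact: cpT].
- exact: ch.
- by apply: cvgB; [exact: cT|exact: cvg_id].
- apply: cvgB; apply: cvgM; [exact: cf'|exact: cp|exact: cvg_id|exact: ch].
Qed.

Let I x := f' x ^+ 2 / (2 * f x) * p x.

(* f = T' p(T) / p, hence ln f = ln (1 + theta') - (T^2 - x^2) / 2. *)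
Let pointwise x : f x * ln (f x) * p x <= I x + E' x.
Proof.
set th' := h x / p (T x) - 1.
have hT : 0 < h x / p (T x) by rewrite divr_gt0.
have lnf : ln (f x) <= th' - x * theta x - theta x ^+ 2 / 2.
  have -> : f x = (h x / p (T x)) * expR (x ^+ 2 / 2 - T x ^+ 2 / 2).
    rewrite /h (p01 x) (p01 (T x)) expRD !mulNr !expRN.
    have e1 := expR_gt0 (x ^+ 2 / 2); have e2 := expR_gt0 (T x ^+ 2 / 2).
    have e3 := p_gt0 0.
    by field; rewrite !gt_eqF.
  rewrite lnM ?posrE ?expR_gt0// expRK.
  have -> : h x / p (T x) = 1 + th' by rewrite /th' addrC subrK.
  have := @le_ln1Dx _ th'; rewrite /th' ltrBrDr addNr => /(_ hT).
  by rewrite /theta; lra.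
have h1' : f x * ln (f x) * p x <= f x * (th' - x * theta x - theta x ^+ 2 / 2) * p x.
  apply: ler_wpM2r; first exact: ltW.
  by apply: ler_wpM2l => //; exact: ltW.
apply: le_trans h1' _.
(* Exactly the amount lost: with [ln (1 + theta')] bounded by [theta'], the right side minus the
   left is this completed square. *)
have sq : 0 <= (f' x + theta x * f x) ^+ 2 / (2 * f x) * p x.
  by rewrite mulr_ge0 ?(ltW (p_gt0 x))// mulr_ge0 ?sqr_ge0// invr_ge0 mulr_ge0// ltW.
rewrite -subr_ge0; apply: le_trans sq _; rewrite le_eqVlt; apply/orP; left; apply/eqP.
rewrite /I /E' -/th' /h; have := f_gt0 x; move: (f x) => a a0.
by field; rewrite gt_eqF.
Qed.

(* If the boundary term stayed above eps, then - p(T) would grow linearly. *)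
Let boundary_right (eps : R) (N : nat) : 0 < eps -> exists2 b, N%:R <= b & E b <= eps.
Proof.
move=> e0; apply: contrapT => nb.
have Eb b : N%:R <= b -> eps < E b.
  by move=> Nb; rewrite ltNge; apply/negP => Eb; apply: nb; exists b.
have dpT x : is_derive x (1 : R) (fun x => - p (T x)) (T x * h x).
  have d1 := @is_derive1_comp _ p T x _ _ (dp _) (dT x).
  apply: (is_derive_eq (is_deriveN d1)).
  by field; rewrite gt_eqF.
(* Over a length [(p 0 + 1) / eps] the function [- p (T x)] would grow by more than [p 0 + 1], while
   [p] takes values between 0 and [p 0] only. *)
pose b := N%:R + (p 0 + 1) / eps.
have Nb : N%:R < b by rewrite ltrDl divr_gt0// addr_gt0.
have [c /andP[Nc cb] e] := MVT_global dpT Nb.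
have thc : eps < T c * h c.
  apply: (lt_le_trans (Eb c (ltW Nc))); rewrite ler_wpM2r ?(ltW (h_gt0 c))// /theta.
  by rewrite gerBl; apply: le_trans (ltW Nc).
have pmax x : p x <= p 0.
  rewrite (p01 x) ler_piMr ?(ltW (p_gt0 0))// -[leRHS]expR0 ler_expR mulNr oppr_le0.
  by rewrite divr_ge0// sqr_ge0.
have : eps * (b - N%:R) < T c * h c * (b - N%:R) by rewrite ltr_pM2r// subr_gt0.
rewrite -e {1}/b addrAC subrr add0r mulrC divfK ?gt_eqF//.
have := p_gt0 (T b); have := pmax (T N%:R).
move: (p (T b)) (p (T N%:R)) (p 0) => q1 q2 q3; lra.
Qed.

Let boundary_left (eps : R) (N : nat) : 0 < eps -> exists2 a, a <= - N%:R & - eps <= E a.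
Proof.
move=> e0; apply: contrapT => nb.
have Eb b : b <= - N%:R -> E b < - eps.
  by move=> Nb; rewrite ltNge; apply/negP => Eb; apply: nb; exists b.
have dpT x : is_derive x (1 : R) (fun x => - p (T x)) (T x * h x).
  have d1 := @is_derive1_comp _ p T x _ _ (dp _) (dT x).
  apply: (is_derive_eq (is_deriveN d1)).
  by field; rewrite gt_eqF.
pose b := - N%:R - (p 0 + 1) / eps.
have Nb : b < - N%:R by rewrite ltrBlDr ltrDl divr_gt0// addr_gt0.
have [c /andP[bc cN] e] := MVT_global dpT Nb.
have thc : T c * h c < - eps.
  apply: le_lt_trans (Eb c (ltW cN)); rewrite ler_wpM2r ?(ltW (h_gt0 c))// /theta.
  by rewrite lerDl oppr_ge0; apply: le_trans (ltW cN) _; rewrite oppr_le0.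
have pmax x : p x <= p 0.
  rewrite (p01 x) ler_piMr ?(ltW (p_gt0 0))// -[leRHS]expR0 ler_expR mulNr oppr_le0.
  by rewrite divr_ge0// sqr_ge0.
have : T c * h c * (- N%:R - b) < - eps * (- N%:R - b) by rewrite ltr_pM2r// subr_gt0.
have bE : - N%:R - b = (p 0 + 1) / eps by rewrite /b opprB addrCA subrr addr0.
rewrite -e bE mulNr [eps * _]mulrC divfK ?gt_eqF//.
have := p_gt0 (T b); have := pmax (T (- N%:R)).
move: (p (T b)) (p (T (- N%:R))) (p 0) => q1 q2 q3; lra.
Qed.

(** Since [f ln f >= f - 1 >= -1], adding one copy of [p] makes the integrand nonnegative, so that
    its integral grows with the interval; that copy has mass 1, the constant in the bounds below. *)
Let k x := (f x * ln (f x) + 1) * p x.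

Let k_ge0 x : 0 <= k x.
Proof.
apply: mulr_ge0; last exact: ltW.
have f0 := f_gt0 x; have := mulr_ln_ge (f_gt0 x); lra.
Qed.

Let cI : continuous I.
Proof.
move=> x; apply: cvgM; last exact: cp.
apply: cvgM; first by apply: cvgM; exact: cf'.
apply: cvgV; first by rewrite gt_eqF// mulr_gt0.
by apply: cvgM; [exact: cvg_cst|exact: cf].
Qed.

Let I_ge0 x : 0 <= I x.
Proof.
by rewrite mulr_ge0 ?(ltW (p_gt0 x))// mulr_ge0 ?sqr_ge0// invr_ge0 mulr_ge0// ltW.
Qed.

Let ck : continuous k.
Proof.
move=> x; apply: cvgM; last exact: cp.
apply: cvgD; last exact: cvg_cst.
apply: cvgM; first exact: cf.
have hl : continuous_at x (@ln R \o f) by apply: continuous_comp; [exact: cf|exact: continuous_ln].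
exact: hl.
Qed.

(** Integrating [pointwise] over an interval leaves the boundary term [E b - E a]. Endpoints beyond
    the given interval are chosen so that this is at most [e]; such endpoints exist arbitrarily far
    out, which suffices because [k] is nonnegative. *)
Let k_itv (N : nat) : (\int[leb]_(x in `[(- N.+1%:R)%R, N.+1%:R%R]) (k x)%:E <=
  \int[leb]_x (I x)%:E + 1)%E.
Proof.
apply/lee_addgt0Pr => e e0.
have e2 : 0 < e / 2 by rewrite divr_gt0.
have [b Nb Eb] := boundary_right N.+1 e2; have [a Na Ea] := boundary_left N.+1 e2.
have N0 : 0 < N.+1%:R :> R by rewrite ltr0n.
have ab : a < b by lra.
have mk : measurable_fun [set: measurableTypeR R] (EFin \o k).
  by apply/measurable_EFinP; exact: continuous_measurable_fun.
apply: (@le_trans _ _ (\int[leb]_(x in `[a, b]) (k x)%:E)%E).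
  apply: ge0_subset_integral => //.
  - exact: measurable_funS mk.
  - by move=> x _; rewrite lee_fin.
  - by apply: subset_itv; rewrite bnd_simp.
have iI := continuous_itv_integrable a b cI.
have iE := continuous_itv_integrable a b cE'.
have ipab := continuous_itv_integrable a b cp.
have kle x : k x <= I x + (E' x + p x).
  by have := pointwise x; rewrite /k mulrDl mul1r; lra.
apply: (@le_trans _ _ (\int[leb]_(x in `[a, b]) ((I x)%:E + ((E' x)%:E + (p x)%:E)))%E).
  apply: ge0_le_integral => //.
  - by move=> x _; rewrite lee_fin.
  - exact: measurable_funS mk.
  - by apply: (measurable_int leb); apply: integrableD => //; exact: integrableD.
  - by move=> x _; rewrite -!EFinD lee_fin.
rewrite integralD//; last exact: integrableD.
rewrite integralD// (FTC2_global ab dE cE').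
rewrite -[leRHS]addeA; apply: leeD.
  apply: ge0_subset_integral => //.
  - by apply/measurable_EFinP; exact: continuous_measurable_fun.
  - by move=> x _; rewrite lee_fin.
rewrite addeC; apply: leeD; last by rewrite lee_fin; lra.
rewrite -[leRHS](integral_normal_pdf (0 : R) 1) -pE.
apply: ge0_subset_integral => //.
- by apply/measurable_EFinP; exact: continuous_measurable_fun.
- by move=> x _; rewrite lee_fin ltW.
Qed.

Lemma log_sobolev_unit :
  (\int[gamma]_x (f x * ln (f x) - f x + 1)%:E <=
   \int[gamma]_x (f' x ^+ 2 / (2 * f x))%:E)%E.
Proof.
have kI : (\int[leb]_x (k x)%:E <= \int[leb]_x (I x)%:E + 1)%E.
  pose g (n : nat) (x : R) := \1_(`[- n.+1%:R, n.+1%:R]%classic) x * k x.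
  have mi n : measurable (`[- n.+1%:R, n.+1%:R]%classic : set (measurableTypeR R)).
    exact: measurable_itv.
  have gk : (\int[leb]_x (g n x)%:E @[n --> \oo] --> \int[leb]_x (k x)%:E)%E.
    apply: (@monotone_Rcvg _ (measurableTypeR R) R leb g k).
    - move=> n; apply: measurable_funM; first exact: measurable_indic.
      exact: continuous_measurable_fun.
    - by move=> n x; rewrite mulr_ge0// indicE ler0n.
    - move=> x m n mn; rewrite ler_wpM2r// !indicE ler_nat.
      case: (boolP (x \in `[- m.+1%:R, m.+1%:R]%classic)) => //=.
      rewrite inE /= in_itv /= => /andP[h2 h3]; rewrite mem_set//= in_itv /=.
      have : m.+1%:R <= n.+1%:R :> R by rewrite ler_nat.
      lra.
    - move=> x; apply: cvg_near_cst; near=> n.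
      rewrite /g indicE mem_set ?mul1r//= in_itv /= -ler_norml.
      apply: (@le_trans _ _ n%:R); last by rewrite ler_nat.
      by near: n; exact: nbhs_infty_ger.
  apply: (cvge_to_le gk); apply: nearW => n.
  by rewrite /g integral_indicM.
have Psi_ge0 x : 0 <= f x * ln (f x) - f x + 1.
  by have := mulr_ln_ge (f_gt0 x); lra.
have mlnf : measurable_fun setT (fun x => f x * ln (f x)).
  by apply: measurable_funM => //; exact: measurableT_comp.
rewrite -(leeD2rE _ _ (_ : 1%E \is a fin_num))//.
rewrite -{1}if1 -ge0_integralD//; last 4 first.
- by move=> x _; rewrite lee_fin.
- apply/measurable_EFinP; apply: measurable_funD => //; exact: measurable_funB.
- by move=> x _; rewrite lee_fin ltW.
- exact/measurable_EFinP.
under eq_integral do rewrite -EFinD.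
rewrite int_gamma; last 2 first.
- by apply: measurable_funD => //; apply: measurable_funD => //; exact: measurable_funB.
- by move=> x; rewrite addr_ge0// ltW.
rewrite int_gamma; last 2 first.
- apply: continuous_measurable_fun => x.
  apply: cvgM; first by apply: cvgM; exact: cf'.
  apply: cvgV; first by rewrite gt_eqF// mulr_gt0.
  by apply: cvgM; [exact: cvg_cst|exact: cf].
- by move=> x; rewrite mulr_ge0 ?sqr_ge0// invr_ge0 mulr_ge0// ltW.
apply: le_trans kI; rewrite le_eqVlt; apply/orP; left; apply/eqP.
by apply: eq_integral => x _; congr EFin; rewrite /k; ring.
Unshelve. all: by end_near. Qed.

End transport.

Lemma log_sobolev_line (g g' : R -> R) (m : R) :
  0 < m ->
  (forall x, 0 < g x) -> (forall x, is_derive x (1 : R) g (g' x)) -> continuous g' ->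
  (\int[gamma]_x (g x)%:E = m%:E)%E ->
  (\int[gamma]_x (g x * ln (g x / m) - g x + m)%:E <=
   \int[gamma]_x (g' x ^+ 2 / (2 * g x))%:E)%E.
Proof.
move=> m_gt0 g0 dg cg' gm; have m_ge0 := ltW m_gt0.
have cg : continuous g := is_derive_continuous dg.
have mg : measurable_fun setT g := continuous_measurable_fun cg.
have fm : (\int[gamma]_x (g x / m)%:E = 1)%E.
  under eq_integral do rewrite mulrC EFinM.
  rewrite ge0_integralZl_EFin ?invr_ge0//.
  - by rewrite gm -EFinM mulVf// gt_eqF.
  - by move=> x _; rewrite lee_fin ltW.
  - by apply/measurable_EFinP.
have dfm x : is_derive x (1 : R) (fun x => g x / m) (g' x / m).
  have -> : (fun x => g x / m) = m^-1 *: g by apply/funext => y; rewrite mulrC.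
  by apply: (is_derive_eq (is_deriveZ m^-1 (dg x))); rewrite mulrC.
have cfm : continuous (fun x => g' x / m).
  by move=> x; apply: cvgM; [exact: cg'|exact: cvg_cst].
have fm_gt0 x : 0 < g x / m by rewrite divr_gt0.
have := log_sobolev_unit erefl fm_gt0 dfm cfm fm.
have mcfm : measurable_fun setT (fun x => g x / m) by exact: measurable_funM.
have Psi_ge0 x : 0 <= g x / m * ln (g x / m) - g x / m + 1.
  by have := mulr_ln_ge (fm_gt0 x); lra.
have mPsi : measurable_fun [set: measurableTypeR R]
    (fun x => g x / m * ln (g x / m) - g x / m + 1).
  apply: measurable_funD => //; apply: measurable_funB => //.
  by apply: measurable_funM => //; exact: measurableT_comp.
have mJ : measurable_fun [set: measurableTypeR R] (fun x => (g' x / m) ^+ 2 / (2 * (g x / m))).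
  apply: continuous_measurable_fun => x.
  apply: cvgM; first by apply: cvgM; exact: cfm.
  apply: cvgV; first by rewrite gt_eqF// mulr_gt0.
  by apply: cvgM; [exact: cvg_cst|apply: cvgM; [exact: cg|exact: cvg_cst]].
have J0 x : 0 <= (g' x / m) ^+ 2 / (2 * (g x / m)).
  by rewrite mulr_ge0 ?sqr_ge0// invr_ge0 mulr_ge0// ltW.
have m0E : (0 <= m%:E)%E by rewrite lee_fin.
move=> /(lee_wpmul2l m0E).
rewrite -(@ge0_integralZl_real _ _ _ gamma _ _ m_ge0 Psi_ge0 mPsi).
rewrite -(@ge0_integralZl_real _ _ _ gamma _ _ m_ge0 J0 mJ).
rewrite (_ : (\int[gamma]_x (m * (g x / m * ln (g x / m) - g x / m + 1))%:E)%E =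
  (\int[gamma]_x (g x * ln (g x / m) - g x + m)%:E)%E); last first.
  by apply: eq_integral => x _; congr EFin; field; rewrite gt_eqF.
move=> hle; apply: (le_trans hle); rewrite le_eqVlt; apply/orP; left; apply/eqP.
apply: eq_integral => x _; congr EFin.
by field; rewrite !gt_eqF.
Qed.

(** The integral of [g ln g - g + 1] splits into the entropy of [g] relative to its mean [m] and the
    same expression at [m]. Splitting needs integrability, so infinite information is set aside
    first. In this form the bound can be iterated over directions. *)
Lemma log_sobolev_line_entropy (g g' : R -> R) (m : R) :
  0 < m -> (forall x, 0 < g x) -> (forall x, is_derive x (1 : R) g (g' x)) -> continuous g' ->
  (\int[gamma]_x (g x)%:E = m%:E)%E ->
  (\int[gamma]_x (g x * ln (g x) - g x + 1)%:E <=
   (m * ln m - m + 1)%:E + \int[gamma]_x (g' x ^+ 2 / (2 * g x))%:E)%E.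
Proof.
move=> m0 g0 dg cg' gm.
have mg : measurable_fun setT g := continuous_measurable_fun (is_derive_continuous dg).
pose A x := g x * ln (g x / m) - g x + m.
have A0 x : 0 <= A x.
  rewrite /A; have gm0 : 0 < g x / m by rewrite divr_gt0.
  set u := g x / m in gm0 *; have -> : g x = m * u by rewrite /u mulrC divfK ?gt_eqF.
  by have := ler_wpM2l (ltW m0) (mulr_ln_ge gm0); rewrite -/u mulrBr mulr1; lra.
have mA : measurable_fun [set: measurableTypeR R] A.
  apply: measurable_funD => //; apply: measurable_funB => //.
  by apply: measurable_funM => //; apply: measurableT_comp => //; exact: measurable_funM.
have lsi := log_sobolev_line m0 g0 dg cg' gm.
set J := (X in (_ <= _ + X)%E).
have [Joo|Joo] := eqVneq J +oo%E; first by rewrite Joo addey ?leey.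
have iA : gamma.-integrable setT (EFin \o A).
  apply/integrableP; split; first exact/measurable_EFinP.
  under eq_integral do rewrite /= ger0_norm//.
  by apply: le_lt_trans lsi _; rewrite ltey.
have ig : gamma.-integrable setT (EFin \o g).
  apply/integrableP; split; first exact/measurable_EFinP.
  under eq_integral do rewrite /= gtr0_norm//.
  by rewrite gm ltry.
have ic := bm_integrable gamma (bm_cst (measurableTypeR R) (m * ln m - m + 1 - m * ln m)).
have igl := bm_integrableM (bm_cst _ (ln m)) ig.
have e x : g x * ln (g x) - g x + 1 = A x + (ln m * g x + (m * ln m - m + 1 - m * ln m)).
  by rewrite /A lnM ?posrE// ?invr_gt0// lnV ?posrE//; ring.
under eq_integral do rewrite e.
have igm : \int[gamma]_x g x = m by rewrite /Rintegral gm.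
have i3 := integrable_EFinD igl ic; have i4 := integrable_EFinD iA i3.
rewrite -(EFin_Rintegral i4) RintegralD//.
rewrite RintegralD// RintegralZl// igm Rintegral_cst// [X in fine X]probability_setT mulr1.
rewrite EFinD (EFin_Rintegral iA) addeC; apply: leeD => //.
by rewrite lee_fin; lra.
Qed.

End log_sobolev_line.

(** * Cylindrical likelihood ratios *)

Section orthonormal_lists.
Variables (R : realType) (W H : completeNormedModType R).
Variables (ip : {dot H for (@idfun R)}) (i : {linear H -> W}) (j : dual W -> H).
Variables (muW : probability (borel W) R).
Hypothesis Haws : abstract_wiener_space ip i j muW.

(* The type dual W has no decidable equality, hence no boolean membership. *)
Fixpoint In_seq (T : Type) (x : T) (s : seq T) : Prop :=
  if s is y :: s' then y = x \/ In_seq x s' else False.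

Definition orth (e : dual W) (s : seq (dual W)) := forall e', In_seq e' s -> ip (j e) (j e') = 0.

Fixpoint orthonormal (s : seq (dual W)) : Prop :=
  if s is e :: s' then [/\ `|j e| = 1, orth e s' & orthonormal s'] else True.

Definition agree (s : seq (dual W)) (w w' : W) := forall e, In_seq e s -> e w = e w'.

Definition cylindrical (T : Type) (s : seq (dual W)) (f : W -> T) :=
  forall w w', agree s w w' -> f w = f w'.

(** The functional with prescribed coordinates on [s]. It serves as the orthogonal projection in
    Gram-Schmidt and in Bessel's inequality, and as the shift direction that reproduces the signals
    on [s]. *)
Lemma orthonormal_comb (s : seq (dual W)) (c : dual W -> R) : orthonormal s ->
  exists v : dual W, [/\ forall w, v w = \sum_(e <- s) c e * e w,
    forall e, In_seq e s -> e (i (j v)) = c e,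
    forall e, orth e s -> ip (j e) (j v) = 0 &
    `|j v| ^+ 2 = \sum_(e <- s) c e ^+ 2].
Proof.
elim: s => [_|e s IH /= [e1 es os]].
  have [z z0] := dual_zero W.
  have jz : j z = 0.
    have -> : j z = 0 *: j z + 0 *: j z by apply: (j_comb Haws) => w; rewrite z0; ring.
    by rewrite !scale0r addr0.
  exists z; split=> //; first by move=> w; rewrite big_nil z0.
    by move=> e _; rewrite jz -(scale0r (j e)) ipZr mul0r.
  by rewrite jz normr0 expr0n big_nil.
have [v [vE vc vo vn]] := IH os.
have [u uE] := dual_comb (c e) 1 e v.
have ju : j u = c e *: j e + j v by rewrite (j_comb Haws uE) scale1r.
have iju (e' : dual W) : e' (i (j u)) = c e * ip (j e') (j e) + e' (i (j v)).
  by rewrite -(aws_riesz Haws) ju ipDr ipZr (aws_riesz Haws e' (j v)).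
have ev : ip (j e) (j v) = 0 by exact: vo.
exists u; split.
- by move=> w; rewrite big_cons uE vE mul1r.
- move=> e' [<-|e's].
    by rewrite iju (ip_norm Haws) e1 expr1n mulr1 -(aws_riesz Haws) ev addr0.
  by rewrite iju (ipC _ (j e') (j e)) (es _ e's) mulr0 add0r vc.
- move=> e' oe'; rewrite ju ipDr ipZr (oe' e (or_introl erefl)) mulr0 add0r vo// => e'' e''s.
  by apply: oe'; right.
- rewrite -(ip_norm Haws) ju !(ipDl, ipDr, ipZl, ipZr) (ipC _ (j v) (j e)) ev.
  by rewrite !(ip_norm Haws) e1 vn big_cons; ring.
Qed.

(* By Gram-Schmidt. *)
Lemma orthonormal_span (L : seq (dual W)) : exists s, orthonormal s /\
  forall e, In_seq e L -> forall w w', agree s w w' -> e w = e w'.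
Proof.
elim: L => [|e L [s [os sL]]]; first by exists [::].
have [v [vE vc vo vn]] := orthonormal_comb (fun e' => ip (j e) (j e')) os.
have [p pE] := dual_comb 1 (-1) e v.
have ew w : e w = p w + v w by rewrite pE; ring.
have vag w w' : agree s w w' -> v w = v w'.
  move=> ag; rewrite !vE; elim: {vE vc vo vn sL os} s ag => [|a s IH] ag; first by rewrite !big_nil.
  rewrite !big_cons (ag a (or_introl erefl)) IH// => e' e's.
  by apply: ag; right.
have [jp|jp] := eqVneq (j p) 0.
  exists s; split=> // e' [<-|e'L] w w' ag; last exact: sL.
  by rewrite !ew !(dual_eq0 Haws jp) (vag _ _ ag).
have [q [q1 pq]] := dual_normalize Haws jp.
have jq (h : H) : ip (j p) h = `|j p| * ip (j q) h.
  by rewrite !(aws_riesz Haws) pq.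
exists (q :: s); split.
  split=> // e' e's.
  have : ip (j p) (j e') = 0.
    rewrite (j_comb Haws pE) scale1r ipDl ipZl (ipC _ (j v)) mulN1r.
    by rewrite (aws_riesz Haws e' (j v)) vc// subrr.
  by rewrite jq => /eqP; rewrite mulf_eq0 normr_eq0 (negbTE jp) /= => /eqP.
move=> e' [<-|e'L] w w' ag; last first.
  by apply: sL => // a as'; apply: ag; right.
rewrite !ew !pq (ag q (or_introl erefl)) (vag w w')// => a as'.
by apply: ag; right.
Qed.

Lemma bessel (s : seq (dual W)) (h : H) : orthonormal s ->
  \sum_(e <- s) ip h (j e) ^+ 2 <= `|h| ^+ 2.
Proof.
move=> os; have [v [vE vc vo vn]] := orthonormal_comb (fun e => ip h (j e)) os.
have hv : ip h (j v) = \sum_(e <- s) ip h (j e) ^+ 2.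
  rewrite ipC -(@ipC _ _ ip) ipC (aws_riesz Haws v h) vE.
  by apply: eq_bigr => e _; rewrite -(aws_riesz Haws) (ipC _ (j e)) expr2.
have := sqr_ge0 `|h - j v|; rewrite -(ip_norm Haws) !(ipDl, ipDr, ipNl, ipNr).
rewrite (ipC _ (j v) h) hv !(ip_norm Haws) vn; lra.
Qed.

End orthonormal_lists.

Lemma Rintegral_gt0 d (T : measurableType d) (R : realType) (P : probability T R) (f : T -> R) :
  P.-integrable setT (EFin \o f) -> (forall x, 0 < f x) -> 0 < \int[P]_x f x.
Proof.
move=> jf f0; rewrite lt_neqAle Rintegral_ge0 ?andbT; last by move=> x _; exact: ltW.
apply/eqP => h0.
have mf : measurable_fun setT (EFin \o f) := measurable_int _ jf.
have : (\int[P]_x `|(EFin \o f) x| = 0)%E.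
  under eq_integral do rewrite /= gtr0_norm//.
  by rewrite -(EFin_Rintegral jf) -h0.
move/(ae_eq_integral_abs P measurableT mf) => [N [mN PN0 sub]].
have NT : N = setT.
  apply/seteqP; split=> // x _; apply: sub => /= /(_ I) [] fx0.
  by have := f0 x; rewrite fx0 ltxx.
have := probability_setT P; rewrite -NT PN0 => /eqP.
by rewrite eqe eq_sym oner_eq0.
Qed.

(** * Gaussian mixtures on the line *)

Section mixture.
Context d (X : measurableType d) (R : realType) (nu : probability X R).
Variables (u k : X -> R).
Hypotheses (mu_ : measurable_fun setT u) (bk : bounded_measurable k) (k_gt0 : forall x, 0 < k x).
Notation gamma := (normal_prob (0 : R) 1).

(* The derivatives of g(r) = int exp(r u - u^2/2) k dnu. *)
Definition mixture (n : nat) (r : R) :=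
  \int[nu]_x (u x ^+ n * expR (r * u x - u x ^+ 2 / 2) * k x).

(** From [|v|^n <= expR (n |v|)] and completion of the square in [(n + K) |v| - v^2 / 2]. The bound
    is uniform in [v], so mixtures can be differentiated under the integral whatever the law of
    [u]. *)
Lemma gaussian_factor_le (n : nat) (r K v : R) : `|r| <= K ->
  `|v ^+ n * expR (r * v - v ^+ 2 / 2)| <= expR ((n%:R + K) ^+ 2 / 2).
Proof.
move=> rK; rewrite normrM normrX (ger0_norm (expR_ge0 _)).
have h1 : `|v| ^+ n <= expR (n%:R * `|v|).
  rewrite -[n%:R * _]mulrC expRM_natr; apply: lerXn2r; rewrite ?nnegrE ?expR_ge0//.
  by apply: le_trans (expR_ge1Dx _); rewrite lerDr.
apply: (@le_trans _ _ (expR (n%:R * `|v|) * expR (K * `|v| - `|v| ^+ 2 / 2))).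
  apply: ler_pM; rewrite ?exprn_ge0 ?expR_ge0// ler_expR real_normK ?num_real// lerD2r.
  by apply: le_trans (ler_norm _) _; rewrite normrM ler_wpM2r.
rewrite -expRD ler_expR.
have := sqr_ge0 (`|v| - (n%:R + K)); lra.
Qed.

Let mfac n r : measurable_fun setT (fun x => u x ^+ n * expR (r * u x - u x ^+ 2 / 2)).
Proof.
apply: measurable_funM; first exact: measurable_funX.
apply: measurableT_comp => //; apply: measurable_funB; first exact: measurable_funM.
by apply: measurable_funM => //; exact: measurable_funX.
Qed.

Lemma bm_mixture n r : bounded_measurable (fun x => u x ^+ n * expR (r * u x - u x ^+ 2 / 2) * k x).
Proof.
apply: bmM => //; split; first exact: mfac.
by exists (expR ((n%:R + `|r|) ^+ 2 / 2)) => x; exact: gaussian_factor_le.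
Qed.

Lemma is_derive_mixture n r : is_derive r (1 : R) (mixture n) (mixture n.+1 r).
Proof.
have [_ [M kM]] := bk.
have M0 : 0 <= M := le_trans (normr_ge0 _) (kM point).
have df v c (r' : R) : is_derive r' (1 : R) (fun r => v ^+ n * expR (r * v - v ^+ 2 / 2) * c)
    (v ^+ n.+1 * expR (r' * v - v ^+ 2 / 2) * c).
  have h : is_derive r' (1 : R) (fun r => r * v - v ^+ 2 / 2) v.
    by apply: is_derive_eq; rewrite /= /GRing.scale /=; ring.
  have h2 := @is_derive1_comp _ expR (fun r => r * v - v ^+ 2 / 2) r' _ _ (is_derive_expR _) h.
  have h3 := is_deriveZ (v ^+ n * c) h2.
  have -> : (fun r => v ^+ n * expR (r * v - v ^+ 2 / 2) * c) =
      v ^+ n * c *: (expR \o (fun r => r * v - v ^+ 2 / 2)).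
    by apply/funext => z /=; rewrite mulrAC.
  by apply: (is_derive_eq h3); rewrite /GRing.scale /= (exprS v n); ring.
apply: (@is_derive_integral _ X R nu
  (fun r x => u x ^+ n * expR (r * u x - u x ^+ 2 / 2) * k x)
  (fun r x => u x ^+ n.+1 * expR (r * u x - u x ^+ 2 / 2) * k x) r
  (fun x => expR ((n.+1%:R + (`|r| + 1)) ^+ 2 / 2) * M) (fun r' x => df (u x) (k x) r')).
- by move=> r' _; apply: bm_integrable; exact: bm_mixture.
- move=> r' x rr'; rewrite normrM ler_pM//; apply: gaussian_factor_le.
  by rewrite -[r'](subrK r) addrC; apply: le_trans (ler_normD _ _) _; rewrite lerD2l ltW.
- by apply: bm_integrable; exact: bm_cst.
Qed.

Lemma mixture0_gt0 r : 0 < mixture 0 r.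
Proof.
apply: Rintegral_gt0; first by apply: bm_integrable; exact: bm_mixture.
by move=> x; rewrite expr0 mul1r mulr_gt0// expR_gt0.
Qed.

(** By Tonelli: each factor [expR (r * u - u^2 / 2)] has Gaussian mean 1 in [r]. *)
Lemma mixture0_mean : (\int[gamma]_r (mixture 0 r)%:E = (\int[nu]_x k x)%R%:E)%E.
Proof.
pose G : probability (measurableTypeR R) R := gamma.
pose f (z : X * measurableTypeR R) := expR (z.2 * u z.1 - u z.1 ^+ 2 / 2) * k z.1.
have mf : measurable_fun setT f.
  have m1 : measurable_fun [set: X * measurableTypeR R] (fun z => u z.1) by exact: measurableT_comp.
  apply: measurable_funM; last by apply: (measurableT_comp bk.1); exact: measurable_fst.
  apply: measurableT_comp => //; apply: measurable_funB.
    by apply: measurable_funM => //; exact: measurable_snd.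
  by apply: measurable_funM => //; exact: measurable_funX.
have f0 z : 0 <= f z by rewrite mulr_ge0 ?expR_ge0// ltW.
transitivity (\int[gamma]_r \int[nu]_x (f (x, r))%:E)%E.
  apply: eq_integral => r _; rewrite EFin_Rintegral; last by apply: bm_integrable; exact: bm_mixture.
  by apply: eq_integral => x _; rewrite /f expr0 mul1r.
rewrite -(prod_prob_ge0_sym nu G mf f0) (prod_prob_ge0 nu G mf f0).
rewrite (EFin_Rintegral (bm_integrable nu bk)); apply: eq_integral => x _.
rewrite /f /=.
transitivity ((expR (- (u x ^+ 2 / 2)) * k x)%:E * \int[gamma]_r (expR (u x * r))%:E)%E.
  rewrite -ge0_integralZl_real.
  - apply: eq_integral => r _; congr EFin.
    by rewrite [RHS]mulrAC -expRD; congr (expR _ * _); ring.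
  - by rewrite mulr_ge0 ?expR_ge0// ltW.
  - by move=> r; exact: expR_ge0.
  - by apply: measurableT_comp => //; exact: measurable_funM.
by rewrite gamma_expR -EFinM mulrAC -expRD addrC subrr expR0 mul1r.
Qed.

Lemma mixture_entropy :
  (\int[gamma]_r (mixture 0 r * ln (mixture 0 r) - mixture 0 r + 1)%:E <=
   ((\int[nu]_x k x) * ln (\int[nu]_x k x) - (\int[nu]_x k x) + 1)%R%:E +
   \int[gamma]_r (mixture 1 r ^+ 2 / (2 * mixture 0 r))%:E)%E.
Proof.
apply: log_sobolev_line_entropy.
- by apply: Rintegral_gt0 => //; exact: bm_integrable.
- exact: mixture0_gt0.
- exact: is_derive_mixture.
- exact: (is_derive_continuous (is_derive_mixture 1)).
- exact: mixture0_mean.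
Qed.

End mixture.

Lemma measurable_Rintegral_param d1 d2 (X : measurableType d1) (T : measurableType d2)
    (R : realType) (P : probability X R) (m : probability T R) (f : X * T -> R) :
  measurable_fun setT f ->
  measurable_fun setT (fun w => \int[P]_x f (x, w)).
Proof.
move=> mf.
have mp : measurable_fun setT (fun w => \int[P]_x ((EFin \o f)^\+ (x, w)))%E.
  by apply: measurable_fun_fubini_tonelli_G => //; apply: measurable_funepos; exact/measurable_EFinP.
have mn : measurable_fun setT (fun w => \int[P]_x ((EFin \o f)^\- (x, w)))%E.
  by apply: measurable_fun_fubini_tonelli_G => //; apply: measurable_funeneg; exact/measurable_EFinP.
have h : measurable_fun setT (fun w => \int[P]_x (f (x, w))%:E)%E.
  rewrite (_ : (fun w => _) = (fun w => \int[P]_x ((EFin \o f)^\+ (x, w)) -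
      \int[P]_x ((EFin \o f)^\- (x, w)))%E); first exact: emeasurable_funB.
  by apply/funext => w; rewrite [LHS]integralE; congr (_ - _)%E; apply: eq_integral => x _; rewrite ?funeposE ?funenegE.
by apply: (measurableT_comp _ h); exact: fine_measurable.
Qed.

Lemma measurable_inv_gt0 d (T : measurableType d) (R : realType) (f : T -> R) :
  measurable_fun setT f -> (forall x, 0 < f x) -> measurable_fun setT (fun x => (f x)^-1).
Proof.
move=> mf f0; rewrite (_ : (fun x => _) = (fun x => expR (- ln (f x)))).
  by apply: measurableT_comp => //; apply: measurable_funN; exact: measurableT_comp.
by apply/funext => x; rewrite expRN lnK ?posrE.
Qed.

Section dual_lin.
Variables (R : realType) (W H : completeNormedModType R).
Variables (ip : {dot H for (@idfun R)}) (i : {linear H -> W}) (j : dual W -> H).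
Variables (muW : probability (borel W) R).
Hypothesis Haws : abstract_wiener_space ip i j muW.

Lemma continuous_ip (h : H) : continuous (fun x => ip x h : R).
Proof.
have [||e eE] := @dual_of_fun _ H (fun x => ip x h) `|h|.
- by move=> a x y; rewrite ipDl ipZl.
- by move=> x; rewrite mulrC; exact: (ip_cauchy Haws).
rewrite (_ : (fun x => _) = e); first exact: dual_continuous.
by apply/funext => x; rewrite eE.
Qed.

Lemma measurable_ip (h : H) : measurable_fun [set: borel H] (fun x : borel H => ip (x : H) h : R).
Proof. exact: (@continuous_borel_measurable R H (fun x : H => ip x h) (continuous_ip (h := h))). Qed.

End dual_lin.

(** * The channel seen through finitely many functionals *)

Section channel.
Variables (R : realType) (W H : completeNormedModType R).
Variables (ip : {dot H for (@idfun R)}) (i : {linear H -> W}) (j : dual W -> H).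
Variables (muW : probability (borel W) R) (muX : probability (borel H) R) (rho : R).
Hypothesis Haws : abstract_wiener_space ip i j muW.
Implicit Types (e : dual W) (s : seq (dual W)) (x : borel H) (w : borel W).

Notation Q := (prod_prob muX muW).

Definition channel (z : borel H * borel W) : borel W := rho *: i (z.1 : H) + (z.2 : W).

Definition signal e x : R := rho * ip (x : H) (j e).

Lemma measurable_signal e : measurable_fun setT (signal e).
Proof. by apply: measurable_funM => //; exact: (measurable_ip Haws). Qed.

Lemma dual_channel e (z : borel H * borel W) :
  e (channel z) = signal e z.1 + e (z.2 : W).
Proof. by rewrite /channel linearD linearZ /= /signal (ipC ip z.1) (aws_riesz Haws). Qed.

Lemma measurable_channel : measurable_fun setT channel.
Proof.
apply: measurable_fun_borel; first exact: (aws_separable Haws).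
move=> e; under eq_fun do rewrite dual_channel.
apply: measurable_funD.
  by apply: (measurableT_comp (measurable_signal e)); exact: measurable_fst.
by apply: (measurableT_comp (measurable_dual e)); exact: measurable_snd.
Qed.

(** For orthonormal [s] and a fixed input [x], the density of the projection of [rho x + w] on [s]
    with respect to that of [w]. *)
Definition kernel s x w : R := expR (\sum_(e <- s) (e (w : W) * signal e x - signal e x ^+ 2 / 2)).

Lemma kernel_cons e s x w :
  kernel (e :: s) x w = expR (e (w : W) * signal e x - signal e x ^+ 2 / 2) * kernel s x w.
Proof. by rewrite /kernel big_cons expRD. Qed.

Lemma kernel_gt0 s x w : 0 < kernel s x w. Proof. exact: expR_gt0. Qed.

Lemma measurable_kernel s : measurable_fun setT (fun z : borel H * borel W => kernel s z.1 z.2).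
Proof.
elim: s => [|e s IH].
  by rewrite /kernel; under eq_fun do rewrite big_nil; exact: measurable_cst.
under eq_fun do rewrite kernel_cons.
apply: measurable_funM => //; apply: measurableT_comp => //.
have m1 : measurable_fun setT (fun z : borel H * borel W => signal e z.1).
  by apply: (measurableT_comp (measurable_signal e)); exact: measurable_fst.
have m2 : measurable_fun setT (fun z : borel H * borel W => e (z.2 : W)).
  by apply: (measurableT_comp (measurable_dual e)); exact: measurable_snd.
apply: measurable_funB; first exact: measurable_funM.
by apply: measurable_funM => //; exact: measurable_funX.
Qed.

Lemma bm_kernel s w : bounded_measurable (fun x => kernel s x w).
Proof.
split.
  apply: (measurableT_comp (measurable_kernel s) (g := fun x => (x, w))).
  exact: measurable_fun_pair.
elim: s => [|e s [M hM]].
  by exists 1 => x; rewrite /kernel big_nil expR0 normr1.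
exists (expR ((0%:R + `|e (w : W)|) ^+ 2 / 2) * M) => x.
rewrite kernel_cons normrM ler_pM//.
by have := @gaussian_factor_le R 0 (e (w : W)) _ (signal e x) (lexx _); rewrite expr0 mul1r.
Qed.

Definition lik s w : R := \int[muX]_x kernel s x w.

(** The derivative of [lik (e :: s)] in the coordinate [e], taken under the integral. *)
Definition dlik e s w : R := \int[muX]_x (signal e x * kernel (e :: s) x w).

Lemma lik_mixture e s w : lik (e :: s) w = mixture muX (signal e) (fun x => kernel s x w) 0 (e (w : W)).
Proof. by apply: eq_Rintegral => x _; rewrite kernel_cons expr0 mul1r. Qed.

Lemma dlik_mixture e s w : dlik e s w = mixture muX (signal e) (fun x => kernel s x w) 1 (e (w : W)).
Proof. by apply: eq_Rintegral => x _; rewrite kernel_cons expr1 mulrA. Qed.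

Lemma lik_gt0 s w : 0 < lik s w.
Proof.
by apply: Rintegral_gt0 => [|x]; [exact: (bm_integrable muX (bm_kernel s w))|exact: kernel_gt0].
Qed.

Lemma measurable_lik s : measurable_fun setT (lik s).
Proof. exact: (measurable_Rintegral_param muX muW (measurable_kernel s)). Qed.

Lemma measurable_dlik e s : measurable_fun setT (dlik e s).
Proof.
apply: (measurable_Rintegral_param muX muW (f := fun z => signal e z.1 * kernel (e :: s) z.1 z.2)).
apply: measurable_funM; last exact: measurable_kernel.
by apply: (measurableT_comp (measurable_signal e)); exact: measurable_fst.
Qed.

Lemma kernel_agree s x (w w' : W) : agree s w w' -> kernel s x w = kernel s x w'.
Proof.
rewrite /kernel => ag; congr expR.
elim: s ag => [|e s IH] ag; first by rewrite !big_nil.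
rewrite !big_cons (ag e (or_introl erefl)) IH// => e' e's.
by apply: ag; right.
Qed.

Lemma lik_cylindrical s : cylindrical s (lik s).
Proof. by move=> w w' ag; apply: eq_Rintegral => x _; exact: kernel_agree. Qed.

Lemma dlik_cylindrical e s : cylindrical (e :: s) (dlik e s).
Proof. by move=> w w' ag; apply: eq_Rintegral => x _; rewrite (kernel_agree _ ag). Qed.

Lemma split_agree e s (r : R) w : orth ip j e s -> agree s (split_direction i j e (r, w)) w.
Proof.
move=> oes e' e's; rewrite dual_split.
by rewrite -(aws_riesz Haws) (ipC ip (j e') (j e)) oes// !mulr0 subr0 add0r.
Qed.

Lemma split_self e (r : R) w : `|j e| = 1 -> e (split_direction i j e (r, w)) = r.
Proof.
move=> e1; rewrite dual_split -(aws_riesz Haws) (ip_norm Haws) e1 expr1n; ring.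
Qed.

Definition Psi (t : R) := t * ln t - t + 1.

Lemma Psi_ge0 t : 0 < t -> 0 <= Psi t.
Proof.
by move=> /mulr_ln_ge; rewrite /Psi; lra.
Qed.

Lemma measurable_Psi : measurable_fun [set: R] Psi.
Proof.
apply: measurable_funD => //; apply: measurable_funB => //.
by apply: measurable_funM => //; exact: measurable_ln.
Qed.

(** Along a line in direction [e] orthogonality keeps [kernel s] constant. There [lik (e :: s)] is a
    one-dimensional mixture with Gaussian mean [lik s w], so [mixture_entropy] applies on each line
    and integrates to the claim. *)
Lemma entropy_chain e s : `|j e| = 1 -> orth ip j e s ->
  (\int[muW]_w (Psi (lik (e :: s) w))%:E <=
   \int[muW]_w (Psi (lik s w))%:E +
   \int[muW]_w (dlik e s w ^+ 2 / (2 * lik (e :: s) w))%:E)%E.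
Proof.
move=> e1 oes.
have mP t : measurable_fun setT (fun w => Psi (lik t w)).
  by apply: (measurableT_comp measurable_Psi); exact: measurable_lik.
have mD : measurable_fun setT (fun w => dlik e s w ^+ 2 / (2 * lik (e :: s) w)).
  apply: measurable_funM; first by apply: measurable_funX; exact: measurable_dlik.
  apply: measurable_inv_gt0 => [|w]; last by rewrite mulr_gt0 ?lik_gt0.
  by apply: measurable_funM => //; exact: measurable_lik.
have D0 w : 0 <= dlik e s w ^+ 2 / (2 * lik (e :: s) w).
  by rewrite mulr_ge0 ?sqr_ge0// invr_ge0 mulr_ge0// ltW// lik_gt0.
have P0 t w : 0 <= Psi (lik t w) by exact: Psi_ge0 (lik_gt0 _ _).
have lE w r : lik (e :: s) (split_direction i j e (r, w)) =
    mixture muX (signal e) (fun x => kernel s x w) 0 r.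
  rewrite lik_mixture (split_self r w e1); apply: eq_Rintegral => x _.
  by rewrite (kernel_agree x (split_agree r w oes)).
have dE w r : dlik e s (split_direction i j e (r, w)) =
    mixture muX (signal e) (fun x => kernel s x w) 1 r.
  rewrite dlik_mixture (split_self r w e1); apply: eq_Rintegral => x _.
  by rewrite (kernel_agree x (split_agree r w oes)).
rewrite (disintegration Haws e1 (mP _) (P0 _)) (disintegration Haws e1 mD D0).
have mSplit (F : borel W -> R) : measurable_fun setT F -> (forall w, 0 <= F w) ->
    measurable_fun setT (fun w => \int[normal_prob (0 : R) 1]_r (F (split_direction i j e (r, w)))%:E)%E.
  move=> mF F0.
  have h : measurable_fun setT (fun z : measurableTypeR R * borel W => (F (split_direction i j e z))%:E).
    apply/measurable_EFinP; apply: (measurableT_comp mF); exact: (measurable_split Haws).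
  by apply: (measurable_fun_fubini_tonelli_G (m1 := normal_prob (0 : R) 1) _ h) => z; rewrite lee_fin.
rewrite -ge0_integralD//; last 4 first.
- by move=> w _; rewrite lee_fin.
- exact/measurable_EFinP.
- by move=> w _; apply: integral_ge0 => r _; rewrite lee_fin.
- exact: (mSplit _ mD D0).
apply: ge0_le_integral => //.
- by move=> w _; apply: integral_ge0 => r _; rewrite lee_fin.
- exact: (mSplit _ (mP _) (P0 _)).
- by apply: emeasurable_funD; [exact/measurable_EFinP|exact: (mSplit _ mD D0)].
move=> w _.
have := @mixture_entropy _ _ R muX (signal e) (fun x => kernel s x w) (measurable_signal e)
  (bm_kernel s w) (fun x => kernel_gt0 s x w).
under eq_integral do rewrite -lE -/(Psi _).
by under [in X in (_ <= _ + X)%E]eq_integral do rewrite -lE -dE.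
Qed.

End channel.

Lemma integral_prob_cst d (T : measurableType d) (R : realType) (P : probability T R) (c : R) :
  (\int[P]_x c%:E = c%:E)%E.
Proof. by rewrite integral_cst// [X in (_ * X)%E](probability_setT P) mule1. Qed.

Lemma integrable_fst d1 d2 (T1 : measurableType d1) (T2 : measurableType d2) (R : realType)
    (P1 : probability T1 R) (P2 : probability T2 R) (g : T1 -> R) :
  P1.-integrable setT (EFin \o g) ->
  (prod_prob P1 P2).-integrable setT (EFin \o (fun z : T1 * T2 => g z.1)).
Proof.
move=> ig; have mg := integrable_measurable ig.
have m1 : measurable_fun setT (fun z : T1 * T2 => g z.1).
  by apply: (measurableT_comp mg); exact: measurable_fst.
have mag : measurable_fun setT (fun z : T1 * T2 => `|g z.1|) by exact: measurableT_comp.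
apply/integrableP; split; first exact/measurable_EFinP.
rewrite /= (prod_prob_ge0 P1 P2 mag)//=.
have /integrableP[_] := ig; apply: le_lt_trans; rewrite le_eqVlt; apply/orP; left; apply/eqP.
by apply: eq_integral => x _; rewrite (integral_prob_cst P2).
Qed.

Section cylindrical_transfer.
Variables (R : realType) (W H : completeNormedModType R).
Variables (ip : {dot H for (@idfun R)}) (i : {linear H -> W}) (j : dual W -> H).
Variables (muW : probability (borel W) R) (muX : probability (borel H) R) (rho : R).
Hypothesis Haws : abstract_wiener_space ip i j muW.
Implicit Types (e : dual W) (s : seq (dual W)) (x : borel H) (w : borel W) (f : borel W -> R).

Notation Q := (prod_prob muX muW).
Notation Y := (channel i rho).
Notation signal := (signal ip j rho).
Notation kernel := (kernel ip j rho).
Notation lik := (lik ip j muX rho).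
Notation dlik := (dlik ip j muX rho).
Notation orthonormal := (orthonormal ip j).

Lemma cameron_martin_bm (v : dual W) f : bounded_measurable f ->
  \int[muW]_w f ((w : W) + i (j v)) = \int[muW]_w (f w * expR (v (w : W) - `|j v| ^+ 2 / 2)).
Proof.
pose sh w : borel W := (w : W) + i (j v).
have msh : measurable_fun setT sh := measurable_shift Haws (i (j v)).
have mD : measurable_fun setT (fun w : borel W => expR (v (w : W) - `|j v| ^+ 2 / 2)).
  by apply: measurableT_comp => //; apply: measurable_funB => //; exact: measurable_dual.
have iD : muW.-integrable setT (EFin \o (fun w => expR (v (w : W) - `|j v| ^+ 2 / 2))).
  apply: ge0_integrable => //.
  have := cameron_martin Haws v (measurable_cst (1 : R)) (fun=> ler01).
  under [X in _ = X -> _]eq_integral do rewrite mul1r.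
  by move=> <-; rewrite [X in (X < _)%E](integral_prob_cst muW 1) ltry.
have h (A : set (borel W)) : measurable A -> (\int[muW]_(w in sh @^-1` A) (1%R)%:E =
    \int[muW]_(w in A) (expR (v (w : W) - `|j v| ^+ 2 / 2))%:E)%E.
  move=> mA; rewrite -(integral_indicM muW _ mA).
  rewrite -(cameron_martin Haws v (F := \1_A)); last 2 first.
  - exact: measurable_indic.
  - by move=> w; rewrite indicE ler0n.
  rewrite -(integral_indicM muW (fun=> 1) (measurable_preimage msh mA)).
  by apply: eq_integral => w _; rewrite mulr1.
move=> bf; have := bm_transfer msh (bm_integrable muW (bm_cst _ 1)) iD h bf.
by under eq_Rintegral do rewrite mulr1.
Qed.

(** The function sees the input only through its signals on [s], so [rho *: i x] may be replaced by
    [i (j v)] for the functional [v] having these signals as coordinates, and Cameron-Martin applies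
    to [v]. *)
Lemma cylindrical_section s x f : orthonormal s -> bounded_measurable f -> cylindrical s f ->
  \int[muW]_w f (Y (x, w)) = \int[muW]_w (f w * kernel s x w).
Proof.
move=> os bf cf.
have [v [vE vc _ vn]] := orthonormal_comb Haws (fun e => signal e x) os.
transitivity (\int[muW]_w f ((w : W) + i (j v))).
  apply: eq_Rintegral => w _; apply: cf => e es.
  by rewrite (dual_channel rho Haws) linearD (vc e es) addrC.
rewrite (cameron_martin_bm v bf); apply: eq_Rintegral => w _; congr (_ * expR _).
rewrite vE vn mulr_suml -sumrB; apply: eq_bigr => e _.
by rewrite mulrC.
Qed.

Lemma integral_kernel s x : orthonormal s -> (\int[muW]_w (kernel s x w)%:E = 1)%E.
Proof.
move=> os; have [v [vE vc _ vn]] := orthonormal_comb Haws (fun e => signal e x) os.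
have := cameron_martin Haws v (measurable_cst (1 : R)) (fun=> ler01).
rewrite [X in X = _ -> _](integral_prob_cst muW 1) => ->.
apply: eq_integral => w _; rewrite mul1r; congr (expR _)%:E.
rewrite vE vn mulr_suml -sumrB; apply: eq_bigr => e _.
by rewrite mulrC.
Qed.

Section weighted.
Variables (s : seq (dual W)) (g : borel H -> R).
Hypotheses (os : orthonormal s) (ig : muX.-integrable setT (EFin \o g)).

Let mg : measurable_fun setT g := integrable_measurable ig.

Lemma integrable_weighted f : bounded_measurable f ->
  Q.-integrable setT (EFin \o (fun z : borel H * borel W => f z.2 * (g z.1 * kernel s z.1 z.2))).
Proof.
move=> [mf [M fM]].
have M0 : 0 <= M := le_trans (normr_ge0 _) (fM point).
have m2 : measurable_fun setT (fun z : borel H * borel W => f z.2).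
  by apply: (measurableT_comp mf); exact: measurable_snd.
have m1 : measurable_fun setT (fun z : borel H * borel W => g z.1).
  by apply: (measurableT_comp mg); exact: measurable_fst.
have mk := measurable_kernel (ip := ip) (i := i) (j := j) (muW := muW) rho Haws s.
have ik : Q.-integrable setT (EFin \o (fun z : borel H * borel W => `|g z.1| * kernel s z.1 z.2)).
  have mgk : measurable_fun setT (fun z : borel H * borel W => `|g z.1| * kernel s z.1 z.2).
    by apply: measurable_funM => //; exact: measurableT_comp.
  have gk0 z : 0 <= `|g z.1| * kernel s z.1 z.2 by rewrite mulr_ge0// ltW// kernel_gt0.
  apply: ge0_integrable => //; rewrite (prod_prob_ge0 muX muW mgk gk0).
  have /integrableP[_] := ig; apply: le_lt_trans; rewrite le_eqVlt; apply/orP; left; apply/eqP.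
  apply: eq_integral => x _ /=.
  rewrite ge0_integralZl_real//.
  - by rewrite integral_kernel// mule1.
  - by move=> w; rewrite ltW// kernel_gt0.
  - by apply: (measurableT_comp mk (g := fun w => (x, w))); exact: measurable_fun_pair.
apply: integrable_real_le (integrable_EFinZ M ik).
- by apply: measurable_funM => //; exact: measurable_funM.
- move=> z; rewrite !normrM (gtr0_norm (kernel_gt0 _ _ _ _ _ _)).
  by rewrite ler_wpM2r// mulr_ge0// ltW// kernel_gt0.
Qed.

Lemma integrable_lik_weighted : muW.-integrable setT (EFin \o (fun w => \int[muX]_x (g x * kernel s x w))).
Proof.
have iw := integrable_weighted (bm_cst _ 1).
have mw := measurable_Rintegral_param muX muW (integrable_measurable iw).
have h : (\int[muW]_w \int[muX]_x `|1 * (g x * kernel s x w)|%:E < +oo)%E.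
  exact: (integrable21ltyP muX muW (measurable_int _ iw)).1 iw.
apply/integrableP; split.
  apply/measurable_EFinP; apply: eq_measurable_fun mw => w _.
  by apply: eq_Rintegral => x _; rewrite mul1r.
apply: le_lt_trans h; apply: ge0_le_integral => //.
- do 2 apply: measurableT_comp => //; apply: eq_measurable_fun mw => w _.
  by apply: eq_Rintegral => x _; rewrite mul1r.
- apply: (measurable_fun_fubini_tonelli_G (m1 := muX) (fun z => `|1 * (g z.1 * kernel s z.1 z.2)|%:E)) => //.
  by apply/measurable_EFinP; apply: measurableT_comp => //; exact: (integrable_measurable iw).
- move=> w _ /=.
  have mgk : measurable_fun setT (fun x => g x * kernel s x w).
    by apply: measurable_funM => //; case: (bm_kernel (ip := ip) (i := i) (j := j) (muW := muW) rho Haws s w).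
  have igk : muX.-integrable setT (EFin \o (fun x => g x * kernel s x w)).
    have := bm_integrableM (bm_kernel rho Haws s w) ig.
    by under eq_fun do rewrite mulrC.
  apply: (@le_trans _ _ (\int[muX]_x `|g x * kernel s x w|)%:E).
    by rewrite lee_fin; exact: le_normr_Rintegral.
  rewrite (EFin_Rintegral (integrable_norm igk)) le_eqVlt; apply/orP; left; apply/eqP.
  by apply: eq_integral => x _; rewrite mul1r.
Qed.

(** Taken with [g = 1] it makes [lik s] the conditional expectation of [l]; taken with
    [g = signal e] on the list [e :: s] it plays the same role for [dlik e s] and the score. *)
Lemma cylindrical_transfer f : bounded_measurable f -> cylindrical s f ->
  \int[Q]_z (f (Y z) * g z.1) = \int[muW]_w (f w * \int[muX]_x (g x * kernel s x w)).
Proof.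
move=> bf cf; have [mf [M fM]] := bf.
have M0 : 0 <= M := le_trans (normr_ge0 _) (fM point).
have mY := measurable_channel (ip := ip) (i := i) (j := j) (muW := muW) rho Haws.
have iw := integrable_weighted bf.
have iY : Q.-integrable setT (EFin \o (fun z : borel H * borel W => f (Y z) * g z.1)).
  have bfY : bounded_measurable (fun z => f (Y z)).
    by split; [exact: measurableT_comp|exists M].
  exact: bm_integrableM bfY (integrable_fst muW ig).
have bk x : muW.-integrable setT (EFin \o (fun w => f w * kernel s x w)).
  apply: (bm_integrableM bf); apply: ge0_integrable.
  - have mk := measurable_kernel (ip := ip) (i := i) (j := j) (muW := muW) rho Haws s.
    by apply: (measurableT_comp mk (g := fun w => (x, w))); exact: measurable_fun_pair.
  - by move=> w; rewrite ltW// kernel_gt0.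
  - by rewrite integral_kernel// ltry.
transitivity (\int[Q]_z (f z.2 * (g z.1 * kernel s z.1 z.2))).
  apply: EFin_inj; rewrite (EFin_Rintegral iY) (EFin_Rintegral iw).
  rewrite -(integral12_prod_meas1 iY) -(integral12_prod_meas1 iw).
  apply: eq_integral => x _; rewrite /fubini_F /=.
  have bfx : bounded_measurable (fun w => f (Y (x, w))).
    split; last by exists M.
    by apply: (measurableT_comp mf); apply: (measurableT_comp mY); exact: measurable_fun_pair.
  have i1 := bm_integrable muW bfx.
  transitivity ((g x * \int[muW]_w f (Y (x, w)))%:E).
    rewrite EFinM (EFin_Rintegral i1) -integralZl//.
    by apply: eq_integral => w _; rewrite mulrC EFinM.
  rewrite (cylindrical_section x os bf cf) EFinM (EFin_Rintegral (bk x)) -integralZl//; last exact: bk.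
  by apply: eq_integral => w _; rewrite -EFinM mulrCA.
apply: EFin_inj.
rewrite (EFin_Rintegral iw).
rewrite (EFin_Rintegral (bm_integrableM bf integrable_lik_weighted)).
rewrite -(integral21_prod_meas1 iw); apply: eq_integral => w _; rewrite /fubini_G /=.
have igk : muX.-integrable setT (EFin \o (fun x => g x * kernel s x w)).
  have := bm_integrableM (bm_kernel rho Haws s w) ig.
  by under eq_fun do rewrite mulrC.
rewrite EFinM (EFin_Rintegral igk) -integralZl//.
Qed.

End weighted.

End cylindrical_transfer.

(** * From cylindrical functions to the likelihood ratio *)

Section cylindrical_approximation.
Variables (R : realType) (W H : completeNormedModType R).
Variables (muW : probability (borel W) R) (om : borel W -> R).
Hypothesis sepW : exists2 D : set W, countable D & dense D.
Hypotheses (om0 : forall w, 0 <= om w) (iom : muW.-integrable setT (EFin \o om)).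
Implicit Types (f g h : borel W -> R) (s : seq (dual W)).

Let L1 f := \int[muW]_w (`|f w| * om w).

(** The weight will be [1 + l], so that one approximation controls integrals against [muW] and
    against [l muW] together. *)
Definition approximable f := forall eps : R, 0 < eps -> exists s g,
  [/\ bounded_measurable g, cylindrical s g & \int[muW]_w (`|f w - g w| * om w) <= eps].

Let bm_norm f : bounded_measurable f -> bounded_measurable (fun w => `|f w|).
Proof.
by move=> [mf [M fM]]; split; [exact: measurableT_comp|exists M => w; rewrite normr_id].
Qed.

Let iL1 f : bounded_measurable f -> muW.-integrable setT (EFin \o (fun w => `|f w| * om w)).
Proof. by move=> bf; exact: bm_integrableM (bm_norm bf) iom. Qed.

Let L1D f g h : bounded_measurable f -> bounded_measurable g -> bounded_measurable h ->
  (forall w, `|f w| <= `|g w| + `|h w|) -> L1 f <= L1 g + L1 h.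
Proof.
move=> bf bg bh fgh; rewrite /L1 -RintegralD//; [|exact: iL1|exact: iL1].
apply: le_Rintegral => // [||w _]; first exact: iL1.
- exact: integrable_EFinD (iL1 bg) (iL1 bh).
- by rewrite -mulrDl ler_wpM2r.
Qed.

Lemma cylindrical_cat (T : Type) s1 s2 (f : W -> T) : cylindrical s1 f \/ cylindrical s2 f ->
  cylindrical (s1 ++ s2) f.
Proof.
have catE e : In_seq e s1 \/ In_seq e s2 -> In_seq e (s1 ++ s2).
  by elim: s1 => [|a s IH] /=; [case|case=> [[->|?]|?]; [left|right; apply: IH; left|right; apply: IH; right]].
by case=> cf w w' ag; apply: cf => e es; apply: ag; apply: catE; [left|right].
Qed.

Lemma bm_max f g : bounded_measurable f -> bounded_measurable g ->
  bounded_measurable (fun w => Num.max (f w) (g w)).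
Proof.
move=> [mf [M fM]] [mg [N gN]]; split; first exact: measurable_maxr.
exists (M + N) => w; have := fM w; have := gN w; rewrite /Num.max.
by have := normr_ge0 (f w); have := normr_ge0 (g w); case: ifP => _; lra.
Qed.

Lemma bm_min f g : bounded_measurable f -> bounded_measurable g ->
  bounded_measurable (fun w => Num.min (f w) (g w)).
Proof.
move=> [mf [M fM]] [mg [N gN]]; split; first exact: measurable_minr.
exists (M + N) => w; have := fM w; have := gN w; rewrite /Num.min.
by have := normr_ge0 (f w); have := normr_ge0 (g w); case: ifP => _; lra.
Qed.

Lemma ler_dist_max (a b c d : R) : `|Num.max a b - Num.max c d| <= `|a - c| + `|b - d|.
Proof.
rewrite ler_norml /Num.max; have := ler_norm (a - c); have := ler_norm (b - d).
have := lerNnormlW (lexx `|a - c|); have := lerNnormlW (lexx `|b - d|).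
have := normr_ge0 (a - c); have := normr_ge0 (b - d).
by case: ltP => ?; case: ltP => ? ? ? ? ? ? ?; apply/andP; split; lra.
Qed.

Lemma approximable_near f :
  bounded_measurable f ->
  (forall eps : R, 0 < eps -> exists g, [/\ bounded_measurable g, approximable g &
    \int[muW]_w (`|f w - g w| * om w) <= eps]) -> approximable f.
Proof.
move=> bf fg eps e0; have e2 : 0 < eps / 2 by rewrite divr_gt0.
have [g [bg ag fge]] := fg _ e2.
have [s [h [bh ch gh]]] := ag _ e2.
exists s, h; split => //; rewrite [leRHS](splitr eps).
apply: le_trans (lerD fge gh); apply: L1D; [exact: bmB|exact: bmB|exact: bmB|].
by move=> w; rewrite -(subrKA (g w)) ler_normD.
Qed.

Lemma approximable_cvg f (f_ : nat -> borel W -> R) M :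
  bounded_measurable f -> (forall n, bounded_measurable (f_ n)) ->
  (forall n, approximable (f_ n)) -> (forall n w, `|f w - f_ n w| <= M) ->
  (forall w, f_ n w @[n --> \oo] --> f w) -> approximable f.
Proof.
move=> bf bf_ af_ fM fcvg; apply: approximable_near => // eps e0.
have h : \int[muW]_w (`|f w - f_ n w| * om w) @[n --> \oo] --> \int[muW]_w (0 : R).
  apply: (dominated_Rcvg _ _ (integrable_EFinZ M iom)).
  - by move=> n; apply: integrable_measurable; apply: iL1; exact: bmB.
  - exact: measurable_cst.
  - by move=> n w; rewrite normrM normr_id (ger0_norm (om0 w)) ler_wpM2r.
  - move=> w; rewrite -(mul0r (om w)); apply: cvgMl; rewrite -(@normr0 _ R).
    by apply: cvg_norm; rewrite -(subrr (f w)); apply: cvgB => //; exact: cvg_cst.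
have h0 : \int[muW]_w (0 : R) = 0 by rewrite /Rintegral integral0.
rewrite h0 in h; move/cvgrPdist_le: h => /(_ _ e0)[n _ /(_ n (leqnn n))] /=.
rewrite sub0r normrN => he; exists (f_ n); split => //.
by apply: le_trans he; exact: ler_norm.
Qed.

Lemma approximable_max f g : bounded_measurable f -> bounded_measurable g ->
  approximable f -> approximable g -> approximable (fun w => Num.max (f w) (g w)).
Proof.
move=> bf bg af ag eps e0; have e2 : 0 < eps / 2 by rewrite divr_gt0.
have [s [f' [bf' cf' ff']]] := af _ e2.
have [t [g' [bg' cg' gg']]] := ag _ e2.
exists (s ++ t), (fun w => Num.max (f' w) (g' w)); split; first exact: bm_max.
- move=> w w' ww'; congr Num.max.
    exact: (cylindrical_cat (or_introl cf') ww').
  exact: (cylindrical_cat (or_intror cg') ww').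
- rewrite [leRHS](splitr eps); apply: le_trans (lerD ff' gg').
  apply: L1D; [exact: bmB (bm_max _ _) (bm_max _ _)|exact: bmB|exact: bmB|].
  by move=> w; exact: ler_dist_max.
Qed.

Lemma approximable_comb a f g : bounded_measurable f -> bounded_measurable g ->
  approximable f -> approximable g -> approximable (fun w => a * f w + g w).
Proof.
move=> bf bg af ag eps e0; have e2 : 0 < eps / 2 by rewrite divr_gt0.
have a0 : 0 < `|a| + 1 by rewrite ltr_wpDl.
have ea : 0 < eps / 2 / (`|a| + 1) by rewrite divr_gt0.
have [s [f' [bf' cf' ff']]] := af _ ea.
have [t [g' [bg' cg' gg']]] := ag _ e2.
exists (s ++ t), (fun w => a * f' w + g' w); split; first exact: bmD (bmZ _ _) _.
- move=> w w' ww'; congr (a * _ + _).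
    exact: (cylindrical_cat (or_introl cf') ww').
  exact: (cylindrical_cat (or_intror cg') ww').
- rewrite [leRHS](splitr eps).
  have ff2 : L1 (fun w => (`|a| + 1) * (f w - f' w)) <= eps / 2.
    rewrite /L1; under eq_Rintegral do rewrite normrM (gtr0_norm a0) -mulrA.
    rewrite RintegralZl//; last exact: iL1 (bmB bf bf').
    by rewrite mulrC -ler_pdivlMr.
  apply: le_trans (lerD ff2 gg').
  apply: L1D; [exact: bmB (bmD (bmZ _ _) _) (bmD (bmZ _ _) _)|exact: bmZ (bmB _ _)|exact: bmB|].
  move=> w; rewrite (_ : _ - _ = a * (f w - f' w) + (g w - g' w)); last by ring.
  apply: le_trans (ler_normD _ _) _; rewrite lerD2r !normrM (gtr0_norm a0).
  by rewrite ler_wpM2r// lerDl.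
Qed.

Lemma approximable_cylindrical s f : bounded_measurable f -> cylindrical s f -> approximable f.
Proof.
move=> bf cf eps e0; exists s, f; split => //.
rewrite (_ : Rintegral _ _ _ = 0) ?ltW//.
under eq_Rintegral do rewrite subrr normr0 mul0r.
by rewrite /Rintegral integral0.
Qed.

Lemma approximable_cst c : approximable (fun=> c).
Proof. by apply: (@approximable_cylindrical [::]) => //; exact: bm_cst. Qed.

Lemma approximable_indic (A : set (borel W)) : measurable A -> approximable \1_A.
Proof.
(* Measurability is carried through the induction because the closure steps work with bounded
   measurable indicators. *)
move=> mA; suff [] : measurable A /\ approximable (\1_A : borel W -> R) by [].
move: A mA; apply: borel_dual_ind => //.
- split; first exact: measurable0.
  rewrite (_ : \1_set0 = fun=> 0); first exact: approximable_cst.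
  by apply/funext => w; rewrite indicE in_set0.
- move=> A [mA aA]; split; first exact: measurableC.
  rewrite (_ : \1_(~` A) = fun w => -1 * \1_A w + 1).
    exact: (approximable_comb _ (bm_indic _ mA) (bm_cst _ 1) aA (approximable_cst 1)).
  apply/funext => w; rewrite !indicE in_setC.
  by case: (w \in A) => /=; rewrite ?mulr1 ?mulr0; ring.
- move=> F FP; have mF n : measurable (F n : set (borel W)) := (FP n).1.
  have mU : measurable (\bigcup_n F n : set (borel W)) by exact: bigcup_measurable.
  split => //; pose U n := \big[setU/set0]_(k < n) F k.
  have mUn n : measurable (U n : set (borel W)) by apply: bigsetU_measurable.
  apply: (@approximable_cvg _ (fun n => \1_(U n)) 1); [exact: bm_indic|by move=> n; exact: bm_indic| | |].
  + elim => [|n IH].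
      rewrite /U big_ord0 (_ : \1_set0 = fun=> 0); first exact: approximable_cst.
      by apply/funext => w; rewrite indicE in_set0.
    rewrite /U big_ord_recr /= -/(U n).
    rewrite (_ : \1_(U n `|` F n) = fun w => Num.max (\1_(U n) w) (\1_(F n) w)).
      exact: approximable_max (bm_indic _ (mUn n)) (bm_indic _ (mF n)) IH (FP n).2.
    apply/funext => w; rewrite !indicE in_setU.
    by case: (w \in U n); case: (w \in F n) => /=; rewrite /Num.max ?ltxx ?ltr01 ?ltr10.
  + move=> n w; rewrite !indicE.
    by do 2 case: (_ \in _); rewrite ?subrr ?subr0 ?sub0r ?normrN ?normr1 ?normr0.
  + move=> w; have [[n _ Fnw]|nU] := pselect ((\bigcup_n F n) w).
      apply: cvg_near_cst; exists n.+1 => // m /= nm; rewrite !indicE.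
      have -> : w \in \bigcup_n F n by apply/mem_set; exists n.
      have -> // : w \in U m; apply/mem_set.
      by rewrite /U -bigcup_mkord; exists n.
    apply: cvg_near_cst; exists 0%N => // m _; rewrite !indicE.
    rewrite (memNset nU) memNset// /U -bigcup_mkord => -[k _ Fkw].
    by apply: nU; exists k.
- move=> e a.
  have mE : measurable ([set w | a < e w] : set (borel W)).
    exact: (measurable_lt (measurable_cst a) (measurable_dual e)).
  split => //; apply: (@approximable_cylindrical [:: e]); first exact: bm_indic.
  move=> w w' ww'; rewrite !indicE; congr ((_ : bool)%:R).
  by apply/idP/idP => /set_mem /= h; apply/mem_set => /=; move: h; rewrite (ww' e)//; left.
Qed.

Lemma approximable_bm f : bounded_measurable f -> approximable f.
Proof.
move: f; apply: bm_ind; [exact: approximable_indic|exact: approximable_comb|].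
move=> f bf fg; apply: approximable_near => // eps e0.
pose t := \int[muW]_w om w.
have t0 : 0 <= t by apply: Rintegral_ge0.
have [|g [bg ag fge]] := fg (eps / (t + 1)); first by rewrite divr_gt0// ltr_wpDl.
exists g; split => //.
apply: (@le_trans _ _ (\int[muW]_w (eps / (t + 1) * om w))).
  apply: le_Rintegral => // [||w _]; [exact: iL1 (bmB bf bg)|exact: integrable_EFinZ|].
  by rewrite ler_wpM2r.
rewrite RintegralZl// -/t -mulrA ler_piMr ?(ltW e0)//.
by rewrite mulrC ler_pdivrMr ?ltr_wpDl// mul1r lerDl.
Qed.

End cylindrical_approximation.

(** Clipping an approximant to the bound of [f] does not increase the distance, and it keeps its
    exponential below [expR M]. *)
Lemma ler_dist_clip (R : realDomainType) (M a b : R) : `|a| <= M ->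
  `|a - Num.max (Num.min b M) (- M)| <= `|a - b|.
Proof.
rewrite !ler_norml => /andP[Ma aM].
have := ler_norm (a - b); have := lerNnormlW (lexx `|a - b|).
have := normr_ge0 (a - b); rewrite /Num.max /Num.min.
by case: (ltP b M) => ?; case: ltP => ? ? ? ?; apply/andP; split; lra.
Qed.

(** * Entropy against information, by duality *)

Section entropy_bound.
Variables (R : realType) (W H : completeNormedModType R).
Variables (ip : {dot H for (@idfun R)}) (i : {linear H -> W}) (j : dual W -> H).
Variables (muW : probability (borel W) R) (muX : probability (borel H) R) (rho : R).
Hypothesis Haws : abstract_wiener_space ip i j muW.
Variables (l : borel W -> R) (S : borel W -> borel H).
Implicit Types (e : dual W) (s : seq (dual W)) (x : borel H) (w : borel W) (f : borel W -> R).

Notation Q := (prod_prob muX muW).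
Notation Y := (channel i rho).
Notation signal := (signal ip j rho).
Notation kernel := (kernel ip j rho).
Notation lik := (lik ip j muX rho).
Notation dlik := (dlik ip j muX rho).
Notation orthonormal := (orthonormal ip j).

Hypothesis signal_integrable : forall e, muX.-integrable setT (EFin \o signal e).
Hypotheses (l0 : forall w, 0 <= l w) (il : muW.-integrable setT (EFin \o l)).
Hypothesis density : forall f, bounded_measurable f ->
  \int[Q]_z f (Y z) = \int[muW]_w (f w * l w).
Hypothesis mSe : forall e, measurable_fun setT (fun w => ip (S w : H) (j e) : R).
Hypothesis mSn : measurable_fun setT (fun w => `|S w : H|).
Hypothesis score_integrable : forall e,
  muW.-integrable setT (EFin \o (fun w => l w * ip (S w : H) (j e))).
Hypothesis score : forall e f, bounded_measurable f ->
  \int[Q]_z (f (Y z) * signal e z.1) = \int[muW]_w (f w * (l w * ip (S w : H) (j e))).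

Let ml : measurable_fun setT l := integrable_measurable il.

Lemma cylindrical_density s f : orthonormal s -> bounded_measurable f -> cylindrical s f ->
  \int[muW]_w (f w * lik s w) = \int[muW]_w (f w * l w).
Proof.
move=> os bf cf; rewrite -density//.
have := cylindrical_transfer rho Haws os (bm_integrable muX (bm_cst _ 1)) bf cf.
under eq_Rintegral do rewrite mulr1; move=> ->.
by apply: eq_Rintegral => w _; congr (_ * _); apply: eq_Rintegral => x _; rewrite mul1r.
Qed.

Lemma integrable_lik s : orthonormal s -> muW.-integrable setT (EFin \o lik s).
Proof.
move=> os; have := integrable_lik_weighted rho Haws os (bm_integrable muX (bm_cst _ 1)).
apply: eq_integrable => // w _ /=; congr EFin.
by apply: eq_Rintegral => x _; rewrite mul1r.
Qed.

(** The ratio [dlik / lik] is the score of the projected law, made bounded so as to be a test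
    function. It is set to 0 instead of being clipped at the level [n], so that its product with
    [dlik] is exactly its square times [lik]. *)
Let truncated_score e s (n : nat) w : R :=
  let c := dlik e s w / lik (e :: s) w in if `|c| <= n%:R then c else 0.

Let bm_truncated_score e s n : bounded_measurable (truncated_score e s n).
Proof.
have mc : measurable_fun setT (fun w => dlik e s w / lik (e :: s) w).
  apply: measurable_funM; first exact: (measurable_dlik muX rho Haws).
  apply: measurable_inv_gt0 => [|w]; first exact: (measurable_lik muX rho Haws).
  exact: (lik_gt0 muX rho Haws).
split; last first.
  by exists n%:R => w; rewrite /truncated_score; case: ifP => // _; rewrite normr0 ler0n.
apply: measurable_fun_ifT => //.
by apply: measurable_fun_ler; [exact: measurableT_comp|exact: measurable_cst].
Qed.

Let truncated_cylindrical e s n : cylindrical (e :: s) (truncated_score e s n).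
Proof.
move=> w w' ag; rewrite /truncated_score (dlik_cylindrical ip j muX rho ag).
by rewrite (lik_cylindrical ip j muX rho ag).
Qed.

(** Jensen's inequality in the form of a completed square. For the truncated score [T], the integral
    [A] of [T^2 lik] equals that of [T^2 l] by conditioning and that of [T l <S, h>] by the score
    identity. Then [0 <= l (T - <S, h>)^2] gives [2 A <= A + B], and the truncation is removed by
    monotone convergence. *)
Lemma directional_information_le e s : orthonormal (e :: s) ->
  (\int[muW]_w (dlik e s w ^+ 2 / (2 * lik (e :: s) w))%:E <=
   2^-1%:E * \int[muW]_w (l w * ip (S w : H) (j e) ^+ 2)%:E)%E.
Proof.
move=> os.
have likp w : 0 < lik (e :: s) w by exact: (lik_gt0 muX rho Haws).
have mp2 : measurable_fun setT (fun w => l w * ip (S w : H) (j e) ^+ 2).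
  by apply: measurable_funM => //; exact: measurable_funX.
have p20 w : 0 <= l w * ip (S w : H) (j e) ^+ 2 by rewrite mulr_ge0// sqr_ge0.
have [->|Bfin] := eqVneq (\int[muW]_w (l w * ip (S w : H) (j e) ^+ 2)%:E)%E +oo%E.
  by rewrite gt0_muley ?leey// lte_fin invr_gt0.
have ip2 : muW.-integrable setT (EFin \o (fun w => l w * ip (S w : H) (j e) ^+ 2)).
  by apply: ge0_integrable => //; rewrite lt_neqAle Bfin leey.
rewrite -(EFin_Rintegral ip2); set B := Rintegral _ _ _.
pose g n w := truncated_score e s n w ^+ 2 * lik (e :: s) w / 2.
have bT2 n : bounded_measurable (fun w => truncated_score e s n w ^+ 2).
  have := bmM (bm_truncated_score e s n) (bm_truncated_score e s n).
  by congr bounded_measurable; apply/funext => w; rewrite expr2.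
have iT n : muW.-integrable setT (EFin \o (fun w => truncated_score e s n w ^+ 2 * lik (e :: s) w)).
  by apply: bm_integrableM => //; exact: integrable_lik.
have gn n : \int[muW]_w (truncated_score e s n w ^+ 2 * lik (e :: s) w) <= B.
  set A := Rintegral _ _ _.
  have A1 : A = \int[muW]_w (truncated_score e s n w ^+ 2 * l w).
    apply: (cylindrical_density os (bT2 n)).
    by move=> w w' ag; rewrite (truncated_cylindrical n ag).
  have A2 : A = \int[muW]_w (truncated_score e s n w * (l w * ip (S w : H) (j e))).
    rewrite -(score e (bm_truncated_score e s n)).
    rewrite (cylindrical_transfer rho Haws os (signal_integrable e) (bm_truncated_score e s n) (truncated_cylindrical n)).
    apply: eq_Rintegral => w _; rewrite -/(dlik e s w) /truncated_score.
    case: ifP => _; last by rewrite expr0n !mul0r.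
    by rewrite expr2 -mulrA divfK ?gt_eqF.
  suff : 2 * A <= A + B by lra.
  rewrite {1}A2 A1 -RintegralZl//; last exact: bm_integrableM.
  rewrite -RintegralD//; last exact: bm_integrableM.
  apply: le_Rintegral => // [||w _].
  - by apply: integrable_EFinZ; exact: bm_integrableM.
  - by apply: integrable_EFinD => //; exact: bm_integrableM.
  - have := mulr_ge0 (l0 w) (sqr_ge0 (truncated_score e s n w - ip (S w : H) (j e))).
    by rewrite sqrrB; lra.
have mg n : measurable_fun setT (g n).
  by apply: measurable_funM => //; exact: integrable_measurable (iT n).
have g0 n w : 0 <= g n w by rewrite divr_ge0// mulr_ge0// ?sqr_ge0// ltW.
have gnd w m n : (m <= n)%N -> g m w <= g n w.
  move=> mn; rewrite /g ler_wpM2r ?invr_ge0// ler_wpM2r// ?(ltW (likp w))//.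
  rewrite /truncated_score; case: ifPn => h1; last by rewrite expr0n/= sqr_ge0.
  by rewrite (le_trans h1)// ler_nat.
have gcvg w : g n w @[n --> \oo] --> dlik e s w ^+ 2 / (2 * lik (e :: s) w).
  apply: cvg_near_cst; near=> n.
  rewrite /g /truncated_score ifT.
    rewrite expr_div_n expr2 [in LHS](expr2 (lik _ _)); field.
    by rewrite gt_eqF.
  apply: le_trans (ltW (truncnS_gt _)) _.
  by rewrite ler_nat; near: n; exact: nbhs_infty_ge.
have := monotone_Rcvg (mu := muW) mg g0 gnd gcvg => h.
rewrite -(cvg_lim _ h)//; apply: lime_le; first by apply/cvg_ex; exists (\int[muW]_w (dlik e s w ^+ 2 / (2 * lik (e :: s) w))%:E)%E.
near=> n; rewrite /g.
have i2 : muW.-integrable setT (EFin \o (g n)).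
  have := integrable_EFinZ 2^-1 (iT n).
  by apply: eq_integrable => // w _ /=; rewrite mulrC.
rewrite -(EFin_Rintegral i2) -EFinM lee_fin /g.
under eq_Rintegral do rewrite mulrC.
by rewrite RintegralZl// ler_wpM2l.
Unshelve. all: by end_near. Qed.

Lemma cylindrical_entropy_sum s : orthonormal s ->
  (\int[muW]_w (Psi (lik s w))%:E <=
   2^-1%:E * \int[muW]_w (l w * \sum_(e <- s) ip (S w : H) (j e) ^+ 2)%:E)%E.
Proof.
elim: s => [_|e s IH os].
  rewrite (_ : (\int[muW]_w (Psi (lik [::] w))%:E)%E = 0%E).
    rewrite mule_ge0// integral_ge0// => w _.
    by rewrite big_nil mulr0.
  apply: integral0_eq => w _; congr EFin; rewrite /Psi.
  have -> : lik [::] w = 1.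
    apply: EFin_inj; rewrite (EFin_Rintegral (bm_integrable muX (bm_kernel rho Haws [::] w))).
    rewrite -[RHS](integral_prob_cst muX 1); apply: eq_integral => x _.
    by rewrite /kernel big_nil expR0.
  by rewrite ln1; ring.
have [e1 es os'] := os.
apply: le_trans (entropy_chain muX rho Haws e1 es) _.
apply: le_trans (leeD (IH os') (directional_information_le os)) _.
have msum : measurable_fun setT (fun w => l w * \sum_(e <- s) ip (S w : H) (j e) ^+ 2).
  by apply: measurable_funM => //; apply: measurable_sum => e'; exact: measurable_funX.
have mp2 : measurable_fun setT (fun w => l w * ip (S w : H) (j e) ^+ 2).
  by apply: measurable_funM => //; exact: measurable_funX.
have p20 w : 0 <= l w * ip (S w : H) (j e) ^+ 2 by rewrite mulr_ge0// sqr_ge0.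
have s0 w : 0 <= l w * \sum_(e <- s) ip (S w : H) (j e) ^+ 2.
  by rewrite mulr_ge0// sumr_ge0// => e' _; exact: sqr_ge0.
rewrite -ge0_muleDr; last 2 first.
- by apply: integral_ge0 => w _; rewrite lee_fin.
- by apply: integral_ge0 => w _; rewrite lee_fin.
rewrite -(ge0_integralD_real muW s0 p20 msum mp2) le_eqVlt; apply/orP; left; apply/eqP.
congr (_ * _)%E; apply: eq_integral => w _; rewrite big_cons; congr EFin; ring.
Qed.

Let information := (2^-1%:E * \int[muW]_w (l w * `|S w : H| ^+ 2)%:E)%E.

Lemma cylindrical_entropy_le s : orthonormal s ->
  (\int[muW]_w (Psi (lik s w))%:E <= information)%E.
Proof.
move=> os; apply: le_trans (cylindrical_entropy_sum os) _.
apply: lee_wpmul2l => //.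
apply: ge0_le_integral_real.
- move=> w; rewrite mulr_ge0 ?sumr_ge0//=; last by move=> e _; exact: sqr_ge0.
  by rewrite ler_wpM2l//; exact: (bessel Haws).
- by apply: measurable_funM => //; apply: measurable_sum => e'; exact: measurable_funX.
- by apply: measurable_funM => //; exact: measurable_funX.
Qed.

(* Young's inequality for the pair of conjugate functions Psi and exp - 1. *)
Lemma mul_le_Psi (a b : R) : 0 < a -> a * b <= Psi a + expR b - 1.
Proof.
move=> a0; have := expR_ge1Dx (b - ln a).
rewrite expRD expRN (lnK a0) -(ler_pM2l a0) [a * (_ / a)]mulrC divfK ?gt_eqF//.
rewrite /Psi; lra.
Qed.

Variable K : R.
Hypothesis information_le : (information <= K%:E)%E.

(** Young's inequality is applied with [lik s], whose entropy bound [K] does not depend on [s]; that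
    uniformity is what lets the cylindrical restriction be dropped. *)
Lemma cylindrical_duality s f : orthonormal s -> bounded_measurable f -> cylindrical s f ->
  \int[muW]_w (f w * l w) <= K + \int[muW]_w expR (f w) - 1.
Proof.
move=> os bf cf; rewrite -(cylindrical_density os bf cf).
have likp w : 0 < lik s w by exact: (lik_gt0 muX rho Haws).
have mP : measurable_fun setT (fun w => Psi (lik s w)).
  by apply: (measurableT_comp (@measurable_Psi R)); exact: (measurable_lik muX rho Haws).
have Poo := le_trans (cylindrical_entropy_le os) information_le.
have iP : muW.-integrable setT (EFin \o (fun w => Psi (lik s w))).
  apply: ge0_integrable => //; first by move=> w; exact: Psi_ge0.
  by apply: le_lt_trans Poo _; rewrite ltry.
rewrite -(EFin_Rintegral iP) lee_fin in Poo.
have bE : bounded_measurable (fun w => expR (f w)).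
  case: bf => mf [M fM]; split; first exact: measurableT_comp.
  exists (expR M) => w; rewrite gtr0_norm ?expR_gt0// ler_expR.
  by apply: le_trans (fM w); exact: ler_norm.
have iE := bm_integrable muW bE.
have i1 := bm_integrable muW (bm_cst _ (1 : R)).
have -> : 1 = \int[muW]_w (1 : R) by rewrite Rintegral_prob_cst.
apply: (@le_trans _ _ (\int[muW]_w (Psi (lik s w) + (expR (f w) - 1)))).
  apply: le_Rintegral => // [||w _].
  - by apply: bm_integrableM => //; exact: integrable_lik.
  - by apply: integrable_EFinD => //; exact: integrable_EFinB.
  - by rewrite mulrC addrA; exact: mul_le_Psi.
rewrite RintegralD//; last exact: integrable_EFinB.
by rewrite RintegralB// addrA !lerD2r.
Qed.

(** A cylindrical approximant in L^1 with weight [1 + l] is clipped to the bound of [f] and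
    rewritten over an orthonormal list, to which the cylindrical case applies. *)
Lemma duality f : bounded_measurable f ->
  \int[muW]_w (f w * l w) <= K + \int[muW]_w expR (f w) - 1.
Proof.
move=> bf; have [mf [M0 fM0]] := bf.
pose M := `|M0|.
have fM w : `|f w| <= M by apply: le_trans (fM0 w) (ler_norm _).
apply/ler_addgt0Pr => d d0.
(* The linear term changes by at most [|f - g| l] and the exponential one by at most
   [expR M |f - g|]; both fit under [C |f - g| (1 + l)]. *)
pose C := 1 + expR M.
have C0 : 0 < C by rewrite addr_gt0// expR_gt0.
have om0 w : 0 <= 1 + l w by rewrite addr_ge0.
have iom : muW.-integrable setT (EFin \o (fun w => 1 + l w)).
  by apply: integrable_EFinD => //; exact: (bm_integrable muW (bm_cst _ (1 : R))).
have [L [g [bg cg fg]]] := approximable_bm (aws_separable Haws) om0 iom bf (divr_gt0 d0 C0).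
have [s [os sL]] := orthonormal_span Haws L.
pose h w := Num.max (Num.min (g w) M) (- M).
have M0' : 0 <= M by exact: normr_ge0.
have hM w : `|h w| <= M.
  rewrite /h ler_norml /Num.max /Num.min.
  by case: (ltP (g w) M) => ?; case: ltP => ?; apply/andP; split; lra.
have bh : bounded_measurable h.
  exact: bm_max (bm_min bg (bm_cst _ M)) (bm_cst _ (- M)).
have ch : cylindrical s h.
  move=> w w' ag; rewrite /h; congr (Num.max (Num.min _ _) _).
  by apply: cg => e eL; exact: sL eL _ _ ag.
have fh w : `|f w - h w| <= `|f w - g w| by exact: ler_dist_clip.
have bE (k : borel W -> R) : bounded_measurable k -> bounded_measurable (fun w => expR (k w)).
  case=> mk [N kN]; split; first exact: measurableT_comp.
  exists (expR N) => w; rewrite gtr0_norm ?expR_gt0// ler_expR.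
  by apply: le_trans (kN w); exact: ler_norm.
have ifg : muW.-integrable setT (EFin \o (fun w => `|f w - g w| * (1 + l w))).
  apply: bm_integrableM => //; have [ma [N aN]] := bmB bf bg.
  by split; [exact: measurableT_comp|exists N => w; rewrite normr_id].
have := cylindrical_duality os bh ch.
have e1 : \int[muW]_w (f w * l w) - \int[muW]_w (h w * l w) + (\int[muW]_w expR (h w) - \int[muW]_w expR (f w)) <= d.
  have ifl := bm_integrableM bf il; have ihl := bm_integrableM bh il.
  have ief := bm_integrable muW (bE _ bf); have ieh := bm_integrable muW (bE _ bh).
  rewrite -!RintegralB// -RintegralD//; try exact: integrable_EFinB.
  apply: (@le_trans _ _ (\int[muW]_w (C * (`|f w - g w| * (1 + l w))))).
    apply: le_Rintegral => // [||w _].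
    - by apply: integrable_EFinD; exact: integrable_EFinB.
    - exact: integrable_EFinZ.
    - have a1 : (f w - h w) * l w <= `|f w - g w| * l w.
        by rewrite ler_wpM2r//; apply: le_trans (ler_norm _) (fh w).
      have a2 : expR (h w) - expR (f w) <= expR M * `|f w - g w|.
        have := expR_ge1Dx (f w - h w); rewrite expRD expRN -(ler_pM2l (expR_gt0 (h w))).
        rewrite [expR (h w) * (_ / _)]mulrC divfK ?gt_eqF ?expR_gt0// => a3.
        apply: (@le_trans _ _ (expR (h w) * (h w - f w))); first by lra.
        apply: (@le_trans _ _ (expR (h w) * `|f w - g w|)).
          rewrite ler_wpM2l ?expR_ge0//; apply: le_trans (fh w).
          by rewrite -normrN opprB ler_norm.
        by rewrite ler_wpM2r// ler_expR; apply: le_trans (hM w); exact: ler_norm.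
      have a4 : 0 <= expR M * (`|f w - g w| * l w) by rewrite !mulr_ge0// expR_ge0.
      have a5 : 0 <= `|f w - g w| by [].
      by rewrite /C -mulrBl; lra.
  by rewrite RintegralZl// mulrC -ler_pdivlMr.
lra.
Qed.

End entropy_bound.

Section fatou_bounds.
Context d (T : measurableType d) (R : realType) (mu : {measure set T -> \bar R}).
Variables (g : nat -> T -> R).
Hypotheses (mg : forall n, measurable_fun setT (g n)) (g0 : forall n x, 0 <= g n x).

Lemma fatou_le f (K : \bar R) : (forall x, g n x @[n --> \oo] --> f x) ->
  (forall n, (\int[mu]_x (g n x)%:E <= K)%E) -> (\int[mu]_x (f x)%:E <= K)%E.
Proof.
move=> gf gK.
have -> : (\int[mu]_x (f x)%:E = \int[mu]_x limn_einf (fun n => (g n x)%:E))%E.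
  apply: eq_integral => x _; have h : (g n x)%:E @[n --> \oo] --> (f x)%:E.
    by apply: cvg_EFin (gf x); near=> n.
  by rewrite (cvg_limn_einf_sup h).1.
have mE n : measurable_fun setT (fun x => (g n x)%:E) by exact/measurable_EFinP.
have g0E n x : setT x -> (0 <= (g n x)%:E)%E by rewrite lee_fin.
apply: le_trans (fatou mu measurableT mE g0E) _.
rewrite limn_einf_lim; apply: lime_le; first exact: is_cvg_einfs.
by near=> n; apply: le_trans (gK n); apply: ereal_inf_lbound; exists n => //=.
Unshelve. all: by end_near. Qed.

End fatou_bounds.

Section entropy_of_duality.
Context d (T : measurableType d) (R : realType) (mu : probability T R).
Variables (l : T -> R) (K : R).
Hypotheses (l0 : forall x, 0 <= l x) (il : mu.-integrable setT (EFin \o l)).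
Hypothesis duality : forall f, bounded_measurable f ->
  \int[mu]_x (f x * l x) <= K + \int[mu]_x expR (f x) - 1.

Let ml : measurable_fun setT l := integrable_measurable il.

(** The optimal test function [ln l] is unbounded on both sides, so [ln (t n)] is used, with [l]
    clipped between [n.+1^-1] and [n.+1]. Its exponential is [t n], so duality bounds the integral
    of [l ln (t n) - t n + 1], and Fatou concludes. *)
Lemma entropy_of_duality : (\int[mu]_x (Psi (l x))%:E <= K%:E)%E.
Proof.
pose t n x := Num.max (Num.min (l x) n.+1%:R) n.+1%:R^-1.
have inv1 n : (n.+1%:R : R)^-1 <= 1 by rewrite invf_le1// ler1n.
have inv0 n : 0 < (n.+1%:R : R)^-1 by rewrite invr_gt0.
have n1 n : 1 <= n.+1%:R :> R by rewrite ler1n.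
have t0 n x : 0 < t n x by rewrite /t lt_max inv0 orbT.
have tn n x : t n x <= n.+1%:R.
  by rewrite /t ge_max ge_min lexx orbT/= (le_trans (inv1 n)).
have tn' n x : n.+1%:R^-1 <= t n x by rewrite /t le_max lexx orbT.
have mt n : measurable_fun setT (t n).
  by apply: measurable_maxr => //; apply: measurable_minr.
have bt n : bounded_measurable (t n).
  by split => //; exists n.+1%:R => x; rewrite gtr0_norm.
have bln n : bounded_measurable (fun x => ln (t n x)).
  split; first exact: measurableT_comp.
  exists (ln n.+1%:R) => x; rewrite ler_norml -lnV ?posrE// !ler_ln ?posrE//.
  by rewrite tn tn'.
apply: (fatou_le (g := fun n x => l x * ln (t n x) - t n x + 1)).
- move=> n; apply: measurable_funD => //; apply: measurable_funB => //.
  by apply: measurable_funM => //; case: (bln n).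
(* The integrand is [Psi (t n) + (l - t n) ln (t n)]. Clipping makes the two factors agree in sign:
   both are nonpositive below the lower level and nonnegative above the upper one. *)
- move=> n x; have := Psi_ge0 (t0 n x); rewrite /Psi.
  suff : 0 <= (l x - t n x) * ln (t n x) by lra.
  rewrite /t; have := inv1 n; have := inv0 n; have := n1 n => a1 a2 a3.
  rewrite /Num.max /Num.min; case: (ltP (l x) n.+1%:R) => h1; case: ltP => h2.
  + by apply: mulr_le0; [rewrite subr_le0 (ltW h2)|exact: ln_le0].
  + by rewrite subrr mul0r.
  + by have := lt_le_trans h2 (le_trans a3 a1); rewrite ltxx.
  + by apply: mulr_ge0; [rewrite subr_ge0|exact: ln_ge0].
- move=> x; have [lx|lx] := eqVneq (l x) 0.
    rewrite /Psi lx mul0r sub0r.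
    have tE n : t n x = n.+1%:R^-1.
      by rewrite /t lx (min_idPl _) ?ler0n// (max_idPr _)// ltW.
    under eq_fun do rewrite mul0r sub0r tE.
    apply: cvgD; last exact: cvg_cst.
    by apply: cvgN; exact: cvg_harmonic.
  have lp : 0 < l x by rewrite lt_neqAle eq_sym lx l0.
  apply: cvg_near_cst; near=> n; rewrite /Psi.
  suff -> : t n x = l x by [].
  rewrite /t (min_idPl _).
    rewrite (max_idPl _)// -[leRHS]invrK lef_pV2 ?posrE ?invr_gt0//.
    apply: le_trans (ltW (truncnS_gt _)) _; rewrite ler_nat ltnS.
    by near: n; exact: nbhs_infty_ge.
  apply: le_trans (ltW (truncnS_gt _)) _; rewrite ler_nat ltnS.
  by near: n; exact: nbhs_infty_ge.
- move=> n.
  have i1 := bm_integrableM (bln n) il.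
  have i2 := bm_integrable mu (bt n).
  have i3 := bm_integrable mu (bm_cst _ (1 : R)).
  have i12 : mu.-integrable setT (EFin \o (fun x => l x * ln (t n x) - t n x)).
    apply: integrable_EFinB i2; move: i1; apply: eq_integrable => // x _ /=.
    by rewrite mulrC.
  rewrite -(EFin_Rintegral (integrable_EFinD i12 i3)) lee_fin.
  rewrite RintegralD// Rintegral_prob_cst.
  under [X in X + _ <= _]eq_Rintegral do rewrite mulrC.
  rewrite RintegralB//.
  have := duality (bln n); under [X in _ <= _ + X - _ -> _]eq_Rintegral do rewrite lnK ?posrE//.
  lra.
Unshelve. all: by end_near. Qed.

End entropy_of_duality.

(** * Differentiation along the Cameron-Martin space *)

(** The Radon-Nikodym derivative of the image under [Y] of the charge with density [k]; the null-set
    hypothesis provides absolute continuity. *)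
Lemma exists_transfer_density d d' (O : measurableType d) (T : measurableType d') (R : realType)
    (P : {measure set O -> \bar R}) (mu : {sigma_finite_measure set T -> \bar R})
    (Y : O -> T) (k : O -> R) :
  measurable_fun setT Y -> P.-integrable setT (EFin \o k) ->
  (forall A, measurable A -> mu A = 0%E -> P (Y @^-1` A) = 0%E) ->
  exists2 m : T -> R, mu.-integrable setT (EFin \o m) &
    forall A, measurable A -> (\int[P]_(x in Y @^-1` A) (k x)%:E = \int[mu]_(w in A) (m w)%:E)%E.
Proof.
move=> mY ik Pmu.
pose nu : {charge set T -> \bar R} :=
  measure_function_pushforward__canonical__charge_Charge (induced_charge ik) mY.
have numu : nu `<< mu.
  apply/null_content_dominatesP => A mA muA.
  rewrite /nu /= /pushforward /induced_charge; apply: null_set_integral => //.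
  - exact: measurable_preimage.
  - by apply: measurable_funTS; exact: measurable_int ik.
  - exact: Pmu.
have fin x : Radon_Nikodym nu mu x \is a fin_num := Radon_Nikodym_fin_num x numu.
have RNE x : (fine (Radon_Nikodym nu mu x))%:E = Radon_Nikodym nu mu x by rewrite fineK.
exists (fun x => fine (Radon_Nikodym nu mu x)).
  apply: eq_integrable (Radon_Nikodym_integrable numu) => // x _.
  by rewrite /= RNE.
move=> A mA; have := Radon_Nikodym_integral numu mA.
by rewrite {1}/nu /= /pushforward /induced_charge => ->; apply: eq_integral => x _; rewrite RNE.
Qed.

Section shifts.
Variables (R : realType) (W H : completeNormedModType R).
Variables (ip : {dot H for (@idfun R)}) (i : {linear H -> W}) (j : dual W -> H).
Variables (muW : probability (borel W) R).
Hypothesis Haws : abstract_wiener_space ip i j muW.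
Variable e : dual W.
Implicit Types (w : borel W) (f F g P : borel W -> R).

Definition cm_shift (s : R) w : borel W := (w : W) + s *: i (j e).

Lemma cm_shift0 w : cm_shift 0 w = w. Proof. by rewrite /cm_shift scale0r addr0. Qed.

Lemma cm_shiftD s t w : cm_shift s (cm_shift t w) = cm_shift (t + s) w.
Proof. by rewrite /cm_shift scalerDl addrA. Qed.

Lemma measurable_shift_fun s : measurable_fun setT (cm_shift s).
Proof. exact: (measurable_shift Haws (s *: i (j e))). Qed.

Lemma measurable_comp_shift s f : measurable_fun setT f -> measurable_fun setT (fun w => f (cm_shift s w)).
Proof. by move=> mf; apply: (measurableT_comp mf); exact: measurable_shift_fun. Qed.

Definition cm_density (s : R) w : R := expR (s * e (w : W) - s ^+ 2 * `|j e| ^+ 2 / 2).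

Lemma measurable_cm_density s : measurable_fun setT (cm_density s).
Proof.
apply: measurableT_comp => //; apply: measurable_funB => //.
by apply: measurable_funM => //; exact: measurable_dual.
Qed.

Lemma cm_density_ge0 s w : 0 <= cm_density s w. Proof. exact: expR_ge0. Qed.

Lemma cameron_martin_scale s F : measurable_fun setT F -> (forall w, 0 <= F w) ->
  (\int[muW]_w (F (cm_shift s w))%:E = \int[muW]_w (F w * cm_density s w)%:E)%E.
Proof.
move=> mF F0.
have [es esE] := dual_comb s 0 e e.
have jes : j es = s *: j e.
  by rewrite (j_comb Haws (a := s) (b := 0) (e1 := e) (e2 := e))// scale0r addr0.
have := cameron_martin Haws es mF F0; rewrite jes => h.
transitivity (\int[muW]_w (F ((w : W) + i (s *: j e)))%:E)%E.
  by apply: eq_integral => w _; rewrite /cm_shift linearZ.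
rewrite h; apply: eq_integral => w _; rewrite /cm_density esE mul0r addr0.
by rewrite normrZ exprMn real_normK ?num_real.
Qed.

Lemma cm_density_sqr s : (\int[muW]_w (cm_density s w ^+ 2)%:E = (expR (s ^+ 2 * `|j e| ^+ 2))%:E)%E.
Proof.
have := cameron_martin_scale (s + s) (measurable_cst (1 : R)) (fun=> ler01).
rewrite [X in X = _ -> _](integral_prob_cst muW 1) => h.
rewrite -[RHS]mule1 h -(ge0_integralZl_real muW (expR_ge0 _) (f := fun w => 1 * cm_density (s + s) w)).
- apply: eq_integral => w _; rewrite /cm_density expr2 -expRD mul1r -expRD.
  by congr (expR _)%:E; field.
- by move=> w; rewrite mul1r cm_density_ge0.
- by apply: measurable_funM => //; exact: measurable_cm_density.
Qed.

(* Uniform integrability of the translates with respect to the L^2 norm. *)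
Lemma shift_small (eps : R) : 0 < eps -> exists2 d : R, 0 < d & forall f, measurable_fun setT f ->
  (\int[muW]_w (f w ^+ 2)%:E <= d%:E)%E -> forall s, `|s| <= 1 ->
  (\int[muW]_w `|f (cm_shift s w)|%:E <= eps%:E)%E.
Proof.
move=> e0; pose C := expR (`|j e| ^+ 2); have C0 : 0 < C by exact: expR_gt0.
(* Young's inequality is balanced so that [k * d] and [C / (2 * k)] both equal [eps / 2]. *)
have [k k0 kE] : exists2 k, 0 < k & k = C / eps by exists (C / eps) => //; rewrite divr_gt0.
exists (eps / (2 * k)); first by rewrite divr_gt0// mulr_gt0.
move=> f mf fd s s1.
have mf2 : measurable_fun setT (fun w => f w ^+ 2) by exact: measurable_funX.
have mD2 : measurable_fun setT (fun w => cm_density s w ^+ 2).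
  by apply: measurable_funX; exact: measurable_cm_density.
rewrite (cameron_martin_scale s (F := fun w => `|f w|)) //; last exact: measurableT_comp.
apply: (@le_trans _ _ (\int[muW]_w (k * f w ^+ 2 + (2 * k)^-1 * cm_density s w ^+ 2)%:E)%E).
  apply: ge0_le_integral_real.
  - move=> w; rewrite mulr_ge0 ?cm_density_ge0//=.
    set a := `|f w|; set b := cm_density s w.
    have -> : f w ^+ 2 = a ^+ 2 by rewrite real_normK ?num_real.
    have := mulr_ge0 (ltW k0) (sqr_ge0 (a - b / (2 * k))).
    have -> : k * (a - b / (2 * k)) ^+ 2 = k * a ^+ 2 - a * b + b ^+ 2 / (4 * k).
      by field; rewrite gt_eqF.
    have : b ^+ 2 / (4 * k) <= (2 * k)^-1 * b ^+ 2.
      rewrite mulrC ler_wpM2r ?sqr_ge0// lef_pV2 ?posrE ?mulr_gt0//.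
      by rewrite ler_wpM2r ?(ltW k0)// ler_nat.
    move: (b ^+ 2 / (4 * k)) ((2 * k)^-1 * b ^+ 2) (k * a ^+ 2) (a * b) => x1 x2 x3 x4.
    lra.
  - apply: measurable_funM; first exact: measurableT_comp.
    exact: measurable_cm_density.
  - by apply: measurable_funD; exact: measurable_funM.
rewrite ge0_integralD_real; last 4 first.
- by move=> w; rewrite mulr_ge0 ?sqr_ge0// ltW.
- by move=> w; rewrite mulr_ge0 ?sqr_ge0// invr_ge0 mulr_ge0// ltW.
- exact: measurable_funM.
- exact: measurable_funM.
rewrite !ge0_integralZl_real ?(ltW k0)//; last 3 first.
- by rewrite invr_ge0 mulr_ge0// ltW.
- by move=> w; exact: sqr_ge0.
- by move=> w; exact: sqr_ge0.
rewrite cm_density_sqr [leRHS](_ : _ = k%:E * (eps / (2 * k))%:E + (2 * k)^-1%:E * C%:E)%E.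
  apply: leeD; first by apply: lee_wpmul2l => //; rewrite lee_fin ltW.
  rewrite -!EFinM lee_fin ler_wpM2l ?invr_ge0 ?mulr_ge0 ?(ltW k0)// ler_expR.
  by rewrite ler_piMl ?sqr_ge0// -(@real_normK _ s) ?num_real// expr_le1.
rewrite -!EFinM -EFinD; congr EFin; rewrite kE; field.
by rewrite !gt_eqF.
Qed.

Let mabs f : measurable_fun setT f -> measurable_fun setT (fun w => `|f w|).
Proof. by move=> mf; exact: measurableT_comp. Qed.

(* The quadratic remainders of N equal steps add up to t ^ 2 L / N, which vanishes. *)
Lemma increment_L1 P g (L B t : R) : measurable_fun setT P -> measurable_fun setT g ->
  0 <= L -> (forall w s, `|P (cm_shift s w) - P w - s * g w| <= L * s ^+ 2) ->
  (forall s, `|s| <= 1 -> (\int[muW]_w `|g (cm_shift s w)|%:E <= B%:E)%E) ->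
  0 <= t <= 1 -> (\int[muW]_w `|P (cm_shift t w) - P w|%:E <= (t * B)%:E)%E.
Proof.
move=> mP mg L0 PL gB /andP[t0 t1].
have mPs s : measurable_fun setT (fun w => `|P (cm_shift s w) - P w|).
  by apply: mabs; apply: measurable_funB => //; exact: measurable_comp_shift.
have step (N q : nat) : (q <= N.+1)%N ->
    (\int[muW]_w `|P (cm_shift (q%:R * (t / N.+1%:R)) w) - P w|%:E <=
     (q%:R * (t / N.+1%:R * B + L * (t / N.+1%:R) ^+ 2))%:E)%E.
  set d := t / N.+1%:R; have d0 : 0 <= d by rewrite divr_ge0.
  elim: q => [_|q IH qN].
    rewrite !mul0r; under eq_integral do rewrite cm_shift0 subrr normr0.
    by rewrite integral0.
  have qd1 : `|q%:R * d| <= 1.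
    rewrite ger0_norm ?mulr_ge0// /d mulrA ler_pdivrMr// mul1r.
    by rewrite -[leRHS]mulr1 ler_pM// ler_nat ltnW.
  have mgs : measurable_fun setT (fun w => d * `|g (cm_shift (q%:R * d) w)|).
    by apply: measurable_funM => //; apply: mabs; exact: measurable_comp_shift.
  apply: (@le_trans _ _ (\int[muW]_w (`|P (cm_shift (q%:R * d) w) - P w| +
     (d * `|g (cm_shift (q%:R * d) w)| + L * d ^+ 2))%:E)%E).
    apply: ge0_le_integral_real => //.
    - move=> w; rewrite normr_ge0/=.
      have := PL (cm_shift (q%:R * d) w) d; rewrite cm_shiftD -{2}[d]mul1r -mulrDl natr1.
      set a := P (cm_shift (q.+1%:R * d) w); set b := P (cm_shift _ w); set c := g _ => h.
      rewrite (_ : a - P w = (b - P w) + (d * c + (a - b - d * c))); last by ring.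
      apply: le_trans (ler_normD _ _) _; rewrite lerD2l.
      by apply: le_trans (ler_normD _ _) _; rewrite normrM (ger0_norm d0) lerD2l.
    - by apply: measurable_funD => //; exact: measurable_funD.
  rewrite ge0_integralD_real//; last 2 first.
  - by move=> w; rewrite addr_ge0// mulr_ge0// sqr_ge0.
  - exact: measurable_funD.
  rewrite ge0_integralD_real//; last 2 first.
  - by move=> w; rewrite mulr_ge0.
  - by move=> w; rewrite mulr_ge0// sqr_ge0.
  rewrite ge0_integralZl_real//; last by apply: mabs; exact: measurable_comp_shift.
  rewrite (integral_prob_cst muW).
  rewrite -natr1 mulrDl mul1r EFinD; apply: leeD; first exact: IH (ltnW qN).
  rewrite EFinD leeD2r// [leRHS]EFinM; apply: lee_wpmul2l; first by rewrite lee_fin.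
  exact: gB.
apply/lee_addgt0Pr => eps e0.
pose N := Num.truncn (L / eps).
have LN : L / eps <= N.+1%:R by exact: ltW (truncnS_gt _).
have N0 : (N.+1%:R : R) != 0 by rewrite pnatr_eq0.
have := step N N.+1 (leqnn _); rewrite mulrC divfK//; move=> h; apply: le_trans h _.
rewrite -EFinD lee_fin.
have -> : N.+1%:R * (t / N.+1%:R * B + L * (t / N.+1%:R) ^+ 2) = t * B + L * t ^+ 2 / N.+1%:R.
  by field.
rewrite lerD2l ler_pdivrMr// [leRHS]mulrC; rewrite ler_pdivrMr// in LN.
by apply: le_trans LN; rewrite ler_piMr// expr_le1.
Qed.

(** Right-sided, with an error [o(t)] in mean only. This asks little enough to hold for [l], which
    is just integrable, and to be stable under the L^2 closure defining the gradient. *)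
Definition L1_derivative F g := forall eps : R, 0 < eps -> exists2 d : R, 0 < d &
  forall t, 0 < t <= d -> (\int[muW]_w `|F (cm_shift t w) - F w - t * g w|%:E <= (eps * t)%:E)%E.

(** The Taylor constants [L_ k] are not uniform in [k]. An index [m] with [g_ m] close to [g] is
    fixed first, and only [L_ m] enters the choice of [d]. Once [t] is known, [k] is taken so large
    that [F_ k - F] is small compared with [t]. Passing from [F_ m] to [F_ k] uses [increment_L1],
    whose bound does not involve [L_ k]. *)
Lemma L1_derivative_closed F g (F_ g_ : nat -> borel W -> R) (L_ : nat -> R) :
  measurable_fun setT F -> measurable_fun setT g ->
  (forall k, measurable_fun setT (F_ k)) -> (forall k, measurable_fun setT (g_ k)) ->
  (forall k, 0 <= L_ k) ->
  (forall k w s, `|F_ k (cm_shift s w) - F_ k w - s * g_ k w| <= L_ k * s ^+ 2) ->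
  (forall eps : R, 0 < eps -> exists N, forall k, (N <= k)%N ->
     (\int[muW]_w ((F_ k w - F w) ^+ 2)%:E <= eps%:E)%E) ->
  (forall eps : R, 0 < eps -> exists N, forall k, (N <= k)%N ->
     (\int[muW]_w ((g_ k w - g w) ^+ 2)%:E <= eps%:E)%E) ->
  L1_derivative F g.
Proof.
move=> mF mg mF_ mg_ L0 FL F_F g_g eps e0.
have e4 : 0 < eps / 4 by rewrite divr_gt0.
have [d0 d00 small] := shift_small e4.
(* A quarter, because [(a - b)^2 <= 2 a^2 + 2 b^2] must bring the distance between [g_ k] and [g_ m]
   below [d0]. *)
have [m gm] := g_g (d0 / 4) (divr_gt0 d00 (ltr0n _ 4)).
pose d := Num.min 1 (eps / (4 * (L_ m + 1))).
have Lm1 : 0 < L_ m + 1 by rewrite ltr_wpDl.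
exists d; first by rewrite lt_min ltr01 divr_gt0// mulr_gt0.
move=> t /andP[t0]; rewrite le_min => /andP[t1 tL].
have et8 : 0 < eps * t / 8 by rewrite divr_gt0// mulr_gt0.
have [d1 d10 small1] := shift_small et8.
have [N FN] := F_F d1 d10.
pose k := maxn m N.
have mfk : measurable_fun setT (fun w => F_ k w - F w) by exact: measurable_funB.
have a1 := small1 _ mfk (FN k (leq_maxr _ _)).
have mgmg : measurable_fun setT (fun w => g_ m w - g w) by exact: measurable_funB.
have sq (u : borel W -> R) w : 0 <= u w ^+ 2 by exact: sqr_ge0.
have d04 : d0 / 4 <= d0 by rewrite ler_pdivrMr// ler_peMr ?ler1n// ltW.
have a2 := small _ mgmg (le_trans (gm m (leqnn _)) (_ : (d0 / 4)%:E <= d0%:E)%E).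
have mgk : measurable_fun setT (fun w => g_ k w - g_ m w) by exact: measurable_funB.
have gkm : (\int[muW]_w ((g_ k w - g_ m w) ^+ 2)%:E <= d0%:E)%E.
  apply: (@le_trans _ _ (\int[muW]_w (2 * (g_ k w - g w) ^+ 2 + 2 * (g_ m w - g w) ^+ 2)%:E)%E).
    apply: ge0_le_integral_real.
    - move=> w; rewrite sqr_ge0/=; have := sqr_ge0 ((g_ k w - g w) + (g_ m w - g w)).
      rewrite !expr2; lra.
    - exact: measurable_funX.
    - by apply: measurable_funD; apply: measurable_funM => //; apply: measurable_funX => //;
        exact: measurable_funB.
  have mk2 : measurable_fun setT (fun w => (g_ k w - g w) ^+ 2).
    by apply: measurable_funX; exact: measurable_funB.
  have mm2 : measurable_fun setT (fun w => (g_ m w - g w) ^+ 2) by exact: measurable_funX.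
  rewrite ge0_integralD_real; last 4 first.
  - by move=> w; rewrite mulr_ge0// sqr_ge0.
  - by move=> w; rewrite mulr_ge0// sqr_ge0.
  - exact: measurable_funM.
  - exact: measurable_funM.
  rewrite !ge0_integralZl_real//; try by move=> w; exact: sqr_ge0.
  rewrite [leRHS](_ : _ = 2%:E * (d0 / 4)%:E + 2%:E * (d0 / 4)%:E)%E.
  by apply: leeD; apply: lee_wpmul2l => //; apply: gm; rewrite // leq_maxl.
  by rewrite -!EFinM -EFinD; congr EFin; field.
have a3 := small _ mgk gkm.
have PL w s : `|(F_ k (cm_shift s w) - F_ m (cm_shift s w)) - (F_ k w - F_ m w) - s * (g_ k w - g_ m w)|
    <= (L_ k + L_ m) * s ^+ 2.
  rewrite (_ : _ - _ = (F_ k (cm_shift s w) - F_ k w - s * g_ k w) -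
     (F_ m (cm_shift s w) - F_ m w - s * g_ m w)); last by ring.
  by rewrite mulrDl; apply: le_trans (ler_normB _ _) (lerD _ _); exact: FL.
have mP : measurable_fun setT (fun w => F_ k w - F_ m w) by exact: measurable_funB.
have t01 : 0 <= t <= 1 by rewrite ltW.
have a4 := increment_L1 mP mgk (addr_ge0 (L0 k) (L0 m)) PL a3 t01.
have ms (u : borel W -> R) : measurable_fun setT u -> measurable_fun setT (fun w => `|u (cm_shift t w)|).
  by move=> mu; apply: mabs; exact: measurable_comp_shift.
(* Five error terms: replacing [F] by [F_ k] at both ends costs [eps * t / 8] each; the increment of
   [F_ k - F_ m], the Taylor remainder of [F_ m] and the gap between [g_ m] and [g] cost
   [eps * t / 4] each. *)
pose b1 w := `|F_ k (cm_shift t w) - F (cm_shift t w)|.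
pose b2 w := `|F_ k w - F w|.
pose b3 w := `|(F_ k (cm_shift t w) - F_ m (cm_shift t w)) - (F_ k w - F_ m w)|.
pose b4 := L_ m * t ^+ 2.
pose b5 w := t * `|g_ m w - g w|.
have m1 : measurable_fun setT b1 by exact: (ms _ mfk).
have m2 : measurable_fun setT b2 by exact: mabs.
have m3 : measurable_fun setT b3.
  by apply: mabs; apply: measurable_funB => //; exact: (measurable_comp_shift t mP).
have m5 : measurable_fun setT b5 by apply: measurable_funM => //; exact: mabs.
have b50 w : 0 <= b5 w by rewrite mulr_ge0// ltW.
have b40 : 0 <= b4 by rewrite mulr_ge0// sqr_ge0.
apply: (@le_trans _ _ (\int[muW]_w (b1 w + (b2 w + (b3 w + (b4 + b5 w))))%:E)%E).
  apply: ge0_le_integral_real.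
  - move=> w; rewrite normr_ge0/= /b1 /b2 /b3 /b5.
    rewrite (_ : F (cm_shift t w) - F w - t * g w = - (F_ k (cm_shift t w) - F (cm_shift t w)) + ((F_ k w - F w)
      + (((F_ k (cm_shift t w) - F_ m (cm_shift t w)) - (F_ k w - F_ m w)) +
      ((F_ m (cm_shift t w) - F_ m w - t * g_ m w) + t * (g_ m w - g w))))); last by ring.
    apply: le_trans (ler_normD _ _) _; rewrite normrN lerD2l.
    apply: le_trans (ler_normD _ _) _; rewrite lerD2l.
    apply: le_trans (ler_normD _ _) _; rewrite lerD2l.
    apply: le_trans (ler_normD _ _) _; rewrite normrM (gtr0_norm t0) lerD2r.
    exact: FL.
  - apply: mabs; apply: measurable_funB; last exact: measurable_funM.
    by apply: measurable_funB => //; exact: measurable_comp_shift.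
  - by apply: measurable_funD => //; apply: measurable_funD => //; apply: measurable_funD => //;
      exact: measurable_funD.
have m45 : measurable_fun setT (fun w => b4 + b5 w) by exact: measurable_funD.
have m345 : measurable_fun setT (fun w => b3 w + (b4 + b5 w)) by exact: measurable_funD.
have m2345 : measurable_fun setT (fun w => b2 w + (b3 w + (b4 + b5 w))) by exact: measurable_funD.
have p45 w : 0 <= b4 + b5 w by rewrite addr_ge0.
have b10 w : 0 <= b1 w by exact: normr_ge0.
have b20 w : 0 <= b2 w by exact: normr_ge0.
have b30 w : 0 <= b3 w by exact: normr_ge0.
have p345 w : 0 <= b3 w + (b4 + b5 w) by rewrite addr_ge0.
rewrite (ge0_integralD_real muW b10 (fun w => addr_ge0 (b20 w) (p345 w)) m1 m2345).
rewrite (ge0_integralD_real muW b20 p345 m2 m345) (ge0_integralD_real muW b30 p45 m3 m45).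
rewrite (ge0_integralD_real muW (f := fun=> b4) (fun=> b40) b50 (measurable_cst _) m5).
rewrite (integral_prob_cst muW b4) (ge0_integralZl_real muW (ltW t0) (f := fun w => `|g_ m w - g w|)) //; last exact: mabs.
have c1 : (\int[muW]_w (b1 w)%:E <= (eps * t / 8)%:E)%E by apply: a1; rewrite gtr0_norm.
have c2 : (\int[muW]_w (b2 w)%:E <= (eps * t / 8)%:E)%E.
  have := a1 0; rewrite normr0 ler01 => /(_ isT).
  by under eq_integral do rewrite cm_shift0.
have c3 : (\int[muW]_w (b3 w)%:E <= (t * (eps / 4))%:E)%E by exact: a4.
have c4 : b4 <= t * (eps / 4).
  rewrite /b4 expr2 mulrCA ler_wpM2l ?(ltW t0)//.
  move: tL; rewrite ler_pdivlMr ?mulr_gt0// => tL.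
  by have := mulr_ge0 (ltW t0) (ltW Lm1); rewrite ler_pdivlMr//; lra.
have c5 : (t%:E * \int[muW]_w `|g_ m w - g w|%:E <= (t * (eps / 4))%:E)%E.
  rewrite EFinM; apply: lee_wpmul2l; first by rewrite lee_fin ltW.
  have := a2 _ 0; rewrite normr0 ler01 => /(_ _ isT) h.
  rewrite (_ : (\int[muW]_w _)%E = (\int[muW]_w `|g_ m (cm_shift 0 w) - g (cm_shift 0 w)|%:E)%E).
    by apply: h; rewrite lee_fin.
  by apply: eq_integral => w _; rewrite cm_shift0.
rewrite (_ : eps * t = eps * t / 8 + (eps * t / 8 + (t * (eps / 4) + (t * (eps / 4) + t * (eps / 4)))));
  last by field.
rewrite !EFinD; apply: (leeD c1); apply: (leeD c2); apply: (leeD c3); apply: leeD c5.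
by rewrite lee_fin.
Qed.

End shifts.

Section line_derivatives.
Variables (R : realType) (n : nat).
Implicit Types (f : 'rV[R]_n -> R) (a v : 'rV[R]_n).

Lemma is_derive_line f a v (s : R) : differentiable f (a + s *: v) ->
  is_derive s (1 : R) (fun r : R => f (a + r *: v)) ('D_v f (a + s *: v)).
Proof.
move=> df; have dv := diff_derivable df (v := v).
have E : (fun h : R => h^-1 *: (((fun r : R => f (a + r *: v)) \o shift s) (h *: (1 : R)) - f (a + s *: v))) =
    (fun h : R => h^-1 *: ((f \o shift (a + s *: v)) (h *: v) - f (a + s *: v))).
  apply/funext => h; have h1 : h *: (1 : R) = h by rewrite /GRing.scale /= mulr1.
  by congr (_ *: (f _ - _)); rewrite h1 /= scalerDl addrCA.
by apply: DeriveDef; rewrite /derivable /derive E.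
Qed.

Lemma derive_coord f a v : differentiable f a ->
  'D_v f a = \sum_(m < n) v 0 m * 'D_('e_m) f a.
Proof.
move=> df; rewrite deriveE// {1}(row_sum_delta v) linear_sum.
by apply: eq_bigr => m _; rewrite linearZ deriveE.
Qed.

Lemma line_lipschitz f (M : R) a v (s : R) : (forall x, differentiable f x) ->
  (forall x m, `|'D_('e_m) f x| <= M) ->
  `|f (a + s *: v) - f a| <= (\sum_(m < n) `|v 0 m|) * M * `|s|.
Proof.
move=> df fM; pose phi (r : R) := f (a + r *: v).
have dphi (r : R) : is_derive r (1 : R) phi ('D_v f (a + r *: v)) by exact: is_derive_line.
have bound x : `|'D_v f x| <= (\sum_(m < n) `|v 0 m|) * M.
  rewrite derive_coord// mulr_suml; apply: le_trans (ler_norm_sum _ _ _) _.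
  by apply: ler_sum => m _; rewrite normrM ler_wpM2l.
have -> : f a = phi 0 by rewrite /phi scale0r addr0.
rewrite -/(phi s); have [s0|s0|<-] := ltgtP 0 s.
- have [c _ ->] := MVT_global dphi s0.
  by rewrite subr0 normrM ler_wpM2r.
- have [c _ e] := MVT_global dphi s0.
  by rewrite -opprB e sub0r normrN normrM normrN ler_wpM2r.
- by rewrite subrr !normr0 mulr0.
Qed.

(** The bounded second partial derivatives make the directional derivative Lipschitz along the line,
    with a constant independent of the base point. *)
Lemma line_taylor f a v : smooth_bounded f -> exists2 L : R, 0 <= L &
  forall a s, `|f (a + s *: v) - f a - s * 'D_v f a| <= L * s ^+ 2.
Proof.
move=> /(_ 2%N)[_ [df Cf]].
have NE (m : 'I_n) : exists M : R, forall p x, `|'D_('e_p) (fun x => 'D_('e_m) f x) x| <= M.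
  have [_ [_ C1]] := Cf m.
  have [Np NpP] := choice (fun p => (C1 p).1).
  exists (\sum_(p < n) `|Np p|) => p x.
  apply: le_trans (NpP p x) (le_trans (ler_norm _) _).
  by rewrite (bigD1 p)//= lerDl sumr_ge0.
have [N NP] := choice NE.
pose V := \sum_(m < n) `|v 0 m|; have V0 : 0 <= V by exact: sumr_ge0.
pose L := \sum_(m < n) `|v 0 m| * (V * `|N m|).
have L0 : 0 <= L by apply: sumr_ge0 => m _; rewrite !mulr_ge0.
exists L => // b s.
have ddf m x : differentiable (fun x => 'D_('e_m) f x) x by have [_ [d _]] := Cf m; exact: d.
have DL r : `|'D_v f (b + r *: v) - 'D_v f b| <= L * `|r|.
  rewrite !derive_coord// -sumrB mulr_suml; apply: le_trans (ler_norm_sum _ _ _) _.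
  apply: ler_sum => m _; rewrite -mulrBr normrM -!mulrA ler_wpM2l// mulrA.
  apply: (line_lipschitz (f := fun x => 'D_('e_m) f x)) => // x p.
  by apply: le_trans (NP m p x) _; exact: ler_norm.
pose phi (r : R) := f (b + r *: v).
have dphi (r : R) : is_derive r (1 : R) phi ('D_v f (b + r *: v)) by exact: is_derive_line.
have -> : f b = phi 0 by rewrite /phi scale0r addr0.
rewrite -/(phi s).
have key c : `|c| <= `|s| -> `|('D_v f (b + c *: v) - 'D_v f b) * s| <= L * s ^+ 2.
  move=> cs; rewrite normrM -(@real_normK _ s) ?num_real// expr2 mulrA ler_wpM2r//.
  by apply: le_trans (DL c) _; rewrite ler_wpM2l.
have [s0|s0|<-] := ltgtP 0 s.
- have [c /andP[c0 cs] ->] := MVT_global dphi s0.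
  by rewrite subr0 [s * _]mulrC -mulrBl; apply: key; rewrite !gtr0_norm// ltW.
- have [c /andP[cs c0] e] := MVT_global dphi s0.
  rewrite -[phi s - phi 0]opprB e sub0r mulrN opprK [s * _]mulrC -mulrBl.
  by apply: key; rewrite !ltr0_norm// lerN2 ltW.
- by rewrite subrr mul0r subrr normr0 expr0n mulr0.
Qed.

End line_derivatives.

Section malliavin_directional.
Variables (R : realType) (W H : completeNormedModType R).
Variables (ip : {dot H for (@idfun R)}) (i : {linear H -> W}) (j : dual W -> H).
Variables (muW : probability (borel W) R).
Hypothesis Haws : abstract_wiener_space ip i j muW.
Variable e : dual W.
Implicit Types (w : borel W) (F : W -> R) (G : W -> H).

Notation cm_shift := (cm_shift i j e).

Lemma cylindrical_taylor F G : cylindrical_gradient j F G ->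
  continuous F /\ exists2 L : R, 0 <= L &
    forall w (s : R), `|F (cm_shift s w) - F w - s * ip (G w) (j e)| <= L * s ^+ 2.
Proof.
move=> [n [f [u [sf FE GE]]]].
pose delta (w : W) : 'rV[R]_n := \row_m u m w.
have df x : differentiable f x by have [_ []] := sf 1%N.
split.
  have cd : continuous delta.
    have -> : delta = \sum_(m < n) (fun w => u m w *: 'e_m).
      apply/funext => w; rewrite fct_sumE [LHS]row_sum_delta.
      by apply: eq_bigr => m _; rewrite mxE.
    apply: (big_ind (fun g : W -> 'rV[R]_n => continuous g)).
    - by move=> x; exact: cvg_cst.
    - by move=> g1 g2 c1 c2 x; exact: cvgD (c1 x) (c2 x).
    - by move=> m _ x; apply: cvgZr_tmp; exact: (@dual_continuous _ _ (u m) x).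
  move=> w; rewrite (_ : F = f \o delta); last by apply/funext => x; exact: FE.
  by apply: continuous_comp; [exact: cd|exact: differentiable_continuous].
have [L L0 fL] := line_taylor 0 (delta (i (j e))) sf.
exists L => // w s; rewrite !FE.
have -> : \row_m u m (cm_shift s w) = delta w + s *: delta (i (j e)).
  by apply/rowP => m; rewrite !mxE /cm_shift linearD linearZ.
suff -> : ip (G w) (j e) = 'D_(delta (i (j e))) f (delta w) by exact: fL.
have ip0 : ip 0 (j e) = 0 by rewrite -[X in ip X _](scale0r 0) ipZl mul0r.
rewrite derive_coord// GE (big_morph (fun h => ip h (j e)) (fun a b => ipDl ip a b (j e)) ip0).
apply: eq_bigr => m _; rewrite ipZl (aws_riesz Haws) mxE mulrC.
by [].
Qed.

End malliavin_directional.

Lemma cvg0_eventually_le (R : realType) (u : nat -> \bar R) (eps : R) :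
  u n @[n --> \oo] --> 0%E -> 0 < eps -> exists N, forall n, (N <= n)%N -> (u n <= eps%:E)%E.
Proof.
move=> /fine_cvgP[[N1 _ fin1] /cvgrPdist_le h] e0.
have [N2 _ h2] := h _ e0.
exists (maxn N1 N2) => n; rewrite geq_max => /andP[n1 n2].
rewrite -(fineK (fin1 n n1)) lee_fin.
by apply: le_trans (h2 n n2); rewrite sub0r normrN ler_norm.
Qed.

(* No measurability: the integral of a nonnegative function is a supremum over simple functions below it. *)
Lemma ge0_le_integral_outer d (T : measurableType d) (R : realType)
    (mu : {measure set T -> \bar R}) (f g : T -> R) :
  (forall x, 0 <= f x <= g x) -> (\int[mu]_x (f x)%:E <= \int[mu]_x (g x)%:E)%E.
Proof.
move=> fg; rewrite !ge0_integralTE.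
- apply: le_ereal_sup => _ [h hf <-]; exists h => // x.
  by apply: le_trans (hf x) _; rewrite lee_fin; case/andP: (fg x).
- by move=> x; rewrite lee_fin; case/andP: (fg x); exact: le_trans.
- by move=> x; rewrite lee_fin; case/andP: (fg x).
Qed.

(** From [|expR v - 1 - v| <= v^2 expR |v|] and [u^2 <= 4 expR |u|]. Apart from the factor [t^2] the
    bound is free of [t], and it is integrable thanks to the exponential moments of the signal. *)
Lemma expR_remainder_le (R : realType) (t u : R) : `|t| <= 1 ->
  `|expR (t * u) - 1 - t * u| <= 4 * t ^+ 2 * (expR (2 * u) + expR (- 2 * u)).
Proof.
move=> t1; set v := t * u.
have h0 : 0 <= expR v - 1 - v by have := expR_ge1Dx v; lra.
rewrite ger0_norm//.
have a0 : 0 <= `|v| by [].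
have h1 : expR v - 1 - v <= v ^+ 2 * expR `|v|.
  have hv : expR v - 1 <= v * expR v.
    have := ler_wpM2l (expR_ge0 v) (expR_ge1Dx (- v)).
    by rewrite mulrDr -expRD subrr expR0; lra.
  have hw : 1 - expR v <= - v by have := expR_ge1Dx v; lra.
  have e1 : 1 <= expR `|v| by rewrite -expR0 ler_expR.
  have [v0|v0] := leP 0 v.
    rewrite ger0_norm// expr2 -mulrA.
    apply: (@le_trans _ _ (v * (expR v - 1))); first by lra.
    by rewrite ler_wpM2l.
  apply: (@le_trans _ _ (- v * (1 - expR v))); first by lra.
  apply: (@le_trans _ _ (- v * - v)); first by rewrite ler_wpM2l// oppr_ge0 ltW.
  by rewrite mulrNN -expr2 ler_peMr ?sqr_ge0.
have vu : `|v| <= `|u| by rewrite normrM ler_piMl.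
have u4 : u ^+ 2 <= 4 * expR `|u|.
  have h := expR_ge1Dx (`|u| / 2).
  have h' : `|u| / 2 <= expR (`|u| / 2) by lra.
  have : (`|u| / 2) * (`|u| / 2) <= expR (`|u| / 2) * expR (`|u| / 2) by rewrite ler_pM// divr_ge0.
  rewrite -expRD -splitr -(@real_normK _ u) ?num_real// expr2 => h2.
  have -> : `|u| * `|u| = 4 * (`|u| / 2 * (`|u| / 2)) by field.
  by rewrite ler_wpM2l.
have u2 : expR (2 * `|u|) <= expR (2 * u) + expR (- 2 * u).
  have [u0|u0] := leP 0 u; first by rewrite ger0_norm// lerDl expR_ge0.
  by rewrite ltr0_norm// mulrN mulNr lerDr expR_ge0.
apply: le_trans h1 _; rewrite /v exprMn.
apply: (@le_trans _ _ (t ^+ 2 * (u ^+ 2 * expR `|u|))).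
  by rewrite -mulrA ler_wpM2l ?sqr_ge0// ler_wpM2l ?sqr_ge0// ler_expR.
rewrite [leRHS](_ : _ = t ^+ 2 * (4 * (expR (2 * u) + expR (- 2 * u)))); last by ring.
rewrite ler_wpM2l ?sqr_ge0//.
apply: le_trans (ler_wpM2r (expR_ge0 _) u4) _.
rewrite -mulrA ler_wpM2l// -expRD; apply: le_trans u2.
by rewrite ler_expR; lra.
Qed.

Lemma set_integral_comb d (T : measurableType d) (R : realType) (mu : {measure set T -> \bar R})
    (A : set T) (a b c : T -> R) (t : R) : measurable A ->
  mu.-integrable setT (EFin \o a) -> mu.-integrable setT (EFin \o b) ->
  mu.-integrable setT (EFin \o c) ->
  (\int[mu]_(x in A) (a x - b x - t * c x)%:E =
   \int[mu]_(x in A) (a x)%:E - \int[mu]_(x in A) (b x)%:E - t%:E * \int[mu]_(x in A) (c x)%:E)%E.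
Proof.
move=> mA ia ib ic.
have iA (f : T -> R) : mu.-integrable setT (EFin \o f) -> mu.-integrable A (EFin \o f).
  by move=> h; apply: integrableS h.
etransitivity.
  exact: (integralB mA (iA _ (integrable_EFinB ia ib)) (iA _ (integrable_EFinZ t ic))).
congr (_ - _)%E; last by rewrite -integralZl//; exact: iA.
exact: (integralB mA (iA _ ia) (iA _ ib)).
Qed.

Section densities.
Variables (R : realType) (W H : completeNormedModType R).
Variables (ip : {dot H for (@idfun R)}) (i : {linear H -> W}) (j : dual W -> H).
Variables (muW : probability (borel W) R) (muX : probability (borel H) R) (rho : R).
Hypothesis Haws : abstract_wiener_space ip i j muW.
Variable e : dual W.

Notation Q := (prod_prob muX muW).
Notation Y := (channel i rho).
Notation signal := (signal ip j rho).
Notation cm_shift := (cm_shift i j e).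
Notation cm_density := (cm_density j e).

Lemma L2_gradient_L1_derivative (F : W -> R) (G : W -> H) : L2_gradient j muW F G ->
  L1_derivative i j muW e F (fun w => ip (G w) (j e)).
Proof.
move=> [mF mG [F_ [G_ [FG FF GG]]]].
have hT k := cylindrical_taylor Haws e (FG k).
have [L_ LP] := choice (fun k => let: conj _ (ex_intro2 L a b) := hT k in ex_intro (fun L : R => 0 <= L /\
  forall w (s : R), `|F_ k (cm_shift s w) - F_ k w - s * ip (G_ k w) (j e)| <= L * s ^+ 2) L (conj a b)).
have mF_ k : measurable_fun setT (F_ k : borel W -> R).
  by apply: continuous_borel_measurable; exact: (hT k).1.
(* Obtained as a pointwise limit of difference quotients of the continuous function [F_ k]. *)
have m_g k : measurable_fun setT (fun w : borel W => ip (G_ k w) (j e) : R).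
  apply: (@measurable_fun_cvg _ _ _ _ (fun n (w : borel W) => n.+1%:R * (F_ k (cm_shift n.+1%:R^-1 w) - F_ k w))).
    move=> n; apply: measurable_funM => //; apply: measurable_funB => //.
    exact: (measurable_comp_shift Haws e _ (mF_ k)).
  move=> w _; apply/cvgrPdist_le => eps e0; near=> n.
  have n0 : n.+1%:R != 0 :> R by rewrite pnatr_eq0.
  have fe (N a b p : R) : N != 0 -> N * (a - b) - p = N * (a - b - N^-1 * p).
    by move=> N0; field.
  have fe2 (N L : R) : N != 0 -> N * (L * N^-1 ^+ 2) = L / N by move=> N0; field.
  rewrite distrC fe// normrM ger0_norm//.
  apply: le_trans (ler_wpM2l _ ((LP k).2 w _)) _ => //.
  rewrite fe2//.
  rewrite ler_pdivrMr//; have : L_ k / eps <= n.+1%:R; last by rewrite ler_pdivrMr// mulrC.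
  apply: le_trans (ltW (truncnS_gt _)) _; rewrite ler_nat ltnS.
  by near: n; exact: nbhs_infty_ge.
apply: (L1_derivative_closed Haws (F_ := F_) (g_ := fun k w => ip (G_ k w) (j e)) (L_ := L_)) => //.
- by apply: (measurableT_comp (measurable_ip Haws (j e))).
- by move=> k; exact: (LP k).1.
- by move=> k w s; exact: (LP k).2.
- move=> eps e0; have [N NP] := cvg0_eventually_le FF e0.
  exists N => k Nk; apply: le_trans (NP k Nk).
  by under [X in (_ <= X)%E]eq_integral do rewrite real_normK ?num_real//.
- move=> eps e0; have a0 : 0 < `|j e| ^+ 2 + 1 by rewrite ltr_wpDl ?sqr_ge0.
  have [N NP] := cvg0_eventually_le GG (divr_gt0 e0 a0).
  exists N => k Nk.
  set c := `|j e| ^+ 2 + 1 in a0 *.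
  have mp2 : measurable_fun setT (fun w : borel W => (ip (G_ k w) (j e) - ip (G w) (j e)) ^+ 2).
    by apply: measurable_funX; apply: measurable_funB => //; exact: (measurableT_comp (measurable_ip Haws (j e))).
  have h : (\int[muW]_w (c^-1 * (ip (G_ k w) (j e) - ip (G w) (j e)) ^+ 2)%:E <= (eps / c)%:E)%E.
    (* Measurability has been established for the scalar products with [j e] only, not for the norm
       of [G_ k w - G w], hence a comparison that asks for none. *)
    apply: le_trans (NP k Nk); apply: ge0_le_integral_outer => w.
    rewrite mulr_ge0 ?sqr_ge0 ?invr_ge0 ?(ltW a0)//= mulrC ler_pdivrMr//.
    have -> : ip (G_ k w) (j e) - ip (G w) (j e) = ip (G_ k w - G w) (j e) by rewrite ipDl ipNl.
    apply: le_trans (_ : _ <= `|G_ k w - G w| ^+ 2 * `|j e| ^+ 2) _.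
      rewrite -exprMn -[leLHS]real_normK ?num_real// lerXn2r ?nnegrE ?mulr_ge0//.
      exact: (ip_cauchy Haws).
    by rewrite ler_wpM2l ?sqr_ge0// lerDl.
  move: h; rewrite ge0_integralZl_real ?invr_ge0 ?(ltW a0)//; last by move=> w; exact: sqr_ge0.
  by rewrite mulrC EFinM lee_pmul2l// lte_fin invr_gt0.
Unshelve. all: by end_near. Qed.

End densities.

(** * The derivative of the likelihood ratio *)

Section density_derivative.
Variables (R : realType) (W H : completeNormedModType R).
Variables (ip : {dot H for (@idfun R)}) (i : {linear H -> W}) (j : dual W -> H).
Variables (muW : probability (borel W) R) (muX : probability (borel H) R) (rho : R).
Hypothesis Haws : abstract_wiener_space ip i j muW.
Variable e : dual W.

Notation Q := (prod_prob muX muW).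
Notation Y := (channel i rho).
Notation u := (signal ip j rho e).
Notation cm_shift := (cm_shift i j e).
Notation cm_density := (cm_density j e).

Hypothesis signal_exp : forall t : R, muX.-integrable setT (EFin \o (fun x => expR (t * u x))).
Variable l : borel W -> R.
Hypotheses (l0 : forall w, 0 <= l w) (il : muW.-integrable setT (EFin \o l)).
Hypothesis density : forall A : set (borel W), measurable A ->
  Q (Y @^-1` A) = (\int[muW]_(w in A) (l w)%:E)%E.

Let ml : measurable_fun setT l := integrable_measurable il.

Lemma signal_integrable : muX.-integrable setT (EFin \o u).
Proof.
apply: (integrable_real_le (g := fun x => expR (1 * u x) + expR (-1 * u x))).
- exact: (measurable_signal rho Haws).
- by move=> x; rewrite mul1r mulN1r; exact: normr_le_expR.
- exact: integrable_EFinD.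
Qed.

Let mY : measurable_fun setT Y := measurable_channel (muW := muW) rho Haws.

(* Cameron-Martin is applied twice: conditionally on the input, and to the translate of l. *)
Lemma tilted_density t (A : set (borel W)) : measurable A ->
  (\int[Q]_(z in Y @^-1` A) (expR (t * u z.1))%:E = \int[muW]_(w in A) (l (cm_shift t w))%:E)%E.
Proof.
move=> mA; pose f w := \1_A (cm_shift (- t) w) * cm_density t w.
have mI : measurable_fun setT (\1_A : borel W -> R) by exact: measurable_indic.
have mf : measurable_fun setT f.
  apply: measurable_funM; last exact: measurable_cm_density.
  exact: (measurable_comp_shift Haws e _ mI).
have f0 w : 0 <= f w by rewrite mulr_ge0 ?cm_density_ge0// indicE.
have shN w : cm_shift (- t) (cm_shift t w) = w by rewrite cm_shiftD subrr cm_shift0.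
rewrite -(integral_indicM muW _ mA) -(integral_indicM Q _ (measurable_preimage mY mA)).
transitivity (\int[Q]_z (f (Y z))%:E)%E; last first.
  have Qoo : (Q setT < +oo)%E by rewrite ltey_eq fin_num_measure.
  rewrite (ge0_transfer mY il Qoo l0 mf f0 density).
  have -> : (\int[muW]_w (\1_A w * l (cm_shift t w))%:E =
      \int[muW]_w (\1_A (cm_shift (- t) (cm_shift t w)) * l (cm_shift t w))%:E)%E.
    by apply: eq_integral => w _; rewrite shN.
  rewrite (cameron_martin_scale Haws e t (F := fun w => \1_A (cm_shift (- t) w) * l w)).
  - by apply: eq_integral => w _; rewrite /f mulrAC.
  - by apply: measurable_funM => //; exact: (measurable_comp_shift Haws e _ mI).
  - by move=> w; rewrite mulr_ge0// indicE.
have mu1 : measurable_fun setT (fun z : borel H * borel W => expR (t * u z.1)).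
  exact: integrable_measurable (integrable_fst muW (signal_exp t)).
rewrite prod_prob_ge0; last 2 first.
- by apply: measurable_funM => //; apply: measurable_indic; exact: measurable_preimage.
- by move=> z; rewrite mulr_ge0 ?expR_ge0// indicE.
rewrite prod_prob_ge0; last 2 first.
- exact: measurableT_comp.
- by move=> z; exact: f0.
apply: eq_integral => x _ /=.
pose G w := \1_A (cm_shift (- t) (Y (x, w))) * expR (t * u x).
have mYx : measurable_fun setT (fun w => Y (x, w)).
  by apply: (measurableT_comp mY); exact: measurable_fun_pair.
have mG : measurable_fun setT G.
  apply: measurable_funM => //.
  by apply: (measurableT_comp (measurable_comp_shift Haws e (- t) mI)).
have G0 w : 0 <= G w by rewrite mulr_ge0 ?expR_ge0// indicE.
have YS w : Y (x, cm_shift t w) = cm_shift t (Y (x, w)).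
  by rewrite /channel /cm_shift /= addrA.
transitivity (\int[muW]_w (G (cm_shift t w))%:E)%E.
  by apply: eq_integral => w _; rewrite /G YS shN !indicE.
rewrite (cameron_martin_scale Haws e t mG G0); apply: eq_integral => w _.
rewrite /f /G -mulrA; congr (_ * _)%:E; rewrite /cm_density -expRD; congr expR.
by rewrite (dual_channel rho Haws) /= mulrDr addrA.
Qed.

Lemma exists_density_derivative : exists2 m : borel W -> R,
  muW.-integrable setT (EFin \o m) &
  forall A, measurable A -> (\int[Q]_(z in Y @^-1` A) (u z.1)%:E = \int[muW]_(w in A) (m w)%:E)%E.
Proof.
have ac A : measurable A -> muW A = 0%E -> Q (Y @^-1` A) = 0%E.
  move=> mA muA; rewrite density//; apply: null_set_integral => //.
  by apply/measurable_EFinP; exact: measurable_funTS.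
have [m im mE] := exists_transfer_density mY (integrable_fst muW signal_integrable) ac.
by exists m.
Qed.

Variable m : borel W -> R.
Hypothesis im : muW.-integrable setT (EFin \o m).
Hypothesis score : forall A, measurable A ->
  (\int[Q]_(z in Y @^-1` A) (u z.1)%:E = \int[muW]_(w in A) (m w)%:E)%E.

(** By [tilted_density], [l (w + t h) - l w - t m w] is the density of the image under [Y] of
    [expR (t u) - 1 - t u]. Taking images contracts L^1 norms, so a second-order bound on the input
    side yields an error of order [t^2]. *)
Lemma density_L1_derivative : L1_derivative i j muW e l m.
Proof.
pose k t (z : borel H * borel W) := expR (t * u z.1) - 1 - t * u z.1.
pose K (z : borel H * borel W) := expR (2 * u z.1) + expR (- 2 * u z.1).
have iexp t := integrable_fst muW (signal_exp t).
have iu := integrable_fst muW signal_integrable.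
have i1 := bm_integrable Q (bm_cst _ (1 : R)).
have ik t : Q.-integrable setT (EFin \o k t).
  exact: integrable_EFinB (integrable_EFinB (iexp t) i1) (integrable_EFinZ t iu).
have iK : Q.-integrable setT (EFin \o K) by exact: integrable_EFinD.
have ils t : muW.-integrable setT (EFin \o (fun w => l (cm_shift t w))).
  apply: ge0_integrable => //; first exact: (measurable_comp_shift Haws e _ ml).
  rewrite -(tilted_density t measurableT) preimage_setT.
  by have := integrable_lty measurableT (iexp t).
have K0 z : 0 <= K z by rewrite addr_ge0// expR_ge0.
pose C := \int[Q]_z K z; have C0 : 0 <= C by exact: Rintegral_ge0.
have CE : (C%:E = \int[Q]_z (K z)%:E)%E := EFin_Rintegral iK.
have main t : `|t| <= 1 ->
    (\int[muW]_w `|l (cm_shift t w) - l w - t * m w|%:E <= (4 * t ^+ 2 * C)%:E)%E.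
  move=> t1.
  have iD : muW.-integrable setT (EFin \o (fun w => l (cm_shift t w) - l w - t * m w)).
    exact: integrable_EFinB (integrable_EFinB (ils t) il) (integrable_EFinZ t im).
  apply: le_trans (transfer_L1_le mY (ik t) iD _) _.
    move=> A mA; have mYA := measurable_preimage mY mA.
    rewrite (set_integral_comb t mYA (iexp t) i1 iu) (set_integral_comb t mA (ils t) il im).
    rewrite tilted_density// score//; congr (_ - _ - _)%E.
    by rewrite integral_cst// mul1e; exact: density.
  rewrite EFinM CE -ge0_integralZl_real//; last 2 first.
  - by rewrite mulr_ge0// sqr_ge0.
  - exact: integrable_measurable iK.
  apply: ge0_le_integral_real.
  - by move=> z; rewrite normr_ge0/= expR_remainder_le.
  - by apply: measurableT_comp => //; exact: integrable_measurable (ik t).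
  - by apply: measurable_funM => //; exact: integrable_measurable iK.
move=> eps e0; have C1 : 0 < 4 * (C + 1) by rewrite mulr_gt0// ltr_wpDl.
exists (Num.min 1 (eps / (4 * (C + 1)))); first by rewrite lt_min ltr01 divr_gt0.
move=> t /andP[t0]; rewrite le_min => /andP[t1 te].
apply: le_trans (main t _) _; first by rewrite gtr0_norm.
rewrite lee_fin; rewrite ler_pdivlMr// in te.
rewrite (_ : 4 * t ^+ 2 * C = t * (4 * C) * t); last by ring.
rewrite ler_wpM2r ?(ltW t0)//; apply: le_trans te; rewrite ler_wpM2l ?(ltW t0)//; lra.
Qed.

End density_derivative.

(** Convergence to 0 in mean forces the lower limit to vanish almost everywhere: by Markov's
    inequality, the set where all late terms exceed a fixed level is null. *)
Lemma ae_recurrent_small d (T : measurableType d) (R : realType) (mu : {measure set T -> \bar R})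
    (X : nat -> T -> R) :
  (forall n, measurable_fun setT (X n)) -> (forall n x, 0 <= X n x) ->
  (forall eps : R, 0 < eps -> exists N, forall n, (N <= n)%N -> (\int[mu]_x (X n x)%:E <= eps%:E)%E) ->
  {ae mu, forall x, forall eps : R, 0 < eps -> forall N, exists2 n, (N <= n)%N & X n x < eps}.
Proof.
move=> mX X0 Xs.
suff : {ae mu, forall x, forall p N, exists2 n, (N <= n)%N & X n x < p.+1%:R^-1}.
  apply: filterS => x h eps e0 N.
  have [p _ hp] := near_infty_natSinv_lt (PosNum e0).
  have [n Nn hn] := h p N; exists n => //.
  exact: lt_trans hn (hp p (leqnn _)).
apply: ae_foralln => p; apply: ae_foralln => N.
pose B := \bigcap_(n in [set n | (N <= n)%N]) [set x | p.+1%:R^-1 <= X n x].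
have p0 : 0 < (p.+1%:R : R)^-1 by rewrite invr_gt0.
have mB : measurable B.
  apply: bigcap_measurableType => n _.
  rewrite (_ : [set x | _] = ~` [set x | X n x < p.+1%:R^-1]).
    by apply: measurableC; exact: measurable_lt (mX n) (measurable_cst _).
  by apply/seteqP; split => x /=; rewrite leNgt => /negP.
have B0 : mu B = 0%E.
  apply/eqP; rewrite eq_le measure_ge0 andbT; apply/lee_addgt0Pr => eps e0; rewrite add0e.
  have [M MP] := Xs (eps * p.+1%:R^-1) (mulr_gt0 e0 p0).
  have := MP (maxn M N) (leq_maxl _ _); set n := maxn M N.
  have h : (\int[mu]_x (p.+1%:R^-1 * \1_B x)%:E <= \int[mu]_x (X n x)%:E)%E.
    apply: ge0_le_integral_real => //.
      move=> x; rewrite mulr_ge0 ?(ltW p0) ?indicE//=.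
      have [xB|] := boolP (x \in B); last by rewrite mulr0.
      by rewrite mulr1; move/set_mem: xB; apply; exact: leq_maxr.
    by apply: measurable_funM => //; exact: measurable_indic.
  move=> h2; have := le_trans h h2.
  rewrite (ge0_integralZl_real mu (ltW p0) (f := \1_B)); [|by move=> x; rewrite indicE|exact: measurable_indic].
  by rewrite integral_indic// setIT mulrC EFinM lee_pmul2l// lte_fin.
exists B; split => // x /= nx n /= Nn; rewrite leNgt; apply/negP => hx.
by apply: nx; exists n.
Qed.

(** Only infinitely many indices are under control. Along them the slopes [s] of [b] stay bounded,
    so [b n] approaches [a], and differentiability of [phi] turns the slope of [phi] into
    [dphi * s]. *)
Lemma slope_limit (R : realType) (phi : R -> R) (a dphi m g : R) (t b : nat -> R) :
  is_derive a (1 : R) phi dphi -> (forall n, 0 < t n) -> t n @[n --> \oo] --> 0 ->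
  (forall eps : R, 0 < eps -> forall N, exists n, [/\ (N <= n)%N, `|(b n - a) / t n - m| < eps &
     `|(phi (b n) - phi a) / t n - g| < eps]) -> g = dphi * m.
Proof.
move=> dp t0 tcvg h.
apply/eqP; rewrite -subr_eq0 -normr_eq0; apply/eqP/le_anti; rewrite normr_ge0 andbT.
apply/ler_addgt0Pr => eta eta0; rewrite add0r.
(* The three errors are [eps], [eps * (|m| + 1)] and [|dphi| * eps], in total [eps * D]. *)
pose D := `|dphi| + `|m| + 2; have D0 : 0 < D by rewrite ltr_wpDl// addr_ge0.
pose eps := Num.min 1 (eta / D).
have e0 : 0 < eps by rewrite lt_min ltr01 divr_gt0.
have e1 : eps <= 1 by rewrite ge_min lexx.
have eD : eps * D <= eta by rewrite -ler_pdivlMr// ge_min lexx orbT.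
have [r r0 hr] : exists2 r : R, 0 < r & forall x, `|x - a| < r ->
    `|phi x - phi a - dphi * (x - a)| <= eps * `|x - a|.
  have [dv dE] := dp.
  have : h^-1 *: ((phi \o shift a) (h *: (1 : R)) - phi a) @[h --> 0^'] --> dphi by rewrite -dE.
  move/cvgrPdist_le => /(_ _ e0) /nbhs_ballP [r /= r0 hr].
  exists r => // x xr; have [->|xa] := eqVneq x a.
    by rewrite !subrr mulr0 subrr normr0 mulr0.
  have xa0 : x - a != 0 by rewrite subr_eq0.
  have := hr (x - a); rewrite -ball_normE /= sub0r normrN => /(_ xr xa0).
  rewrite /GRing.scale /= mulr1 subrK => hx.
  rewrite -ler_pdivrMr ?normr_gt0// -normfV -normrM.
  rewrite (_ : (_ - _) / _ = - (dphi - (x - a)^-1 * (phi x - phi a))) ?normrN//.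
  by field.
have [N _ hN] : \forall n \near \oo, t n * (`|m| + 1) < r.
  have m1 : 0 < `|m| + 1 by rewrite ltr_wpDl.
  have := tcvg => /cvgrPdist_lt /(_ _ (divr_gt0 r0 m1)).
  apply: filterS => n; rewrite sub0r normrN gtr0_norm//.
  by rewrite ltr_pdivlMr.
have [n [Nn h1 h2]] := h eps e0 N.
have tn := t0 n.
set s := (b n - a) / t n in h1 *; set q := (phi (b n) - phi a) / t n in h2 *.
have bE : b n - a = s * t n by rewrite /s divfK ?gt_eqF.
have sm : `|s| <= `|m| + eps.
  rewrite -(subrK m s); apply: le_trans (ler_normD _ _) _; rewrite addrC lerD2l; exact: ltW.
have h3 : `|q - dphi * s| <= eps * (`|m| + 1).
  have br : `|b n - a| < r.
    rewrite bE normrM (gtr0_norm tn) mulrC; apply: le_lt_trans (hN n Nn).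
    by rewrite ler_wpM2l ?(ltW tn)//; lra.
  have -> : q - dphi * s = (phi (b n) - phi a - dphi * (s * t n)) / t n.
    by rewrite /q; field; rewrite gt_eqF.
  rewrite normrM normfV (gtr0_norm tn) ler_pdivrMr// -bE.
  apply: le_trans (hr _ br) _; rewrite bE normrM (gtr0_norm tn) mulrA.
  by rewrite ler_wpM2r ?(ltW tn)// ler_wpM2l ?(ltW e0)//; lra.
rewrite (_ : g - dphi * m = - (q - g) + ((q - dphi * s) + dphi * (s - m))); last by ring.
apply: le_trans (ler_normD _ _) _; rewrite normrN.
have h4 : `|dphi * (s - m)| <= `|dphi| * eps by rewrite normrM ler_wpM2l// ltW.
apply: le_trans (lerD (ltW h2) (le_trans (ler_normD _ _) (lerD h3 h4))) _.
apply: le_trans eD; rewrite /D; lra.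
Qed.

(** * Continuity of translation on Borel sets *)

Section translation_of_sets.
Variables (R : realType) (W H : completeNormedModType R).
Variables (ip : {dot H for (@idfun R)}) (i : {linear H -> W}) (j : dual W -> H).
Variables (muW : probability (borel W) R).
Hypothesis Haws : abstract_wiener_space ip i j muW.
Variable e : dual W.
Implicit Types (w : borel W) (A : set (borel W)).

Notation cm_shift := (cm_shift i j e).
Notation cm_density := (cm_density j e).

Let t (n : nat) : R := n.+1%:R^-1.

Let t01 n : 0 < t n <= 1.
Proof. by rewrite /t invr_gt0 ltr0Sn/= invf_le1// ler1n. Qed.

Let tcvg : t n @[n --> \oo] --> 0.
Proof. exact: cvg_harmonic. Qed.

Definition exit A n w : R := \1_A w * (1 - \1_A (cm_shift (t n) w)).

Let mS n A : measurable A -> measurable_fun setT (fun w => \1_A (cm_shift (t n) w) : R).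
Proof. by move=> mA; apply: (measurable_comp_shift Haws e _ (measurable_indic mA)). Qed.

Let bmS n A : measurable A -> bounded_measurable (fun w => \1_A (cm_shift (t n) w) : R).
Proof.
move=> mA; split; first exact: mS.
by exists 1 => w; rewrite indicE; case: (_ \in _); rewrite ?normr1 ?normr0.
Qed.

Lemma exit_ge0 A n w : 0 <= exit A n w.
Proof. by rewrite /exit !indicE; do 2 case: (_ \in _); rewrite ?subrr ?subr0 ?mulr0 ?mul0r ?mulr1. Qed.

Lemma exit_le1 A n w : `|exit A n w| <= 1.
Proof.
rewrite ger0_norm ?exit_ge0// /exit !indicE.
by do 2 case: (_ \in _); rewrite ?subrr ?subr0 ?mulr0 ?mul0r ?mulr1.
Qed.

Lemma bm_exit A n : measurable A -> bounded_measurable (exit A n).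
Proof. by move=> mA; apply: bmM (bm_indic _ mA) (bmB (bm_cst _ 1) (bmS n mA)). Qed.

(** Cameron-Martin moves the translation from the indicator to the Gaussian density, which is
    continuous in the shift and dominated. *)
Lemma indic_shift_cvg A : measurable A ->
  \int[muW]_w (\1_A (cm_shift (t n) w) : R) @[n --> \oo] --> \int[muW]_w (\1_A w : R).
Proof.
move=> mA; have mI : measurable_fun setT (\1_A : borel W -> R) by exact: measurable_indic.
have I0 w : 0 <= \1_A w :> R by rewrite indicE.
have iD s : muW.-integrable setT (EFin \o cm_density s).
  apply: ge0_integrable; [exact: measurable_cm_density|exact: cm_density_ge0|].
  have := cameron_martin_scale Haws e s (measurable_cst (1 : R)) (fun=> ler01).
  under [X in _ = X -> _]eq_integral do rewrite mul1r.
  by move=> <-; rewrite [X in (X < _)%E](integral_prob_cst muW 1) ltry.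
have E n : \int[muW]_w (\1_A (cm_shift (t n) w) : R) = \int[muW]_w (\1_A w * cm_density (t n) w).
  apply: EFin_inj; rewrite (EFin_Rintegral (bm_integrable muW (bmS n mA))).
  rewrite (EFin_Rintegral (bm_integrableM (bm_indic _ mA) (iD (t n)))).
  exact: (cameron_martin_scale Haws e (t n) mI I0).
under eq_fun do rewrite E.
(* For [0 < t <= 1] the density is at most [expR |e w|]; the prefactor cancels the normalizations of
   the densities at 1 and -1. *)
pose g w := expR (`|j e| ^+ 2 / 2) * (cm_density 1 w + cm_density (-1) w).
apply: (dominated_Rcvg (g := g)) => //.
- by move=> n; apply: measurable_funM => //; exact: measurable_cm_density.
- by apply: integrable_EFinZ; exact: integrable_EFinD.
- move=> n w; have /andP[tn0 tn1] := t01 n.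
  rewrite normrM (ger0_norm (cm_density_ge0 _ _ _ _)).
  apply: (@le_trans _ _ (cm_density (t n) w)).
    rewrite ler_piMl ?cm_density_ge0// indicE; case: (_ \in _); by rewrite ?normr1 ?normr0.
  rewrite /g /cm_density mulrDr -!expRD sqrrN expr1n !mul1r mulN1r.
  rewrite [_ / 2 + (e _ - _)]addrC subrK [_ / 2 + (- e _ - _)]addrC subrK.
  apply: le_trans (expR_norm_le _); rewrite ler_expR.
  apply: le_trans (_ : _ <= t n * e (w : W)) _.
    by rewrite gerBl divr_ge0// mulr_ge0// sqr_ge0.
  apply: le_trans (ler_norm _) _; rewrite normrM (gtr0_norm tn0).
  by rewrite ler_piMl.
- move=> w; rewrite -[X in _ --> X]mulr1; apply: cvgM; first exact: cvg_cst.
  have -> : 1 = expR (0 * e (w : W) - 0 * `|j e| ^+ 2 / 2) :> R by rewrite !mul0r subrr expR0.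
  apply: continuous_cvg; first exact: continuous_expR.
  apply: cvgB; first by apply: cvgMl.
  apply: cvgMl; apply: cvgMl; rewrite -(mul0r (0 : R)).
  by under eq_fun do rewrite expr2; exact: cvgM.
Qed.

(** The sets with this property form a sigma-algebra containing the open sets. Open sets are clear
    pointwise. For complements, exits and entrances differ by the change in mass of the translated
    set, which tends to 0 by [indic_shift_cvg]. Countable unions are approximated by finite ones. *)
Lemma exit_cvg0 A : measurable A -> \int[muW]_w exit A n w @[n --> \oo] --> 0.
Proof.
pose C A := measurable A /\ \int[muW]_w exit A n w @[n --> \oo] --> 0.
suff : (@open W).-sigma.-measurable `<=` C by move=> h mA; exact: (h A mA).2.
have h0 : \int[muW]_w (0 : R) = 0 by rewrite /Rintegral integral0.
have C0 : C set0.
  split; first exact: measurable0.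
  rewrite (_ : (fun n => _) = fun=> 0); first exact: cvg_cst.
  apply/funext => n; rewrite -[RHS]h0; apply: eq_Rintegral => w _.
  by rewrite /exit indicE in_set0 mul0r.
have CU B1 B2 : C B1 -> C B2 -> C (B1 `|` B2).
  move=> [m1 c1] [m2 c2]; have mU : measurable (B1 `|` B2) by exact: measurableU.
  split => //; apply: (@squeeze_cvgr _ _ _ _ (fun=> 0) (fun n => \int[muW]_w exit B1 n w + \int[muW]_w exit B2 n w)).
  - near=> n; apply/andP; split; first by apply: Rintegral_ge0 => w _; exact: exit_ge0.
    rewrite -RintegralD//; [|exact: (bm_integrable muW (bm_exit n _))..].
    apply: le_Rintegral => //; first exact: (bm_integrable muW (bm_exit n mU)).
      exact: (bm_integrable muW (bmD (bm_exit n m1) (bm_exit n m2))).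
    move=> w _; rewrite /exit !indicE !in_setU.
    by do 4 case: (_ \in _) => /=; rewrite ?subrr ?subr0 ?mulr0 ?mul0r ?mulr1; lra.
  - exact: cvg_cst.
  - by rewrite -(addr0 0); exact: cvgD.
apply: smallest_sub; last first.
  move=> U oU; have mU : measurable (U : set (borel W)) by exact: sub_sigma_algebra.
  split => //; rewrite -[X in _ --> X]h0.
  apply: (bounded_cvg (M := 1)).
  - by move=> n; case: (bm_exit n mU).
  - exact: measurable_cst.
  - by move=> n w; exact: exit_le1.
  - move=> w; have [wU|nwU] := boolP (w \in U); last first.
      by rewrite /exit indicE (negbTE nwU); under eq_fun do rewrite mul0r; exact: cvg_cst.
    apply: cvg_near_cst.
    have : cm_shift (t n) w @[n --> \oo] --> (w : W).
      rewrite -[X in _ --> X]addr0 -(scale0r (i (j e))).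
      by apply: cvgD; [exact: cvg_cst|apply: cvgZr_tmp].
    move=> /(_ U); rewrite /nbhs /=.
    have nU : nbhs (w : W) U by apply: open_nbhs_nbhs; split => //; exact: set_mem.
    move=> /(_ nU); apply: filterS => n; rewrite /preimage /= => hU.
    by rewrite /exit !indicE wU (mem_set hU) subrr mulr0.
split => //.
- move=> A' [mA' cA']; rewrite setTD; have mC : measurable (~` A' : set (borel W)) by exact: measurableC.
  split => //.
  have E n : \int[muW]_w exit (~` A') n w =
      (\int[muW]_w (\1_A' (cm_shift (t n) w) : R) - \int[muW]_w (\1_A' w : R)) + \int[muW]_w exit A' n w.
    have i1 := bm_integrable muW (bmS n mA'); have i2 := bm_integrable muW (bm_indic R mA').
    have i3 := bm_integrable muW (bm_exit n mA').
    rewrite -RintegralB// -RintegralD//; last exact: integrable_EFinB.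
    apply: eq_Rintegral => w _; rewrite /exit !indicE !in_setC.
    by do 2 case: (_ \in _) => /=; ring.
  have -> : (fun n => \int[muW]_w exit (~` A') n w) = (fun n =>
      (\int[muW]_w (\1_A' (cm_shift (t n) w) : R) - \int[muW]_w (\1_A' w : R)) + \int[muW]_w exit A' n w).
    exact/funext.
  rewrite -(addr0 0); apply: cvgD => //.
  rewrite -(subrr (\int[muW]_w (\1_A' w : R))); apply: cvgB; last exact: cvg_cst.
  exact: indic_shift_cvg.
- move=> F FP; have mF n : measurable (F n : set (borel W)) := (FP n).1.
  have mU : measurable (\bigcup_n F n : set (borel W)) by exact: bigcup_measurable.
  split => //; pose U n : set (borel W) := \big[setU/set0]_(k < n) F k.
  have CUn n : C (U n).
    by elim: n => [|n IH]; rewrite /U ?big_ord0// big_ord_recr; exact: CU.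
  have mUn n : measurable (U n) := (CUn n).1.
  pose V : set (borel W) := \bigcup_n F n.
  have UE w K : \1_(U K) w <= \1_V w :> R.
    rewrite !indicE; have [wU|_] := boolP (w \in U K); last exact: ler0n.
    rewrite mem_set//.
    by move/set_mem: wU; rewrite /U -bigcup_mkord => -[k _ Fk]; exists k.
  have Ucvg : \int[muW]_w (\1_V w - \1_(U K) w : R) @[K --> \oo] --> 0.
    rewrite -[X in _ --> X]h0; apply: (bounded_cvg (M := 1)).
    - by move=> K; case: (bmB (bm_indic R mU) (bm_indic R (mUn K))).
    - exact: measurable_cst.
    - by move=> K w; rewrite !indicE; do 2 case: (_ \in _); rewrite ?subrr ?subr0 ?sub0r ?normrN ?normr1 ?normr0.
    - move=> w; apply: cvg_near_cst.
      have [[k _ Fk]|nF] := pselect ((\bigcup_n F n) w).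
        exists k.+1 => // K /= kK; rewrite !indicE !mem_set ?subrr//; last by exists k.
        by rewrite /U -bigcup_mkord; exists k.
      exists 0%N => // K _; rewrite !indicE (memNset nF) memNset ?subrr//.
      by rewrite /U -bigcup_mkord => -[k _ Fk]; apply: nF; exists k.
  apply/cvgrPdist_le => eps e0; have e2 : 0 < eps / 2 by rewrite divr_gt0.
  move/cvgrPdist_le: Ucvg => /(_ _ e2) [K _ /(_ K (leqnn K))] /=; rewrite sub0r normrN => hK.
  have [_ /cvgrPdist_le /(_ _ e2)] := CUn K; apply: filterS => n; rewrite !sub0r !normrN => hn.
  rewrite [leRHS](splitr eps); apply: le_trans (lerD (le_trans (ler_norm _) hn) (le_trans (ler_norm _) hK)).
  rewrite ger0_norm; last by apply: Rintegral_ge0 => w _; exact: exit_ge0.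
  have bU := bmB (bm_indic R mU) (bm_indic R (mUn K)).
  rewrite -RintegralD//; [|exact: (bm_integrable muW (bm_exit n _))|exact: (bm_integrable muW bU)].
  apply: le_Rintegral => //; first exact: (bm_integrable muW (bm_exit n mU)).
    exact: (bm_integrable muW (bmD (bm_exit n (mUn K)) bU)).
  move=> w _; rewrite /exit; have := UE w K; have := UE (cm_shift (t n) w) K.
  by rewrite !indicE; do 4 case: (_ \in _) => /=; lra.
Unshelve. all: by end_near. Qed.

End translation_of_sets.

(** * Chain rule for local gradients *)

Section chain_rule.
Variables (R : realType) (W H : completeNormedModType R).
Variables (ip : {dot H for (@idfun R)}) (i : {linear H -> W}) (j : dual W -> H).
Variables (muW : probability (borel W) R).
Hypothesis Haws : abstract_wiener_space ip i j muW.
Variable e : dual W.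
Implicit Types (w : borel W) (A : set (borel W)).

Notation cm_shift := (cm_shift i j e).
Notation L1_derivative := (L1_derivative i j muW e).
Notation t n := (n.+1%:R^-1 : R).

Definition slope_error (F g : borel W -> R) n w := `|(F (cm_shift (t n) w) - F w) / t n - g w|.

Lemma measurable_slope_error F g n : measurable_fun setT F -> measurable_fun setT g ->
  measurable_fun setT (slope_error F g n).
Proof.
move=> mF mg; apply: measurableT_comp => //; apply: measurable_funB => //.
apply: measurable_funM => //; apply: measurable_funB => //.
exact: (measurable_comp_shift Haws e _ mF).
Qed.

Lemma slope_error_small F g : measurable_fun setT F -> measurable_fun setT g ->
  L1_derivative F g -> forall eps : R, 0 < eps -> exists N, forall n, (N <= n)%N ->
  (\int[muW]_w (slope_error F g n w)%:E <= eps%:E)%E.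
Proof.
move=> mF mg dF eps e0; have [d d0 hd] := dF eps e0.
have [N _ hN] := near_infty_natSinv_lt (PosNum d0).
exists N => n Nn; have t0 : 0 < t n by rewrite invr_gt0.
have td : 0 < t n <= d by rewrite t0/= ltW//; exact: (hN n Nn).
have := hd _ td; rewrite mulrC EFinM -lee_pdivrMl// => h; apply: le_trans h.
rewrite -ge0_integralZl_real ?invr_ge0 ?(ltW t0)//.
  rewrite le_eqVlt; apply/orP; left; apply/eqP; apply: eq_integral => w _; congr EFin.
  rewrite /slope_error -[X in X * `|_|](@gtr0_norm _ (t n)^-1) ?invr_gt0// -normrM.
  have fe (x a b c : R) : x != 0 -> (a - b) / x - c = x^-1 * (a - b - x * c) by move=> x0; field.
  by rewrite fe// gt_eqF.
apply: measurableT_comp => //; apply: measurable_funB; last exact: measurable_funM.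
by apply: measurable_funB => //; exact: (measurable_comp_shift Haws e _ mF).
Qed.

Variables (l m : borel W -> R) (phi dphi : R -> R).
Hypotheses (ml : measurable_fun setT l) (mm : measurable_fun setT m).
Hypothesis dl : L1_derivative l m.
Hypothesis mphi : measurable_fun setT (fun w => phi (l w)).
Hypothesis phi_derive : forall a : R, 0 < a -> is_derive a (1 : R) phi (dphi a).

(* Almost every point of the set where F = phi o l stays in that set under infinitely many of the small
   shifts t n, so that the slopes of F and of l can be compared there. *)
Lemma local_chain_rule A (F g : borel W -> R) : measurable A ->
  measurable_fun setT F -> measurable_fun setT g -> L1_derivative F g ->
  {ae muW, forall w, A w -> F w = phi (l w) -> 0 < l w -> g w = dphi (l w) * m w}.
Proof.
move=> mA mF mg dF.
pose B : set (borel W) := A `&` [set w | F w = phi (l w)].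
have mB : measurable B.
  apply: measurableI => //; rewrite (_ : [set w | _] = (fun w => F w - phi (l w)) @^-1` [set 0]).
    rewrite -[X in measurable X]setTI.
    by apply: (measurable_funB mF mphi) => //; exact: measurable_set1.
  apply/seteqP; split => w /=; first by move=> ->; rewrite subrr.
  by move/eqP; rewrite subr_eq0 => /eqP.
(* The three errors are added so that a single index makes all of them small at once. *)
pose X n w := slope_error l m n w + (slope_error F g n w + exit i j e B n w).
have s0 (f1 f2 : borel W -> R) n w : 0 <= slope_error f1 f2 n w by exact: normr_ge0.
have x0 n w := exit_ge0 i j e B n w.
have m1 n := measurable_slope_error n ml mm.
have m2 n := measurable_slope_error n mF mg.
have m3 n : measurable_fun setT (exit i j e B n) by case: (bm_exit Haws e n mB).
have m23 n : measurable_fun setT (fun w => slope_error F g n w + exit i j e B n w) by exact: measurable_funD.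
have x23 n w : 0 <= slope_error F g n w + exit i j e B n w by rewrite addr_ge0.
have mX n : measurable_fun setT (X n) by exact: measurable_funD.
have X0 n w : 0 <= X n w by rewrite addr_ge0.
have Xs : forall eps : R, 0 < eps -> exists N, forall n, (N <= n)%N -> (\int[muW]_w (X n w)%:E <= eps%:E)%E.
  move=> eps e0; have e3 : 0 < eps / 3 by rewrite divr_gt0.
  have [N1 h1] := slope_error_small ml mm dl e3.
  have [N2 h2] := slope_error_small mF mg dF e3.
  have /cvgrPdist_le /(_ _ e3)[N3 _ h3] := exit_cvg0 Haws e mB.
  exists (maxn N1 (maxn N2 N3)) => n; rewrite !geq_max => /and3P[n1 n2 n3].
  rewrite (ge0_integralD_real muW (s0 l m n) (x23 n) (m1 n) (m23 n)).
  rewrite (ge0_integralD_real muW (s0 F g n) (x0 n) (m2 n) (m3 n)).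
  rewrite (_ : eps = eps / 3 + (eps / 3 + eps / 3)); last by field.
  rewrite !EFinD; apply: leeD; [exact: h1|apply: leeD; first exact: h2].
  rewrite -(EFin_Rintegral (bm_integrable muW (bm_exit Haws e n mB))) lee_fin.
  by have := h3 n n3; rewrite sub0r normrN; apply: le_trans; exact: ler_norm.
have := ae_recurrent_small mX X0 Xs; apply: filterS => w hw Aw Fw lw.
have Bw : B w by split.
apply: (slope_limit (phi_derive lw) (t := fun n => t n) (b := fun n => l (cm_shift (t n) w))).
- by move=> n; rewrite invr_gt0.
- exact: cvg_harmonic.
- move=> eps e0 N.
  (* At a point of [B] the exit term is 0 or 1; a total below 1 therefore means that the translate
     is still in [B], where [F = phi (l w)] again holds. *)
  have e1 : 0 < Num.min 1 eps by rewrite lt_min ltr01.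
  have [n Nn] := hw _ e1 N; rewrite lt_min => /andP[hn1 hn2].
  have a1 := s0 l m n w; have a2 := s0 F g n w; have a3 := x0 n w.
  have BS : B (cm_shift (t n) w).
    apply: contrapT => nB; move: hn1; rewrite /X /exit !indicE (mem_set Bw) (memNset nB).
    by rewrite mulr1n mulr0n subr0 mulr1; lra.
  exists n; split => //.
    by move: hn2; rewrite /X -/(slope_error l m n w); lra.
  rewrite -Fw; have [_ /= <-] := BS.
  by move: hn2; rewrite /X -/(slope_error F g n w); lra.
Qed.

(** The pieces [A k] cover almost every point and are countable, so the local identities combine
    outside one null set. *)
Lemma malliavin_chain_rule (G : W -> H) : malliavin_gradient j muW (fun w => phi (l w)) G ->
  {ae muW, forall w, 0 < l w -> ip (G w) (j e) = dphi (l w) * m w}.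
Proof.
move=> [mG [A [F_ [G_ [mA Acov LG AE]]]]].
have h k : {ae muW, forall w, A k w -> 0 < l w -> ip (G w) (j e) = dphi (l w) * m w}.
  have [mF mGk _] := LG k.
  have mg : measurable_fun setT (fun w : borel W => ip (G_ k w) (j e) : R).
    by apply: (measurableT_comp (measurable_ip Haws (j e))).
  have c1 := local_chain_rule (mA k) mF mg (L2_gradient_L1_derivative Haws e (LG k)).
  have c2 := AE k.
  apply: filterS2 c1 c2 => w h1 h2 Aw lw; have [FE GE] := h2 Aw.
  by rewrite -GE; exact: h1.
have := ae_foralln h => h'; apply: filterS2 Acov h' => w [k _ Aw] hk.
exact: (hk k Aw).
Qed.

End chain_rule.

(** * The restricted logarithmic Sobolev inequality *)

Section likelihood_ratio_entropy.
Variables (R : realType) (W H : completeNormedModType R).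
Variables (ip : {dot H for (@idfun R)}) (i : {linear H -> W}) (j : dual W -> H).
Variables (muW : probability (borel W) R) (muX : probability (borel H) R) (rho : R).
Variable l : borel W -> R.
Hypothesis Haws : abstract_wiener_space ip i j muW.
Hypothesis Hx : admissible_input ip j muX.
Hypothesis Hl : likelihood_ratio i muW muX rho l.
Implicit Types (e : dual W) (f : borel W -> R) (A : set (borel W)).

Notation Q := (prod_prob muX muW).
Notation Y := (channel i rho).
Notation signal := (signal ip j rho).

Let ml : measurable_fun setT l. Proof. by case: Hl. Qed.
Let l0 w : 0 <= l w. Proof. by case: Hl. Qed.

Let density A : measurable A -> Q (Y @^-1` A) = (\int[muW]_(w in A) (l w)%:E)%E.
Proof. by move=> mA; case: Hl => _ _ <-. Qed.

Let l_mass : (\int[muW]_w (l w)%:E = 1)%E.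
Proof. by rewrite -density// preimage_setT; exact: (probability_setT Q). Qed.

Lemma likelihood_ratio_integrable : muW.-integrable setT (EFin \o l).
Proof. by apply: ge0_integrable => //; rewrite l_mass ltry. Qed.

Let il := likelihood_ratio_integrable.

Let signal_exp e (t : R) : muX.-integrable setT (EFin \o (fun x => expR (t * signal e x))).
Proof.
have := Hx.2 (t * rho) e; congr (_.-integrable _ _).
by apply/funext => x /=; rewrite /signal mulrA.
Qed.

Let mY : measurable_fun setT Y := measurable_channel (muW := muW) rho Haws.

(* m / l is the expected signal given the output; the Radon-Nikodym derivative m is
   normalized to vanish where l does. *)
Lemma exists_score e : exists m : borel W -> R,
  [/\ muW.-integrable setT (EFin \o m), forall w, l w = 0 -> m w = 0 &
   forall A, measurable A -> (\int[Q]_(z in Y @^-1` A) (signal e z.1)%:E = \int[muW]_(w in A) (m w)%:E)%E].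
Proof.
have [m im mE] := exists_density_derivative Haws (signal_exp e) il density.
pose B : set (borel W) := [set w | 0 < l w].
have mB : measurable B by exact: measurable_lt (measurable_cst _) ml.
have iu := integrable_fst muW (signal_integrable Haws (signal_exp e)).
exists (fun w => \1_B w * m w); split.
- exact: bm_integrableM (bm_indic R mB) im.
- by move=> w lw; rewrite indicE memNset ?mul0r// /B /= lw ltxx.
- move=> A mA; have mN : measurable (A `\` B) by exact: measurableD.
  (* The output avoids the zeros of [l] almost surely, so cutting [m] off there keeps the
     identity. *)
  have N0 : Q (Y @^-1` (A `\` B)) = 0%E.
    rewrite density//; apply: integral0_eq => w [_ /= /negP].
    by rewrite -leNgt => lw; congr EFin; apply/eqP; rewrite eq_le lw l0.
  rewrite (negligible_integral (measurable_preimage mY mN) (measurable_preimage mY mA) (integrableS measurableT (measurable_preimage mY mA) (@subsetT _ _) iu) N0).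
  rewrite (_ : Y @^-1` A `\` Y @^-1` (A `\` B) = Y @^-1` (A `&` B)); last first.
    apply/seteqP; split => z /=; last by move=> [Az Bz]; split=> // -[].
    by move=> [Az nz]; split => //; apply: contrapT => nB; apply: nz.
  have mAB : measurable (A `&` B) by exact: measurableI.
  rewrite mE// -(integral_indicM muW m mAB) -(integral_indicM muW _ mA).
  by apply: eq_integral => w _; rewrite indicI mulrA.
Qed.

Variables (phi dphi kappa : R -> R) (G : W -> H).
Hypothesis mphi : measurable_fun setT (fun w => phi (l w)).
Hypothesis mkappa : measurable_fun setT (fun w => kappa (l w)).
Hypothesis phi_derive : forall a : R, 0 < a -> is_derive a (1 : R) phi (dphi a).
Hypothesis kappaE : forall a : R, 0 < a -> a * kappa a * dphi a = 1.
Hypothesis HG : malliavin_gradient j muW (fun w => phi (l w)) G.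

(** [kappaE] says that [kappa * phi'] is the derivative of [ln], so where [l] is positive [S] is the
    gradient of [ln l] whatever [phi] is. The logarithm has [kappa = 1], the square root of [c * l]
    has [kappa = 2 / sqrt (c * l)]. *)
Let S w : borel H := kappa (l w) *: G w.

Let mSe e : measurable_fun setT (fun w => ip (S w : H) (j e) : R).
Proof.
rewrite (_ : (fun w => _) = (fun w => kappa (l w) * ip (G w) (j e))).
  by apply: measurable_funM => //; apply: (measurableT_comp (measurable_ip Haws (j e))); case: HG.
by apply/funext => w; rewrite /S ipZl.
Qed.

Let mSn : measurable_fun setT (fun w => `|S w : H|).
Proof.
rewrite (_ : (fun w => _) = (fun w => `|kappa (l w)| * `|G w|)).
  apply: measurable_funM; first exact: measurableT_comp.
  apply: (measurableT_comp (f := fun h : borel H => `|h : H|)); last by case: HG.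
  by apply: continuous_borel_measurable => h; exact: norm_continuous.
by apply/funext => w; rewrite /S normrZ.
Qed.

(** The chain rule covers the points where [l] is positive; at its zeros both sides vanish by the
    normalization of [m]. *)
Let score_ae e (m : borel W -> R) : muW.-integrable setT (EFin \o m) ->
  (forall w, l w = 0 -> m w = 0) ->
  (forall A, measurable A -> (\int[Q]_(z in Y @^-1` A) (signal e z.1)%:E = \int[muW]_(w in A) (m w)%:E)%E) ->
  {ae muW, forall w, l w * ip (S w : H) (j e) = m w}.
Proof.
move=> im m0 mE.
have dl := density_L1_derivative Haws (signal_exp e) l0 il density im mE.
have := malliavin_chain_rule Haws ml (integrable_measurable im) dl mphi phi_derive HG.
apply: filterS => w h; have [lw|] := ltP 0 (l w).
  by rewrite /S ipZl (h lw) mulrA mulrA kappaE// mul1r.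
by rewrite le_eqVlt ltNge l0 orbF => /eqP lw; rewrite lw mul0r m0.
Qed.

Lemma entropy_le_information :
  (\int[muW]_w (Psi (l w))%:E <= 2^-1%:E * \int[muW]_w (l w * `|S w : H| ^+ 2)%:E)%E.
Proof.
have [->|fin] := eqVneq (\int[muW]_w (l w * `|S w : H| ^+ 2)%:E)%E +oo%E.
  by rewrite gt0_muley ?leey// lte_fin invr_gt0.
have I0 : (0 <= \int[muW]_w (l w * `|S w : H| ^+ 2)%:E)%E.
  by apply: integral_ge0 => w _; rewrite lee_fin mulr_ge0// sqr_ge0.
have Ifin : (\int[muW]_w (l w * `|S w : H| ^+ 2)%:E)%E \is a fin_num.
  by rewrite ge0_fin_numE// lt_neqAle fin leey.
pose K := 2^-1 * fine (\int[muW]_w (l w * `|S w : H| ^+ 2)%:E).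
have KE : (2^-1%:E * \int[muW]_w (l w * `|S w : H| ^+ 2)%:E = K%:E)%E by rewrite EFinM fineK.
rewrite KE; apply: (entropy_of_duality l0 il) => f bf.
have sc e : muW.-integrable setT (EFin \o (fun w => l w * ip (S w : H) (j e))) /\
    forall f, bounded_measurable f ->
    \int[Q]_z (f (Y z) * signal e z.1) = \int[muW]_w (f w * (l w * ip (S w : H) (j e))).
  have [m [im m0 mE]] := exists_score e.
  have ae := score_ae im m0 mE.
  have mm := integrable_measurable im.
  have mp : measurable_fun setT (fun w => l w * ip (S w : H) (j e)) by exact: measurable_funM.
  split.
    apply/integrableP; split; first exact/measurable_EFinP.
    have /integrableP[_] := im; apply: le_lt_trans; rewrite le_eqVlt; apply/orP; left; apply/eqP.
    apply: ae_eq_integral => //; try by apply/measurable_EFinP; exact: measurableT_comp.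
    by apply: filterS ae => w h _; rewrite /= h.
  move=> g bg; have [mg _] := bg.
  rewrite (bm_transfer mY (integrable_fst muW (signal_integrable Haws (signal_exp e))) im mE bg).
  rewrite /Rintegral; congr fine; apply: ae_eq_integral => //.
  - by apply/measurable_EFinP; exact: measurable_funM.
  - by apply/measurable_EFinP; exact: measurable_funM.
  - by apply: filterS ae => w h _; rewrite h.
apply: (duality Haws _ l0 il _ mSe mSn (fun e => (sc e).1) (fun e => (sc e).2)) => //.
- by move=> e; exact: (signal_integrable Haws (signal_exp e)).
- move=> g bg; have i1 := bm_integrable Q (bm_cst _ (1 : R)).
  have h A : measurable A -> (\int[Q]_(z in Y @^-1` A) (1%R)%:E = \int[muW]_(w in A) (l w)%:E)%E.
    move=> mA; rewrite integral_cst ?mul1e; first exact: density.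
    exact: measurable_preimage.
  by rewrite -(bm_transfer mY i1 il h bg); apply: eq_Rintegral => z _; rewrite mulr1.
- by rewrite KE.
Qed.

(** Since [l] has mean 1, the correction [- l + 1] integrates to 0; integrability of [l ln l] comes
    with the bound on the nonnegative [Psi (l w)]. *)
Lemma entropy_of_Psi (K : R) : (\int[muW]_w (Psi (l w))%:E <= K%:E)%E ->
  muW.-integrable setT (EFin \o (fun w => l w * ln (l w))) /\
  \int[muW]_w (l w * ln (l w)) <= K.
Proof.
move=> PK; have mP : measurable_fun setT (fun w => Psi (l w)).
  exact: measurableT_comp (@measurable_Psi R) ml.
have P0 w : 0 <= Psi (l w).
  have [lw|] := ltP 0 (l w); first exact: Psi_ge0.
  by rewrite le_eqVlt ltNge l0 orbF => /eqP ->; rewrite /Psi mul0r subrr add0r.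
have iP : muW.-integrable setT (EFin \o (fun w => Psi (l w))).
  by apply: ge0_integrable => //; apply: le_lt_trans PK _; rewrite ltry.
have i1 := bm_integrable muW (bm_cst _ (1 : R)).
have ilm1 : muW.-integrable setT (EFin \o (fun w => l w - 1)) by exact: integrable_EFinB.
have E w : l w * ln (l w) = Psi (l w) + (l w - 1) by rewrite /Psi; ring.
have l1 : \int[muW]_w l w = 1 by rewrite /Rintegral l_mass.
split.
  by under eq_fun do rewrite E; exact: integrable_EFinD.
under eq_Rintegral do rewrite E.
rewrite RintegralD// RintegralB// l1 Rintegral_prob_cst subrr addr0.
by rewrite -lee_fin (EFin_Rintegral iP).
Qed.

End likelihood_ratio_entropy.

Lemma ln_sqrt (R : realType) (x : R) : 0 < x -> ln (Num.sqrt x) = ln x / 2.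
Proof.
move=> x0; have := lnXn 2 (x := Num.sqrt x); rewrite sqrtr_gt0 => /(_ x0).
by rewrite sqr_sqrtr ?(ltW x0)// mulr2n => ->; lra.
Qed.

Theorem mainTheorem6 (R : realType) (W H : completeNormedModType R)
    (ip : {dot H for (@idfun R)}) (i : {linear H -> W}) (j : dual W -> H)
    (muW : probability (borel W) R) (muX : probability (borel H) R)
    (rho : R) (l : W -> R)
    (Haws : abstract_wiener_space ip i j muW)
    (Hx : admissible_input ip j muX)
    (Hl : likelihood_ratio i muW muX rho l) :
  (forall dlogl : W -> H,
     malliavin_gradient j muW (fun w => ln (l w)) dlogl ->
     (\int[muW]_w (l w * ln (l w))%:E
        <= (2^-1)%:E * \int[muW]_w (l w * `|dlogl w| ^+ 2)%:E)%E) /\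
  (forall (c : R) (f : W -> R) (df : W -> H), 0 < c ->
     f = (fun w => Num.sqrt (c * l w)) ->
     malliavin_gradient j muW f df ->
     (\int[muW]_w (f w ^+ 2 * ln `|f w|)%:E
        <= (\int[muW]_w (f w ^+ 2)%:E) *
             (ln (Num.sqrt (fine (\int[muW]_w (f w ^+ 2)%:E))))%:E
           + \int[muW]_w (`|df w| ^+ 2)%:E)%E).
Proof.
have [ml l0 _] := Hl; have il := likelihood_ratio_integrable Hl.
have l1 : (\int[muW]_w (l w)%:E = 1)%E.
  case: Hl => _ _ h; rewrite -h// /output_law /pushforward preimage_setT.
  exact: (probability_setT (prod_prob muX muW)).
split.
  move=> G HG.
  have [->|fin] := eqVneq (\int[muW]_w (l w * `|G w| ^+ 2)%:E)%E +oo%E.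
    by rewrite gt0_muley ?leey// lte_fin invr_gt0.
  have I0 : (0 <= \int[muW]_w (l w * `|G w| ^+ 2)%:E)%E.
    by apply: integral_ge0 => w _; rewrite lee_fin mulr_ge0// sqr_ge0.
  have Ifin : (\int[muW]_w (l w * `|G w| ^+ 2)%:E)%E \is a fin_num.
    by rewrite ge0_fin_numE// lt_neqAle fin leey.
  have mln : measurable_fun setT (fun w : borel W => ln (l w)) by exact: measurableT_comp.
  have kE (a : R) : 0 < a -> a * 1 * a^-1 = 1 by move=> a0; rewrite mulr1 divff ?gt_eqF.
  have mk1 : measurable_fun [set: borel W] (fun=> 1 : R) by exact: measurable_cst.
  have := entropy_le_information Haws Hx Hl (kappa := fun=> 1) mln mk1 (@is_derive1_ln R) kE HG.
  under [X in (_ <= _ * X)%E -> _]eq_integral do rewrite scale1r.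
  rewrite -(fineK Ifin) -EFinM => /(entropy_of_Psi Hl)[iE].
  by rewrite -lee_fin (EFin_Rintegral iE).
move=> c f df c0 fE Hf.
have fw w : f w = Num.sqrt (c * l w) by rewrite fE.
have f2 w : f w ^+ 2 = c * l w by rewrite fw sqr_sqrtr// mulr_ge0// ltW.
have f2int : (\int[muW]_w (f w ^+ 2)%:E = c%:E)%E.
  under eq_integral do rewrite f2.
  by rewrite ge0_integralZl_real ?(ltW c0)// l1 mule1.
rewrite f2int /=.
have [->|fin] := eqVneq (\int[muW]_w (`|df w| ^+ 2)%:E)%E +oo%E.
  by rewrite -EFinM addey ?leey.
have I0 : (0 <= \int[muW]_w (`|df w| ^+ 2)%:E)%E.
  by apply: integral_ge0 => w _; rewrite lee_fin sqr_ge0.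
have Ifin : (\int[muW]_w (`|df w| ^+ 2)%:E)%E \is a fin_num.
  by rewrite ge0_fin_numE// lt_neqAle fin leey.
(* For [a > 0] the weight [2 / root a] is the [kappa] of [sqrt (c * a)]. The value 1 elsewhere keeps
   [root] positive, as its measurable inverse requires. *)
pose root (a : R) := if 0 < a then Num.sqrt (c * a) else 1.
have root0 a : 0 < root a by rewrite /root; case: ifP => // a0; rewrite sqrtr_gt0 mulr_gt0.
have msq : measurable_fun setT (fun w : borel W => Num.sqrt (c * l w)).
  have := Hf; rewrite fE => -[_ _].
  apply: (measurableT_comp (f := @Num.sqrt R)); last exact: measurable_funM.
  by apply: continuous_measurable_fun; exact: sqrt_continuous.
have mk : measurable_fun setT (fun w : borel W => 2 / root (l w)).
  apply: measurable_funM => //; apply: measurable_inv_gt0 => [|w]; last exact: root0.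
  rewrite /root; apply: measurable_fun_ifT => //.
  exact: measurable_fun_ltr.
have dphi (a : R) : 0 < a -> is_derive a (1 : R) (fun a => Num.sqrt (c * a)) (c / (2 * Num.sqrt (c * a))).
  move=> a0; have ca0 : 0 < c * a by rewrite mulr_gt0.
  have d1 : is_derive a (1 : R) ( *%R c) c.
    by apply: is_derive_eq; rewrite /GRing.scale /= mulr1.
  have := is_derive1_comp (is_derive1_sqrt ca0) d1.
  by rewrite mulrC.
have kE (a : R) : 0 < a -> a * (2 / root a) * (c / (2 * Num.sqrt (c * a))) = 1.
  move=> a0; rewrite /root a0; have ca0 : 0 < c * a by rewrite mulr_gt0.
  have s0 : 0 < Num.sqrt (c * a) by rewrite sqrtr_gt0.
  have s2 : Num.sqrt (c * a) * Num.sqrt (c * a) = c * a by rewrite -expr2 sqr_sqrtr// ltW.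
  rewrite (_ : _ * _ = c * a / (Num.sqrt (c * a) * Num.sqrt (c * a))).
    by rewrite s2 divff// gt_eqF.
  by field; rewrite gt_eqF.
rewrite fE in Hf.
have := entropy_le_information Haws Hx Hl msq mk dphi kE Hf.
set I := (\int[muW]_w (`|df w| ^+ 2)%:E)%E in fin I0 Ifin *.
(* Where [l > 0] the weight satisfies [l * kappa^2 = 4 / c]. Zeros of [l] contribute nothing on the
   left, hence only an inequality. *)
have Kle : (2^-1%:E * \int[muW]_w (l w * `|(2 / root (l w)) *: df w| ^+ 2)%:E <= (2 / c * fine I)%:E)%E.
  rewrite EFinM fineK//.
  apply: (@le_trans _ _ (2^-1%:E * \int[muW]_w (4 / c * `|df w| ^+ 2)%:E)%E).
    apply: lee_wpmul2l => //; apply: ge0_le_integral_outer => w.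
    rewrite mulr_ge0 ?sqr_ge0//= normrZ exprMn mulrA ler_wpM2r ?sqr_ge0//.
    rewrite ger0_norm ?divr_ge0 ?(ltW (root0 _))// /root.
    have [lw|lw] := ltP 0 (l w).
      rewrite expr_div_n sqr_sqrtr ?mulr_ge0 ?(ltW c0)//.
      rewrite (_ : _ * _ = 4 / c)//; field.
      by rewrite !gt_eqF.
    have -> : l w = 0 by apply/eqP; rewrite eq_le lw l0.
    by rewrite mul0r divr_ge0// ltW.
  rewrite ge0_integralZl_real ?divr_ge0 ?(ltW c0)//.
  - by rewrite muleA -EFinM (_ : 2^-1 * (4 / c) = 2 / c)//; field; rewrite gt_eqF.
  - have [mG _] := Hf; apply: measurable_funX.
    apply: (measurableT_comp (f := fun h : borel H => `|h : H|)); last exact: mG.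
    by apply: continuous_borel_measurable => h; exact: norm_continuous.
move=> /le_trans /(_ Kle) /(entropy_of_Psi Hl)[iE hE].
(* The term in [l] integrates to [c * ln c / 2], which is the first term of the bound; the factor
   [c / 2] of [l ln l] cancels the [2 / c] in front of the gradient integral. *)
have E w : f w ^+ 2 * ln `|f w| = c * ln c / 2 * l w + c / 2 * (l w * ln (l w)).
  rewrite f2 fw ger0_norm ?sqrtr_ge0//.
  have [lw|lw] := ltP 0 (l w).
    have -> : ln (Num.sqrt (c * l w)) = (ln c + ln (l w)) / 2.
      by rewrite -lnM ?posrE// ln_sqrt// mulr_gt0.
    by field.
  have -> : l w = 0 by apply/eqP; rewrite eq_le lw l0.
  by rewrite !(mulr0, mul0r) addr0.
under eq_integral do rewrite E.
rewrite -(fineK Ifin) -EFinM -EFinD.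
have j1 := integrable_EFinZ (c * ln c / 2) il; have j2 := integrable_EFinZ (c / 2) iE.
rewrite -(EFin_Rintegral (integrable_EFinD j1 j2)) lee_fin RintegralD// !RintegralZl//.
rewrite (_ : \int[muW]_w l w = 1); last by rewrite /Rintegral l1.
rewrite ln_sqrt//.
have c2 : 0 <= c / 2 by rewrite divr_ge0// ltW.
have := ler_wpM2l c2 hE; rewrite (_ : c / 2 * (2 / c * _) = fine I).
  by lra.
by field; rewrite gt_eqF.
Qed.
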